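(* For $p\ge 3$ there is an isomorphism of $\mathrm{GL}_p(K)$-modules \[ \mathcal F_p\cong\bigoplus_{n=0}^\infty\ \bigoplus_{\nu=(\nu_1,\nu_2,\nu_3)\vdash n} m_\nu(M_3(K),so_3(K))\,W_p(\nu), \] where $m_{(2k,0,0)}(M_3(K),so_3(K))=1$ for $k\ge 1$, and for every other partition $\nu=(\nu_1,\nu_2,\nu_3)$ (at most three parts) $m_\nu(M_3(K),so_3(K))=m_\nu$ with $m_\nu$ defined by: (i) if $\nu_1\equiv\nu_2\equiv\nu_3\pmod 2$: $m_\nu=3$ if $\nu_1>\nu_2>\nu_3$; $2$ if $\nu_1=\nu_2>\nu_3$; $2$ if $\nu_1>\nu_2=\nu_3$; $1$ if $\nu_1=\nu_2=\nu_3$; (ii) if $\nu_1\equiv\nu_2\not\equiv\nu_3\pmod 2$: $m_\nu=2$ if $\nu_1>\nu_2$, $1$ if $\nu_1=\nu_2$; (iii) if $\nu_1\equiv\nu_3\not\equiv\nu_2\pmod 2$: $m_\nu=2$; (iv) if $\nu_1\not\equiv\nu_2\equiv\nu_3\pmod 2$: $m_\nu=2$ if $\nu_2>\nu_3$, $1$ if $\nu_2=\nu_3$. For $p<3$ the same formula holds after removing the summands labeled by partitions $\nu$ with more than $p$ nonzero parts.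
   Context: $K$ is a field of characteristic $0$. For $p\ge1$, $T_p=\{t^{(k)}_{ij}\mid 1\le i<j\le 3,\ 1\le k\le p\}$ are commuting indeterminates, and $t_k\in M_3(K[T_p])$ is the generic skew-symmetric matrix with zero diagonal, $(i,j)$ entry $t^{(k)}_{ij}$ and $(j,i)$ entry $-t^{(k)}_{ij}$ for $i<j$. $\mathcal F_p$ is the unital $K$-subalgebra of $M_3(K[T_p])$ generated by $t_1,\dots,t_p$. The group $\mathrm{GL}_p(K)$ acts on $K[T_p]$ by graded $K$-algebra automorphisms via $g\cdot t^{(k)}_{ij}=\sum_{l=1}^p g_{lk}t^{(l)}_{ij}$ for $g=(g_{ij})$, and on $M_3(K[T_p])$ entrywise; $\mathcal F_p$ is a $\mathrm{GL}_p(K)$-submodule. $W_p(\nu)$ denotes the irreducible polynomial $\mathrm{GL}_p(K)$-module indexed by the partition $\nu$. *)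

(* Defs.v *)
From HB Require Import structures.
From mathcomp Require Import all_boot all_order all_algebra.
From mathcomp Require Import mpoly.
Set Implicit Arguments. Unset Strict Implicit. Unset Printing Implicit Defensive.
Import Order.TTheory GRing.Theory.
Local Open Scope ring_scope.

(* K[T_p]: polynomials in the 3p variables t^{(k)}_{ij}; the variable
   t^{(k)}_{ij} (k : 'I_p, pair r : 'I_3 with (0,1)|->0,(0,2)|->1,(1,2)|->2)
   is 'X_(mxvec_index k r). *)
Section Defs.
Variable K : fieldType.
Variable p : nat.

Definition poly := {mpoly K[p * 3]}.
Definition mx3 := 'M[poly]_3.

Definition tvar (k : 'I_p) (r : 'I_3) : 'I_(p * 3) := mxvec_index k r.

Definition pairidx (i j : 'I_3) : 'I_3 := inord (i + j - 1).

Definition tgen (k : 'I_p) : mx3 :=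
  \matrix_(i < 3, j < 3)
    (if (i < j)%N then 'X_(tvar k (pairidx i j))
     else if (j < i)%N then - 'X_(tvar k (pairidx j i)) else 0).

Definition mxsc (c : K) (A : mx3) : mx3 := (c%:MP) *: A.

(* the unital K-subalgebra F_p generated by t_1..t_p:
   K-linear combinations of products of the generators (empty word = 1) *)
Definition word (w : seq 'I_p) : mx3 := \prod_(k <- w) tgen k.
Definition inFp (A : mx3) : Prop :=
  exists s : seq (K * seq 'I_p), A = \sum_(x <- s) mxsc x.1 (word x.2).

Lemma vk_proof (v : 'I_(p * 3)) : (v %/ 3 < p)%N.
Proof. by rewrite ltn_divLR // ltn_ord. Qed.
Lemma vr_proof (v : 'I_(p * 3)) : (v %% 3 < 3)%N.
Proof. by rewrite ltn_mod. Qed.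
Definition vk (v : 'I_(p * 3)) : 'I_p := Ordinal (vk_proof v).
Definition vr (v : 'I_(p * 3)) : 'I_3 := Ordinal (vr_proof v).

Definition gsubst (g : 'M[K]_p) : (p * 3).-tuple poly :=
  [tuple \sum_(l < p) (g l (vk v)) *: 'X_(tvar l (vr v)) | v < p * 3].
Definition gact_poly (g : 'M[K]_p) (q : poly) : poly := comp_mpoly (gsubst g) q.
Definition gact (g : 'M[K]_p) (A : mx3) : mx3 := map_mx (gact_poly g) A.

Definition subspace (U : mx3 -> Prop) : Prop :=
  [/\ U 0, (forall A B, U A -> U B -> U (A + B)) &
      (forall c A, U A -> U (mxsc c A))].
Definition gl_stable (U : mx3 -> Prop) : Prop :=
  forall g : 'M[K]_p, g \in unitmx -> forall A, U A -> U (gact g A).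
Definition submodule (U : mx3 -> Prop) : Prop := subspace U /\ gl_stable U.

Definition irreducible_submodule (U : mx3 -> Prop) : Prop :=
  [/\ submodule U, (exists A, U A /\ A <> 0) &
      forall V : mx3 -> Prop, submodule V -> (forall A, V A -> U A) ->
        (forall A, V A -> A = 0) \/ (forall A, U A -> V A)].

Definition part3 := (nat * nat * nat)%type.
Definition pt1 (nu : part3) := nu.1.1.
Definition pt2 (nu : part3) := nu.1.2.
Definition pt3 (nu : part3) := nu.2.
Definition ptk (nu : part3) (k : nat) : nat := nth 0%N [:: pt1 nu; pt2 nu; pt3 nu] k.

Definition valid_part (nu : part3) : bool :=
  [&& (pt2 nu <= pt1 nu)%N, (pt3 nu <= pt2 nu)%N &
      (count (fun x => x != 0%N) [:: pt1 nu; pt2 nu; pt3 nu] <= p)%N].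

(* highest weight vector of weight nu: weight nu for the diagonal torus,
   fixed by the upper unitriangular matrices (upper Borel for the
   action g . t_k = sum_l g_{lk} t_l, for which t_1 has weight (1,0,...)) *)
Definition hw_vector (nu : part3) (u : mx3) : Prop :=
  [/\ u <> 0,
      (forall d : 'rV[K]_p, (forall k, d 0 k != 0) ->
         gact (diag_mx d) u = mxsc (\prod_(k < p) d 0 k ^+ ptk nu k) u) &
      (forall g : 'M[K]_p, (forall i, g i i = 1) ->
         (forall i j : 'I_p, (j < i)%N -> g i j = 0) -> gact g u = u)].

(* U is (isomorphic to) W_p(nu): an irreducible GL_p-submodule with highest
   weight nu *)
Definition is_W (nu : part3) (U : mx3 -> Prop) : Prop :=
  irreducible_submodule U /\ exists u, U u /\ hw_vector nu u.

End Defs.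

Definition mult_nu (nu : part3) : nat :=
  let a := pt1 nu in let b := pt2 nu in let c := pt3 nu in
  if (b == 0%N) && (c == 0%N) && (0 < a)%N && ~~ odd a then 1%N
  else if (odd a == odd b) && (odd b == odd c) then
    (if (b < a)%N && (c < b)%N then 3%N
     else if (a == b) && (c < b)%N then 2%N
     else if (b < a)%N && (b == c) then 2%N
     else 1%N)
  else if (odd a == odd b) then (if (b < a)%N then 2%N else 1%N)
  else if (odd a == odd c) then 2%N
  else (if (c < b)%N then 2%N else 1%N).

Definition idxJ (p : nat) (j : part3 * nat) : bool :=
  valid_part p j.1 && (j.2 < mult_nu j.1)%N.

(* Main.v *)
(** Identify the generic skew matrix t_k with the cross product by a vector v_k, and put x = v_1,
    y = v_1 x v_2, d = det (v_1, v_2, v_3).  The unipotent-fixed matrices of F_p are combinations of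
    d^c |x|^(2m) |y|^(2n) B with B one of nine matrices built from x and y (the identity, x x^T,
    y y^T, [x], [y], x y^T, y x^T, z x^T, z y^T, where z = x x y).  Sorting these by weight gives
    m_nu vectors of weight nu; for nu = (2k, 0, 0) neither |x|^(2k) nor |x|^(2k-2) x x^T lies in F_p,
    only their difference does.

    Complete reducibility is replaced by the Fischer form, for which the adjoint of g is its
    transpose.  It is anisotropic over the rationals, and the highest weight vectors are rational,
    so each of them generates an irreducible module, and linearly independent ones generate an
    independent family of modules.

    That the sum S of these modules is all of F_p amounts to S being stable under left
    multiplication by every t_k, which has to be checked on the highest weight vectors u only.
    The lowering operators E_21, E_32, E_43 reduce t_2 u, t_3 u and t_4 u to t_1 u and to two further
    unipotent-fixed combinations, which are computed explicitly. *)
Require Import Defs.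
From Stdlib Require Classical_Prop.
From HB Require Import structures.
From mathcomp Require Import all_boot all_order all_algebra.
From mathcomp Require Import ssrcomplements mpoly.
From mathcomp Require Import ring.
Set Implicit Arguments. Unset Strict Implicit. Unset Printing Implicit Defensive.
Import GRing.Theory Num.Theory.
Local Open Scope ring_scope.

(** * The action of matrices on polynomials *)

(** The field [K] need not be ordered, so the Fischer form may be isotropic over it; positivity is
    available only over the rationals. What carries over is a descent: a [K]-combination of rational
    vectors that is orthogonal to all of them is 0. To use it on the module generated by a rational
    [u], that module must be spanned by rational vectors, which holds because matrices with natural
    entries already produce all of it. The passages from part of the group to all of it, and from
    the group to its Lie algebra, rest on one fact: if a polynomial curve lies in a subspace at
    sufficiently many natural parameters, so do its coefficients. The combinations for t_2 and t_3
    have closed forms because norms and matrices are homogeneous in [x] and [y]: Euler's relations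
    absorb the coordinates, and what remains of the third vector reassembles to a factor [d]. *)

Lemma index_allpairs (S T : eqType) (s : seq S) (t : seq T) (a : S) (b : T) :
  a \in s -> b \in t ->
  index (a, b) [seq (x, y) | x <- s, y <- t] = (index a s * size t + index b t)%N.
Proof.
move=> + bt; elim: s => [//|c s IH]; rewrite inE [index a _]/= eq_sym.
rewrite allpairs_cons index_cat.
have inj : injective (fun y : T => (c, y)) by move=> y z [].
have [<-|ne] := eqVneq c a.
  by rewrite map_f // index_map // mul0n.
move=> /= /IH ->.
case: ifP => [/mapP[y _ [eca _]]|_]; first by rewrite eca eqxx in ne.
by rewrite size_map mulSn addnA.
Qed.

(** Reconciles [tvar], which is encoded through [mxvec_index], with [vk] and [vr], which divide by
    3. *)
Lemma val_mxvec_index (m n : nat) (i : 'I_m) (j : 'I_n) :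
  mxvec_index i j = (i * n + j)%N :> nat.
Proof.
rewrite /mxvec_index /= /enum_rank enum_rank_in.unlock insubdK; last first.
  by rewrite cardE [_ \in _]index_mem mem_enum.
rewrite enumT unlock /= index_allpairs ?mem_enum //.
by rewrite !index_enum_ord size_enum_ord.
Qed.

Section Coordinates.
Variable p : nat.

Lemma tvarK (k : 'I_p) (r : 'I_3) : vk (tvar k r) = k /\ vr (tvar k r) = r.
Proof.
split; apply: val_inj; [change (tvar k r %/ 3 = k)%N|change (tvar k r %% 3 = r)%N];
  by rewrite val_mxvec_index ?divnMDl ?divn_small ?addn0 ?modnMDl ?modn_small.
Qed.

Lemma tvar_eta (v : 'I_(p * 3)) : tvar (vk v) (vr v) = v.
Proof.
apply: val_inj; change (mxvec_index (vk v) (vr v) = v :> nat).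
by rewrite val_mxvec_index /= -divn_eq.
Qed.

Lemma tvar_inj (k l : 'I_p) (r s : 'I_3) :
  (tvar k r == tvar l s) = (k == l) && (r == s).
Proof.
apply/eqP/andP => [e|[/eqP -> /eqP ->]] //.
have [k1 r1] := tvarK k r; have [k2 r2] := tvarK l s.
by move: (congr1 (@vk p) e) (congr1 (@vr p) e); rewrite k1 k2 r1 r2 => -> ->.
Qed.

End Coordinates.

(** Suits statements about ring morphisms and derivations, which then need checking on constants and
    variables only. *)
Lemma mpoly_ring_ind (n : nat) (R : comNzRingType) (P : {mpoly R[n]} -> Prop) :
  (forall c, P c%:MP) -> (forall i, P 'X_i) ->
  (forall f g, P f -> P g -> P (f + g)) ->
  (forall f g, P f -> P g -> P (f * g)) -> forall f, P f.
Proof.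
move=> hC hX hD hM; have h1 : P 1 by rewrite -mpolyC1; apply: hC.
elim/mpolyind => [|c m f _ _ Pf]; first by rewrite -mpolyC0.
apply: hD => //; rewrite -mul_mpolyC; apply: (hM) => //.
rewrite mpolyXE_id; apply: (@big_ind _ P _ _ h1 hM) => i _.
by elim: (m i) => [|k IH]; rewrite ?expr0 ?exprS //; apply: hM.
Qed.

Section Action.
Variables (K : fieldType) (p : nat).
Local Notation poly := (Defs.poly K p).
Local Notation mx3 := (mx3 K p).
Implicit Types (f : poly) (A B : mx3) (g h : 'M[K]_p) (V : mx3 -> Prop).

HB.instance Definition _ (g : 'M[K]_p) :=
  GRing.LRMorphism.copy (@gact_poly K p g) (comp_mpoly (gsubst g)).

HB.instance Definition _ (g : 'M[K]_p) :=
  GRing.RMorphism.copy (@gact K p g) (map_mx (gact_poly g)).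

Lemma gact_polyC g c : gact_poly g c%:MP = c%:MP.
Proof. exact: comp_mpolyC. Qed.

Lemma gact_polyX g (k : 'I_p) r :
  gact_poly g 'X_(tvar k r) = \sum_(l < p) (g l k)%:MP * 'X_(tvar l r).
Proof.
rewrite /gact_poly comp_mpolyXU -tnth_nth tnth_mktuple.
have [-> ->] := tvarK k r.
by apply: eq_bigr => l _; rewrite mul_mpolyC.
Qed.

Lemma gact_polyM g h f : gact_poly (g *m h) f = gact_poly g (gact_poly h f).
Proof.
elim/mpoly_ring_ind: f => [c|v|f1 f2 IH1 IH2|f1 f2 IH1 IH2];
  rewrite ?rmorphD ?rmorphM /= ?IH1 ?IH2 ?gact_polyC //.
rewrite -(tvar_eta v) !gact_polyX rmorph_sum /=.
under [RHS]eq_bigr do rewrite rmorphM /= gact_polyC gact_polyX mulr_sumr.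
rewrite exchange_big; apply: eq_bigr => l _ /=.
rewrite mxE raddf_sum mulr_suml; apply: eq_bigr => m _ /=.
by rewrite mulrA -rmorphM /= [h _ _ * _]mulrC.
Qed.

Lemma gact_poly1 f : gact_poly 1%:M f = f.
Proof.
elim/mpoly_ring_ind: f => [c|v|f1 f2 IH1 IH2|f1 f2 IH1 IH2];
  rewrite ?rmorphD ?rmorphM /= ?IH1 ?IH2 ?gact_polyC //.
rewrite -(tvar_eta v) gact_polyX (bigD1 (vk v)) //= big1 ?addr0 => [|l ne].
  by rewrite mxE eqxx mpolyC1 mul1r.
by rewrite mxE (negbTE ne) mpolyC0 mul0r.
Qed.

Lemma gactM g h A : gact (g *m h) A = gact g (gact h A).
Proof. by apply/matrixP => i j; rewrite !mxE gact_polyM. Qed.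

Lemma gact1 A : gact 1%:M A = A.
Proof. by apply/matrixP => i j; rewrite !mxE gact_poly1. Qed.

Lemma mx3D A B i j : (A + B) i j = A i j + B i j. Proof. by rewrite mxE. Qed.
Lemma mx3N A i j : (- A) i j = - A i j. Proof. by rewrite mxE. Qed.
Lemma mx3Z f A i j : (f *: A) i j = f * A i j. Proof. by rewrite mxE. Qed.
Lemma mx30 i j : (0 : mx3) i j = 0. Proof. by rewrite mxE. Qed.

Lemma mxscE c A i j : mxsc c A i j = c%:MP * A i j.
Proof. by rewrite mxE. Qed.

Lemma gact_sc g c A : gact g (mxsc c A) = mxsc c (gact g A).
Proof. by apply/matrixP => i j; rewrite !mxE rmorphM /= gact_polyC. Qed.

Lemma gactB g : {morph @gact K p g : A B / A - B}.
Proof. exact: raddfB. Qed.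

Lemma gact_mul g : {morph @gact K p g : A B / A * B}.
Proof. exact: rmorphM. Qed.

Lemma gact_sum g I (s : seq I) (P : pred I) (H : I -> mx3) :
  gact g (\sum_(i <- s | P i) H i) = \sum_(i <- s | P i) gact g (H i).
Proof. exact: raddf_sum. Qed.

Lemma mxsc1 A : mxsc 1 A = A.
Proof. by rewrite /mxsc mpolyC1 scale1r. Qed.

Lemma mxsc0 A : mxsc 0 A = 0.
Proof. by rewrite /mxsc mpolyC0 scale0r. Qed.

Lemma mxscA c d A : mxsc c (mxsc d A) = mxsc (c * d) A.
Proof. by rewrite /mxsc scalerA -mpolyCM. Qed.

Lemma mxscDl c d A : mxsc (c + d) A = mxsc c A + mxsc d A.
Proof. by rewrite /mxsc mpolyCD scalerDl. Qed.

Lemma mxsc_sumr c I (s : seq I) (F : I -> mx3) :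
  mxsc c (\sum_(i <- s) F i) = \sum_(i <- s) mxsc c (F i).
Proof. exact: scaler_sumr. Qed.

Lemma mxscN c A : mxsc (- c) A = - mxsc c A.
Proof. by rewrite /mxsc mpolyCN scaleNr. Qed.

Lemma mxscBr c A B : mxsc c (A - B) = mxsc c A - mxsc c B.
Proof. exact: scalerBr. Qed.

Lemma mxsc_suml A I (s : seq I) (F : I -> K) :
  mxsc (\sum_(i <- s) F i) A = \sum_(i <- s) mxsc (F i) A.
Proof. exact: (big_morph (@mxsc K p ^~ A) (fun c d => mxscDl c d A) (mxsc0 A)). Qed.

Section Subspace.
Variables (V : mx3 -> Prop) (hV : subspace V).

Lemma subsp0 : V 0. Proof. by case: hV. Qed.
Lemma subspD A B : V A -> V B -> V (A + B). Proof. by case: hV => _ h _; apply: h. Qed.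
Lemma subspZ c A : V A -> V (mxsc c A). Proof. by case: hV => _ _; apply. Qed.
Lemma subspN A : V A -> V (- A).
Proof. by move=> /(subspZ (-1)); rewrite /mxsc mpolyCN mpolyC1 scaleN1r. Qed.
Lemma subspB A B : V A -> V B -> V (A - B).
Proof. by move=> VA VB; apply/subspD/subspN. Qed.
Lemma subsp_sum I (s : seq I) (P : pred I) (F : I -> mx3) :
  (forall i, P i -> V (F i)) -> V (\sum_(i <- s | P i) F i).
Proof. by move=> h; elim/big_ind: _ => //; [exact: subsp0|exact: subspD]. Qed.
Lemma subspZK c A : c != 0 -> V (mxsc c A) -> V A.
Proof. by move=> c0 /(subspZ c^-1); rewrite mxscA mulVf // mxsc1. Qed.

End Subspace.

(** A polynomial curve in the parameter [s]; such curves stand in for Zariski density and for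
    differentiation. *)
Definition polymx (F : K -> mx3) :=
  exists n (A : nat -> mx3), forall s, F s = \sum_(k < n) mxsc (s ^+ k) (A k).

Definition evmx (G : 'M[{poly K}]_p) (s : K) : 'M[K]_p :=
  \matrix_(i, j) (G i j).[s].

Lemma polyfam_gact (G : 'M[{poly K}]_p) f :
  exists P : {poly poly}, forall s, gact_poly (evmx G s) f = P.[s%:MP].
Proof.
elim/mpoly_ring_ind: f => [c|v|f1 f2 [P1 h1] [P2 h2]|f1 f2 [P1 h1] [P2 h2]].
- by exists (c%:MP)%:P => s; rewrite gact_polyC hornerC.
- exists (\sum_(l < p) map_poly (@mpolyC (p * 3) K) (G l (vk v)) * ('X_(tvar l (vr v)))%:P).
  move=> s; rewrite -{1}(tvar_eta v) gact_polyX horner_sum.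
  apply: eq_bigr => l _.
  by rewrite hornerM hornerC mxE horner_map.
- by exists (P1 + P2) => s; rewrite rmorphD /= h1 h2 hornerD.
- by exists (P1 * P2) => s; rewrite rmorphM /= h1 h2 hornerM.
Qed.

Lemma polymx_entries (F : K -> mx3) :
  (forall i j, exists P : {poly poly}, forall s, F s i j = P.[s%:MP]) -> polymx F.
Proof.
move=> h.
have {h}[P hP] : exists P : 'I_3 -> 'I_3 -> {poly poly},
    forall i j s, F s i j = (P i j).[s%:MP].
  have hi i : exists Q : 'I_3 -> {poly poly}, forall j s, F s i j = (Q j).[s%:MP].
    by have [Q hQ] := fin_all_exists (h i); exists Q.
  by have [P hP] := fin_all_exists hi; exists P.
pose n := \max_(i < 3) \max_(j < 3) size (P i j).
exists n, (fun k => \matrix_(i, j) (P i j)`_k) => s.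
apply/matrixP => i j; rewrite hP summxE (@horner_coef_wide _ n); last first.
  by rewrite /n; apply: leq_trans (leq_bigmax i); apply: (leq_bigmax j).
by apply: eq_bigr => k _; rewrite !mxE rmorphXn /= mulrC.
Qed.

Lemma polymx_gact (G : 'M[{poly K}]_p) A : polymx (fun s => gact (evmx G s) A).
Proof.
apply: polymx_entries => i j; have [P hP] := polyfam_gact G (A i j).
by exists P => s; rewrite mxE.
Qed.

End Action.

(** * Density of the big cell *)

Section Density.
Variables (K : fieldType) (p : nat).
Hypothesis charK0 : [pchar K] =i pred0.
Local Notation poly := (Defs.poly K p).
Local Notation mx3 := (mx3 K p).
Implicit Types (f : poly) (A B : mx3) (g h : 'M[K]_p) (V : mx3 -> Prop).

Lemma natr_inj (m n : nat) : (m%:R == n%:R :> K) = (m == n).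
Proof.
wlog lemn : m n / (m <= n)%N => [hw|].
  by case: (leqP m n) => [|/ltnW] /hw; rewrite // eq_sym => ->; rewrite eq_sym.
rewrite eq_sym -subr_eq0 -natrB // ((pcharf0P K).1 charK0) subn_eq0 eq_sym.
by rewrite eqn_leq lemn andbT.
Qed.

(** In characteristic 0 the natural numbers stay distinct in [K], and among the first [n + size q]
    of them fewer than [size q] are roots. *)
Lemma nat_nonroots (q : {poly K}) n : q != 0 ->
  exists a : 'I_n -> nat, injective a /\ forall i, q.[(a i)%:R] != 0.
Proof.
move=> q0; pose good m := q.[m%:R] != 0.
pose s := [seq m <- iota 0 (n + size q) | good m].
have le_n : (n <= size s)%N.
  pose t := [seq m <- iota 0 (n + size q) | ~~ good m].
  have st : (size t < size q)%N.
    rewrite -(size_map (fun m => m%:R : K) t); apply: max_poly_roots => //.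
      by apply/allP => x /mapP[m]; rewrite mem_filter /good negbK => /andP[h _] ->.
    rewrite map_inj_uniq ?filter_uniq ?iota_uniq // => i j /eqP.
    by rewrite natr_inj => /eqP.
  have : (size s + size t = n + size q)%N.
    by rewrite !size_filter count_predC size_iota.
  by move=> e; rewrite -(leq_add2r (size q)) -e leq_add2l ltnW.
exists (fun i => nth 0%N s i); split=> [i j /eqP|i].
  by rewrite nth_uniq ?filter_uniq ?iota_uniq ?(leq_trans (ltn_ord _) le_n) // => /eqP/val_inj.
have : nth 0%N s i \in s by rewrite mem_nth // (leq_trans (ltn_ord _) le_n).
by rewrite mem_filter => /andP[].
Qed.

(** Inverting a Vandermonde matrix at [n] admissible points writes each coefficient as a combination
    of values, all of which lie in [V]. *)
Lemma subspace_coefs V n (A : nat -> mx3) (q : {poly K}) : subspace V -> q != 0 ->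
  (forall m : nat, q.[m%:R] != 0 -> V (\sum_(k < n) mxsc (m%:R ^+ k) (A k))) ->
  forall k, (k < n)%N -> V (A k).
Proof.
move=> hV q0 hq k lt_kn; have [a [inja ha]] := nat_nonroots n q0.
pose W := Vandermonde n (\row_(i < n) ((a i)%:R : K)).
have uW : W \in unitmx.
  rewrite unitmxE unitfE det_Vandermonde.
  apply/prodf_neq0 => i _; apply/prodf_neq0 => j ltij.
  rewrite !mxE subr_eq0 natr_inj; apply: contraTneq ltij => /inja ->.
  by rewrite ltnn.
have -> : A k = \sum_(i < n) mxsc (invmx W i (Ordinal lt_kn))
                    (\sum_(l < n) mxsc ((a i)%:R ^+ l) (A l)).
  under eq_bigr => i _ do rewrite mxsc_sumr.
  rewrite exchange_big /=.
  have e (l : 'I_n) : \sum_(i < n) mxsc (invmx W i (Ordinal lt_kn)) (mxsc ((a i)%:R ^+ l) (A l))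
      = mxsc (l == Ordinal lt_kn)%:R (A l).
    transitivity (mxsc ((W *m invmx W) l (Ordinal lt_kn)) (A l)).
      rewrite mxE mxsc_suml; apply: eq_bigr => i _.
      by rewrite mxscA !mxE mulrC.
    by rewrite mulmxV // mxE.
  under eq_bigr => l _ do rewrite e.
  rewrite (bigD1 (Ordinal lt_kn)) //= eqxx mxsc1 big1 ?addr0 // => l /negbTE ->.
  by rewrite mxsc0.
by apply: subsp_sum => // i _; apply: subspZ => //; apply: hq; apply: ha.
Qed.

Lemma polymx_subspace V (F : K -> mx3) (q : {poly K}) : subspace V -> polymx F ->
  q != 0 -> (forall m : nat, q.[m%:R] != 0 -> V (F m%:R)) -> forall s, V (F s).
Proof.
move=> hV [n [A hA]] q0 hq s; rewrite hA; apply: subsp_sum => // k _.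
apply: subspZ => //; apply: (subspace_coefs hV q0 _ (ltn_ord k)) => m hm.
by rewrite -hA; apply: hq.
Qed.

End Density.

(** * Triangular factorization along a curve through the identity *)

Section LU.
Variable K : fieldType.

Definition lower_unitri n (L : 'M[K]_n) :=
  (forall i, L i i = 1) /\ (forall i j : 'I_n, (i < j)%N -> L i j = 0).
Definition upper_unitri n (N : 'M[K]_n) :=
  (forall i, N i i = 1) /\ (forall i j : 'I_n, (j < i)%N -> N i j = 0).
Definition big_cell n (g : 'M[K]_n) := exists (L : 'M[K]_n) (d : 'rV[K]_n) (N : 'M[K]_n),
  [/\ lower_unitri L, forall k, d 0 k != 0, upper_unitri N & g = L *m diag_mx d *m N].

Lemma lower_unitri_tr n (L : 'M[K]_n) : lower_unitri L -> upper_unitri L^T.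
Proof. by case=> h1 h2; split=> [i|i j lt_ij]; rewrite mxE ?h1 ?h2. Qed.

Lemma upper_unitri_tr n (N : 'M[K]_n) : upper_unitri N -> lower_unitri N^T.
Proof. by case=> h1 h2; split=> [i|i j lt_ij]; rewrite mxE ?h1 ?h2. Qed.

Lemma lower_unitri_block n (c : 'cV[K]_n) (L : 'M[K]_n) :
  lower_unitri L -> lower_unitri (block_mx (1%:M : 'M_1) 0 c L).
Proof.
move=> [h1 h2]; split=> [i|i j].
  by case: (split_ordP i) => k ->; rewrite ?block_mxEul ?block_mxEdr ?mxE ?eqxx.
case: (split_ordP i) => i' ->; case: (split_ordP j) => j' -> /=.
- by rewrite (ord1 i') (ord1 j').
- by rewrite block_mxEur mxE.
- by rewrite (ord1 j').
- by rewrite ltn_add2l block_mxEdr => /h2.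
Qed.

Lemma upper_unitri_block n (b : 'rV[K]_n) (N : 'M[K]_n) :
  upper_unitri N -> upper_unitri (block_mx (1%:M : 'M_1) b 0 N).
Proof.
move=> /upper_unitri_tr/(lower_unitri_block b^T)/lower_unitri_tr.
by rewrite tr_block_mx !trmxK trmx0 tr_scalar_mx.
Qed.

(** One step of Gaussian elimination with pivot [a]. Here [S] is [a] times the Schur complement;
    being free of division, it stays polynomial along a curve. *)
Lemma big_cell_block n (a : K) (b : 'rV[K]_n) (c : 'cV[K]_n) (D S : 'M[K]_n) :
  a != 0 -> S = a *: D - c *m b -> big_cell S ->
  big_cell (block_mx (a%:M : 'M_1) b c D).
Proof.
move=> a0 eS [L [d [N [hL hd hN eLDN]]]].
exists (block_mx (1%:M : 'M_1) 0 (a^-1 *: c) L), (row_mx (a%:M : 'M_1) (a^-1 *: d)),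
  (block_mx (1%:M : 'M_1) (a^-1 *: b) 0 N); split.
- exact: lower_unitri_block.
- move=> k; case: (split_ordP k) => i ->; rewrite ?row_mxEl ?row_mxEr mxE.
    by rewrite ord1 eqxx.
  by rewrite mulf_neq0 ?invr_eq0.
- exact: upper_unitri_block.
have ea : diag_mx (a%:M : 'M_1) = a%:M.
  by apply/matrixP => i j; rewrite !mxE !ord1.
rewrite diag_mx_row ea linearZ /= !mulmx_block.
rewrite !(mul1mx, mulmx1, mul0mx, mulmx0, addr0, add0r).
rewrite !(mul_scalar_mx, mul_mx_scalar, scalerA, divff, mulVf, scale1r) //.
congr block_mx; rewrite -!scalemxAr -scalemxAl -eLDN eS scalerBr scalerA.
by rewrite mulVf // scale1r addrC subrK.
Qed.

(** The pivots of the division-free elimination are polynomials in the parameter that equal 1 at 0;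
    [q] is their product. *)
Lemma big_cell_generic n (G : 'M[{poly K}]_n) : (forall i j, (G i j).[0] = (i == j)%:R) ->
  exists q : {poly K}, q.[0] != 0 /\
    forall s, q.[s] != 0 -> big_cell (\matrix_(i, j) (G i j).[s]).
Proof.
elim: n G => [|n IH] G hG.
  exists 1; split=> [|s _]; first by rewrite hornerC oner_neq0.
  exists 1%:M, 0, 1%:M; split; try by [split=> [[]|[]]|case].
  by apply/matrixP => [[]].
pose a : {poly K} := G ord0 ord0.
pose S := \matrix_(i < n, j < n)
  (a * G (lift ord0 i) (lift ord0 j) - G (lift ord0 i) ord0 * G ord0 (lift ord0 j)).
have a1 : a.[0] = 1 by rewrite hG eqxx.
have [i j|q [q0 hq]] := IH S.
  by rewrite mxE hornerD hornerN !hornerM a1 !hG /= mul0r subr0 mul1r (inj_eq lift_inj).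
exists (a * q); split=> [|s]; first by rewrite hornerM a1 mul1r.
rewrite hornerM mulf_eq0 negb_or => /andP[as0 /hq cell].
have -> : (\matrix_(i, j) (G i j).[s]) = block_mx (a.[s]%:M : 'M_1)
   (\row_j (G ord0 (lift ord0 j)).[s]) (\col_i (G (lift ord0 i) ord0).[s])
   (\matrix_(i, j) (G (lift ord0 i) (lift ord0 j)).[s]).
  have e0 (k : 'I_1) : lshift n k = ord0 by apply: val_inj; rewrite (ord1 k).
  have e1 (k : 'I_n) : rshift 1 k = lift ord0 k by apply: val_inj.
  apply/matrixP => i j.
  case: (@split_ordP 1 n i) => k ->; case: (@split_ordP 1 n j) => l ->; rewrite mxE.
  - by rewrite [RHS](@block_mxEul _ 1 n 1 n) !e0 !ord1 mxE eqxx.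
  - by rewrite [RHS](@block_mxEur _ 1 n 1 n) e0 e1 mxE.
  - by rewrite [RHS](@block_mxEdl _ 1 n 1 n) e0 e1 mxE.
  - by rewrite [RHS](@block_mxEdr _ 1 n 1 n) !e1 mxE.
apply: big_cell_block as0 _ cell.
apply/matrixP => i j; rewrite !mxE big_ord1 !mxE hornerD hornerN !hornerM //.
Qed.
End LU.

(** * The Fischer form *)

Section RationalMorphism.
Variables (K : fieldType).
Hypothesis charK0 : [pchar K] =i pred0.

Lemma intr_char0_eq0 (z : int) : (z%:~R == 0 :> K) = (z == 0).
Proof.
case: z => n; first by rewrite -pmulrn ((pcharf0P K).1 charK0).
by rewrite NegzE mulrNz oppr_eq0 -pmulrn ((pcharf0P K).1 charK0) oppr_eq0.
Qed.

(** Determines the image of [x] from any representation as a fraction, reduced or not, so that the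
    morphism laws follow by cross-multiplication. *)
Lemma ratr_cross (x : rat) (a b : int) : b != 0 -> x * b%:~R = a%:~R ->
  @ratr K x * b%:~R = a%:~R.
Proof.
move=> b0 e; have d0 : (denq x)%:~R != 0 :> K by rewrite intr_char0_eq0 denq_neq0.
apply: (mulIf d0); rewrite /ratr mulrAC divfK // -!intrM; congr (_%:~R).
apply: (@intr_inj rat); rewrite !intrM -e mulrAC; congr (_ * _).
by rewrite -{2}(divq_num_den x) divfK // intr_eq0 denq_neq0.
Qed.

Lemma exists_rat_morphism : exists phi : {rmorphism rat -> K}, True.
Proof.
have d0 x : (denq x)%:~R != 0 :> K by rewrite intr_char0_eq0 denq_neq0.
have dx (x : rat) : x * (denq x)%:~R = (numq x)%:~R.
  by rewrite -{1}(divq_num_den x) divfK // intr_eq0 denq_neq0.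
have dK x := ratr_cross (denq_neq0 x) (dx x).
have zm : zmod_morphism (@ratr K).
  move=> x y; apply: (mulIf (d0 x)); apply: (mulIf (d0 y)).
  have e : (x - y) * (denq x * denq y)%:~R = (numq x * denq y - numq y * denq x)%:~R.
    by rewrite intrM intrB !intrM -!dx; ring.
  have := ratr_cross _ e; rewrite mulf_neq0 ?denq_neq0 // => /(_ isT).
  by rewrite intrM intrB !intrM -!dK mulrA => ->; ring.
have mm : monoid_morphism (@ratr K).
  split=> [|x y]; first by rewrite (ratr_int K 1).
  apply: (mulIf (d0 x)); apply: (mulIf (d0 y)).
  have e : (x * y) * (denq x * denq y)%:~R = (numq x * numq y)%:~R.
    by rewrite !intrM -!dx; ring.
  have := ratr_cross _ e; rewrite mulf_neq0 ?denq_neq0 // => /(_ isT).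
  by rewrite !intrM -!dK mulrA => ->; ring.
pose phi : {rmorphism rat -> K} :=
  HB.pack (@ratr K) (GRing.isZmodMorphism.Build rat K (@ratr K) zm)
    (GRing.isMonoidMorphism.Build rat K (@ratr K) mm).
by exists phi.
Qed.

End RationalMorphism.

Section FischerForm.
Variables (F : fieldType) (n : nat).
Implicit Types (f h : {mpoly F[n]}) (m : 'X_{1..n}).

Definition mfact m : nat := \prod_(i < n) (m i)`!.

(** Equivalently, the value at 0 of [f], read as a differential operator with constant coefficients,
    applied to [h]. *)
Definition fischer f h : F := \sum_(m <- msupp f) f@_m * h@_m * (mfact m)%:R.

Lemma fischerE k f h : (msize f <= k)%N ->
  fischer f h = \sum_(m : 'X_{1..n < k}) f@_m * h@_m * (mfact m)%:R.
Proof.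
move=> le_fk; rewrite /fischer (big_mksub 'X_{1..n < k}) ?msupp_uniq //=; first last.
  by move=> m /msize_mdeg_lt /leq_trans; apply.
rewrite big_rmcond //= => m /memN_msupp_eq0 ->.
by rewrite !mul0r.
Qed.

Lemma fischerC f h : fischer f h = fischer h f.
Proof.
rewrite (@fischerE (msize f + msize h)) ?leq_addr // (@fischerE (msize f + msize h) h) ?leq_addl //.
by apply: eq_bigr => m _; rewrite [f@_m * _]mulrC.
Qed.

Lemma fischerDr f h1 h2 : fischer f (h1 + h2) = fischer f h1 + fischer f h2.
Proof.
by rewrite -big_split; apply: eq_bigr => m _; rewrite mcoeffD mulrDr mulrDl.
Qed.

Lemma fischerZr c f h : fischer f (c%:MP * h) = c * fischer f h.
Proof. by rewrite mulr_sumr; apply: eq_bigr => m _; rewrite mcoeffCM; ring. Qed.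

Lemma fischerDl f1 f2 h : fischer (f1 + f2) h = fischer f1 h + fischer f2 h.
Proof. by rewrite fischerC fischerDr !(fischerC h). Qed.

Lemma fischerZl c f h : fischer (c%:MP * f) h = c * fischer f h.
Proof. by rewrite fischerC fischerZr fischerC. Qed.

Lemma fischer0r f : fischer f 0 = 0.
Proof. by rewrite /fischer big1 // => m _; rewrite mcoeff0 mulr0 mul0r. Qed.

Lemma fischer0l f : fischer 0 f = 0.
Proof. by rewrite fischerC fischer0r. Qed.

Lemma fischer_sumr I (s : seq I) (P : pred I) f (H : I -> {mpoly F[n]}) :
  fischer f (\sum_(i <- s | P i) H i) = \sum_(i <- s | P i) fischer f (H i).
Proof. exact: (big_morph _ (fischerDr f) (fischer0r f)). Qed.

Lemma fischer_suml I (s : seq I) (P : pred I) f (H : I -> {mpoly F[n]}) :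
  fischer (\sum_(i <- s | P i) H i) f = \sum_(i <- s | P i) fischer (H i) f.
Proof. exact: (big_morph (fischer^~ f) (fun a b => fischerDl a b f) (fischer0l f)). Qed.

Lemma mfactU m i : mfact (m + U_(i)) = ((m i).+1 * mfact m)%N.
Proof.
rewrite /mfact (bigD1 i) //= [X in (_ = _ * X)%N](bigD1 i) //= mnmDE mnm1E eqxx.
rewrite addn1 factS mulnA; congr (_ * _)%N; apply: eq_bigr => j ne.
by rewrite mnmDE mnm1E eq_sym (negbTE ne) addn0.
Qed.

Lemma fischerXm m h : fischer 'X_[m] h = h@_m * (mfact m)%:R.
Proof. by rewrite /fischer msuppX big_seq1 mcoeffX eqxx mul1r. Qed.

(** This is what the factorial weights are for: the exponent brought down by differentiation is the
    ratio of consecutive factorials. *)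
Lemma fischer_mulX i f h : fischer ('X_i * f) h = fischer f (mderiv i h).
Proof.
elim/mpolyind: f => [|c m f _ _ IH]; first by rewrite mulr0 !fischer0l.
rewrite mulrDr !fischerDl IH; congr (_ + _).
rewrite -mul_mpolyC mulrCA !fischerZl -mpolyXD !fischerXm mcoeff_deriv.
by rewrite addmC mfactU natrM -mulr_natr; ring.
Qed.

End FischerForm.

(** Builds polynomials by one variable factor at a time, the form in which [fischer_mulX]
    applies. *)
Lemma mpoly_mulX_ind (n : nat) (R : comNzRingType) (P : {mpoly R[n]} -> Prop) :
  P 1 -> (forall c f, P f -> P (c%:MP * f)) -> (forall i f, P f -> P ('X_i * f)) ->
  (forall f g, P f -> P g -> P (f + g)) -> forall f, P f.
Proof.
move=> h1 hC hX hD; have h0 : P 0 by rewrite -(mul0r 1) -mpolyC0; apply: hC.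
elim/mpolyind => [|c m f _ _ Pf] //.
apply: (hD) => //; rewrite -mul_mpolyC; apply: (hC).
rewrite mpolyXE_id; elim/big_rec: _ => // i f1 _ Pf1.
by elim: (m i) => [|k IH]; rewrite ?mul1r // exprS -mulrA; apply: (hX).
Qed.

Lemma fischer_map (F F' : fieldType) (phi : {rmorphism F -> F'}) n
    (f h : {mpoly F[n]}) :
  fischer (map_mpoly phi f) (map_mpoly phi h) = phi (fischer f h).
Proof.
pose k := (msize f + msize (map_mpoly phi f))%N.
rewrite (@fischerE _ _ k) ?leq_addl // (@fischerE _ _ k) ?leq_addr // rmorph_sum /=.
by apply: eq_bigr => m _; rewrite !mcoeff_map_mpoly !rmorphM rmorph_nat.
Qed.

Lemma mfact_gt0 n (m : 'X_{1..n}) : (0 < mfact m)%N.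
Proof. by apply: prodn_gt0 => i; apply: fact_gt0. Qed.

Lemma fischer_ge0 n (f : {mpoly rat[n]}) : 0 <= fischer f f.
Proof. by apply: sumr_ge0 => m _; rewrite mulr_ge0 ?ler0n // -expr2 sqr_ge0. Qed.

Lemma fischer_eq0 n (f : {mpoly rat[n]}) : fischer f f = 0 -> f = 0.
Proof.
move/eqP; rewrite /fischer psumr_eq0 => [|m _]; last first.
  by rewrite mulr_ge0 ?ler0n // -expr2 sqr_ge0.
move=> /allP h; apply/mpolyP => m; rewrite mcoeff0.
case: (boolP (m \in msupp f)) => [/h|/memN_msupp_eq0 //].
rewrite /= mulf_eq0 pnatr_eq0 -leqn0 leqNgt mfact_gt0 orbF.
by rewrite -expr2 sqrf_eq0 => /eqP.
Qed.

Lemma mderivXU n (R : comNzRingType) (i j : 'I_n) :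
  mderiv i ('X_j : {mpoly R[n]}) = (i == j)%:R.
Proof.
rewrite mderivX mnm1E eq_sym; case: eqVneq => [->|_]; last by rewrite scale0r.
by rewrite scale1r -[X in (X - _)%MM]add0m addmK mpolyX0.
Qed.

Section Adjoint.
Variables (K : fieldType) (p : nat).
Local Notation poly := (Defs.poly K p).
Local Notation mx3 := (mx3 K p).
Implicit Types (f h : poly) (A B : mx3) (g : 'M[K]_p).

Lemma mderiv_gact g k r f :
  mderiv (tvar k r) (gact_poly g f) =
  \sum_(l < p) (g k l)%:MP * gact_poly g (mderiv (tvar l r) f).
Proof.
elim/mpoly_ring_ind: f => [c|v|f1 f2 IH1 IH2|f1 f2 IH1 IH2].
- rewrite gact_polyC mderivC big1 // => l _; by rewrite mderivC raddf0 mulr0.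
- rewrite -(tvar_eta v) gact_polyX raddf_sum /= (bigD1 k) //= big1 => [|l ne].
    rewrite (bigD1 (vk v)) //= [X in _ = _ + X]big1 => [|l ne].
      by rewrite !addr0 mderiv_mulC !mderivXU !tvar_inj !eqxx rmorph_nat.
    by rewrite mderivXU tvar_inj (negbTE ne) raddf0 mulr0.
  by rewrite mderiv_mulC mderivXU tvar_inj eq_sym (negbTE ne) mulr0.
- rewrite !raddfD /= IH1 IH2 -big_split; apply: eq_bigr => l _ /=.
  by rewrite !raddfD /= mulrDr.
- rewrite rmorphM /= mderivM IH1 IH2 mulr_suml mulr_sumr -big_split.
  apply: eq_bigr => l _ /=; rewrite mderivM rmorphD !rmorphM /=.
  by ring.
Qed.

Lemma mcoeff0_gact g f : (gact_poly g f)@_0 = f@_0.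
Proof.
elim/mpoly_ring_ind: f => [c|v|f1 f2 IH1 IH2|f1 f2 IH1 IH2].
- by rewrite gact_polyC.
- rewrite -(tvar_eta v) gact_polyX raddf_sum /= big1 => [|l _].
    by rewrite mcoeffX mnm1_eq0.
  by rewrite mcoeffCM mcoeffX mnm1_eq0 mulr0.
- by rewrite rmorphD /= !mcoeffD IH1 IH2.
- by rewrite !rmorphM /= IH1 IH2.
Qed.

(** Multiplying by a variable is adjoint to differentiating by it, and the chain rule for [g^T]
    produces the same coefficients as the substitution by [g] in that variable. *)
Lemma fischer_gact g f h :
  fischer (gact_poly g f) h = fischer f (gact_poly g^T h).
Proof.
elim/mpoly_mulX_ind: f h => [|c f IH|v f IH|f1 f2 IH1 IH2] h.
- by rewrite rmorph1 -mpolyX0 !fischerXm mcoeff0_gact.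
- by rewrite rmorphM /= gact_polyC !fischerZl IH.
- rewrite fischer_mulX -(tvar_eta v) mderiv_gact rmorphM /= gact_polyX mulr_suml.
  rewrite fischer_suml fischer_sumr; apply: eq_bigr => l _.
  by rewrite -mulrA fischerZl fischer_mulX IH fischerZr mxE.
- by rewrite rmorphD /= !fischerDl IH1 IH2.
Qed.

Definition mform A B : K := \sum_(i < 3) \sum_(j < 3) fischer (A i j) (B i j).

Lemma mformC A B : mform A B = mform B A.
Proof. by apply: eq_bigr => i _; apply: eq_bigr => j _; rewrite fischerC. Qed.

Lemma mformDr A B1 B2 : mform A (B1 + B2) = mform A B1 + mform A B2.
Proof.
rewrite -big_split; apply: eq_bigr => i _ /=; rewrite -big_split.
by apply: eq_bigr => j _; rewrite mxE fischerDr.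
Qed.

Lemma mformZr c A B : mform A (mxsc c B) = c * mform A B.
Proof.
rewrite mulr_sumr; apply: eq_bigr => i _; rewrite mulr_sumr.
by apply: eq_bigr => j _; rewrite mxscE fischerZr.
Qed.

Lemma mform0r A : mform A 0 = 0.
Proof. by rewrite -[X in mform A X](mxsc0 A) mformZr mul0r. Qed.

Lemma mform_sumr I (s : seq I) (P : pred I) A (H : I -> mx3) :
  mform A (\sum_(i <- s | P i) H i) = \sum_(i <- s | P i) mform A (H i).
Proof. exact: (big_morph _ (mformDr A) (mform0r A)). Qed.

Lemma mform_suml I (s : seq I) (P : pred I) A (H : I -> mx3) :
  mform (\sum_(i <- s | P i) H i) A = \sum_(i <- s | P i) mform (H i) A.
Proof. by rewrite mformC mform_sumr; apply: eq_bigr => i _; rewrite mformC. Qed.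

Lemma mformZl c A B : mform (mxsc c A) B = c * mform A B.
Proof. by rewrite mformC mformZr mformC. Qed.

Lemma mformDl A B1 B2 : mform (B1 + B2) A = mform B1 A + mform B2 A.
Proof. by rewrite mformC mformDr !(mformC A). Qed.

Lemma mformBr A B1 B2 : mform A (B1 - B2) = mform A B1 - mform A B2.
Proof. by rewrite mformDr -[B2]mxsc1 -mxscN mformZr mxsc1 mulN1r. Qed.

Lemma mformBl A B1 B2 : mform (B1 - B2) A = mform B1 A - mform B2 A.
Proof. by rewrite mformC mformBr !(mformC A). Qed.

Lemma mform_gact g A B : mform (gact g A) B = mform A (gact g^T B).
Proof.
by apply: eq_bigr => i _; apply: eq_bigr => j _; rewrite !mxE fischer_gact.
Qed.

Lemma orth_subspace A : subspace (fun B => mform A B = 0).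
Proof.
split=> [|B1 B2 h1 h2|c B h]; first exact: mform0r.
  by rewrite mformDr h1 h2 addr0.
by rewrite mformZr h mulr0.
Qed.

End Adjoint.

(** * Submodules generated by one matrix *)

Section Span.
Variables (K : fieldType) (p : nat).
Hypothesis charK0 : [pchar K] =i pred0.
Local Notation poly := (Defs.poly K p).
Local Notation mx3 := (mx3 K p).
Implicit Types (f : poly) (A B u w : mx3) (g : 'M[K]_p) (V : mx3 -> Prop).

(** The segment from the identity to [g]: as it starts at the identity, [big_cell_generic] applies
    to it even when [g] is singular. *)
Definition mx_path (g : 'M[K]_p) : 'M[{poly K}]_p :=
  \matrix_(i, j) ((1 - 'X) * (i == j)%:R%:P + 'X * (g i j)%:P).

Lemma mx_path_0 g i j : (mx_path g i j).[0] = (i == j)%:R.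
Proof. by rewrite mxE !(hornerE) /=; ring. Qed.

Lemma mx_path_1 g : evmx (mx_path g) 1 = g.
Proof. by apply/matrixP => i j; rewrite !mxE !(hornerE) /=; ring. Qed.

Lemma gact_cell V A : subspace V -> (forall g, big_cell g -> V (gact g A)) ->
  forall g, V (gact g A).
Proof.
move=> hV cell g; rewrite -(mx_path_1 g).
have [q [q0 hq]] := big_cell_generic (@mx_path_0 g).
apply: (polymx_subspace charK0 hV (polymx_gact (mx_path g) A) (q := q)).
  by apply: contraNneq q0 => ->; rewrite horner0.
by move=> m /hq; apply: cell.
Qed.

Lemma lower_unitri_det n (L : 'M[K]_n) : lower_unitri L -> \det L = 1.
Proof.
move=> [h1 h2]; rewrite det_trig; first by rewrite big1.
by apply/is_trig_mxP.
Qed.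

Lemma big_cell_unit n (g : 'M[K]_n) : big_cell g -> g \in unitmx.
Proof.
move=> [L [d [N [hL hd hN ->]]]].
rewrite unitmxE !det_mulmx (lower_unitri_det hL) -(det_tr N).
rewrite (lower_unitri_det (upper_unitri_tr hN)) mul1r mulr1 det_diag unitfE.
by apply/prodf_neq0 => i _.
Qed.

(** Submodules are stable under invertible matrices by definition; density of the big cell adds the
    singular ones, such as the value at 0 of a one-parameter subgroup. *)
Lemma submodule_gact V g A : submodule V -> V A -> V (gact g A).
Proof.
move=> [hV glV] VA; apply: gact_cell => // h /big_cell_unit uh; exact: glV.
Qed.

Definition natmx (h : 'M[nat]_p) : 'M[K]_p := map_mx (fun n => n%:R) h.

(** Matrices with natural entries are Zariski dense, and they make sense over every field, so they
    send rational vectors to rational vectors. *)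
Lemma gact_natmx V A : subspace V -> (forall h : 'M[nat]_p, V (gact (natmx h) A)) ->
  forall g, V (gact g A).
Proof.
move=> hV hnat.
(* [s] lists the positions whose entries are not yet known to be natural; one after the other serves
   as the parameter of a polynomial curve. *)
suff main (s : seq ('I_p * 'I_p)) g :
    (forall i j, (i, j) \notin s -> exists n : nat, g i j = n%:R) -> V (gact g A).
  by move=> g; apply: (main (enum predT)) => i j; rewrite mem_enum.
elim: s g => [|[i0 j0] s IH] g hg.
  have h1 i : exists r : 'I_p -> nat, forall j, g i j = (r j)%:R.
    by have [j|r hr] := @fin_all_exists _ _ (fun j n => g i j = n%:R); [exact: hg|exists r].
  have [r hr] := fin_all_exists h1.
  have -> : g = natmx (\matrix_(i, j) r i j) by apply/matrixP => i j; rewrite !mxE.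
  exact: hnat.
pose G : 'M[{poly K}]_p := \matrix_(i, j) if (i, j) == (i0, j0) then 'X else (g i j)%:P.
have -> : g = evmx G (g i0 j0).
  apply/matrixP => i j; rewrite !mxE; case: eqP => [[-> ->]|_]; rewrite ?hornerX ?hornerC //.
apply: (polymx_subspace charK0 hV (polymx_gact G A) (oner_neq0 _)) => m _.
apply: IH => i j nij; rewrite !mxE; case: (eqVneq (i, j) (i0, j0)) => [_|ne].
  by exists m; rewrite hornerX.
by rewrite hornerC; apply: hg; rewrite inE negb_or ne.
Qed.

Definition gspan u A := forall V, submodule V -> V u -> V A.

Lemma gspan_submodule u : submodule (gspan u).
Proof.
split; first split.
- by move=> V [hV _] _; apply: subsp0.
- by move=> A B hA hB V hV Vu; apply: (subspD hV.1); [apply: hA|apply: hB].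
- by move=> c A hA V hV Vu; apply: (subspZ hV.1); apply: hA.
- by move=> g ug A hA V hV Vu; apply: hV.2 => //; apply: hA.
Qed.

Lemma gspan_id u : gspan u u. Proof. by []. Qed.

(** The combinations on the right form a subspace, which by [gact_natmx] is stable under the whole
    group. *)
Lemma gspanP u A : gspan u A ->
  exists s : seq (K * 'M[nat]_p), A = \sum_(x <- s) mxsc x.1 (gact (natmx x.2) u).
Proof.
pose V A := exists s : seq (K * 'M[nat]_p),
  A = \sum_(x <- s) mxsc x.1 (gact (natmx x.2) u).
have hV : subspace V.
  split; first by exists [::]; rewrite big_nil.
    by move=> A1 A2 [s1 ->] [s2 ->]; exists (s1 ++ s2); rewrite big_cat.
  move=> c A1 [s ->]; exists [seq (c * x.1, x.2) | x <- s].
  by rewrite big_map mxsc_sumr; apply: eq_bigr => x _; rewrite mxscA.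
have Vu g : V (gact g u).
  apply: gact_natmx => // h; exists [:: (1, h)].
  by rewrite big_seq1 mxsc1.
move=> hA; apply: (hA V); last by rewrite -(gact1 u).
split=> // g _ A1 [s ->]; rewrite rmorph_sum; apply: subsp_sum => //= x _.
by rewrite gact_sc -gactM; apply: subspZ.
Qed.

Lemma polymx_form (F : K -> mx3) w : polymx F ->
  exists P : {poly K}, forall s, P.[s] = mform w (F s).
Proof.
move=> [n [A hA]]; exists (\poly_(k < n) mform w (A k)) => s.
by rewrite horner_poly hA mform_sumr; apply: eq_bigr => k _; rewrite mformZr mulrC.
Qed.

Lemma poly_nat_eq0 (q : {poly K}) : (forall m : nat, q.[m.+1%:R] = 0) -> q = 0.
Proof.
move=> hq; apply/eqP; apply: contraT => q0.
have [||a [_ /(_ ord0)]] := @nat_nonroots K _ (q * 'X) 1.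
- exact: charK0.
- by rewrite mulf_neq0 ?polyX_eq0.
rewrite hornerM hornerX mulf_eq0 negb_or; case: (a ord0) => [|m].
  by rewrite eqxx andbF.
by rewrite hq eqxx.
Qed.

End Span.

Lemma mform_rat_eq0 (p : nat) (B : Defs.mx3 rat p) : mform B B = 0 -> B = 0.
Proof.
move=> /eqP; rewrite psumr_eq0 => [|i _]; last by apply: sumr_ge0 => j _; apply: fischer_ge0.
move=> /allP h; apply/matrixP => i j; rewrite mxE; apply: fischer_eq0.
have := h i (mem_index_enum _); rewrite psumr_eq0 => [|k _]; last exact: fischer_ge0.
by move=> /allP/(_ j (mem_index_enum _))/eqP.
Qed.

(** * Descent of non-degeneracy from a subfield *)

Section Gram.
Variables (K F : fieldType) (p : nat) (phi : {rmorphism F -> K}).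
Hypothesis charK0 : [pchar K] =i pred0.
Hypothesis mform_anisotropic : forall B : Defs.mx3 F p, mform B B = 0 -> B = 0.
Local Notation poly := (Defs.poly K p).
Local Notation mx3 := (mx3 K p).
Implicit Types (A B u v w : mx3) (g : 'M[K]_p) (V : mx3 -> Prop).

Definition ratmap (B : Defs.mx3 F p) : mx3 := map_mx (map_mpoly phi) B.

HB.instance Definition _ := GRing.RMorphism.copy ratmap (map_mx (map_mpoly phi)).

Lemma mform_ratmap (B1 B2 : Defs.mx3 F p) : mform (ratmap B1) (ratmap B2) = phi (mform B1 B2).
Proof.
rewrite rmorph_sum; apply: eq_bigr => i _; rewrite rmorph_sum; apply: eq_bigr => j _.
by rewrite !mxE fischer_map.
Qed.

Lemma ratmap_sc c (B : Defs.mx3 F p) : ratmap (mxsc c B) = mxsc (phi c) (ratmap B).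
Proof. by apply/matrixP => i j; rewrite !mxE rmorphM /= map_mpolyC. Qed.

Lemma gact_ratmap (h : 'M[nat]_p) (B : Defs.mx3 F p) : gact (natmx K h) (ratmap B) = ratmap (gact (natmx F h) B).
Proof.
apply/matrixP => i j; rewrite !mxE.
elim/mpoly_ring_ind: (B i j) => [c|v|f1 f2 IH1 IH2|f1 f2 IH1 IH2].
- by rewrite map_mpolyC !gact_polyC map_mpolyC.
- rewrite -(tvar_eta v) map_mpolyX !gact_polyX rmorph_sum; apply: eq_bigr => l _.
  have e : phi (natmx F h l (vk v)) = natmx K h l (vk v) by rewrite !mxE rmorph_nat.
  by rewrite rmorphM /= map_mpolyC map_mpolyX; congr (_%:MP * _); apply/esym.
- by rewrite !rmorphD /= IH1 IH2.
- by rewrite !rmorphM /= IH1 IH2.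
Qed.

(** The coefficients [c] lie in the kernel of the Gram matrix over [K], which is spanned by the
    kernel over [F]. Over [F] a kernel vector yields a combination orthogonal to itself, and
    anisotropy makes it vanish. *)
Lemma gram_nondegenerate r (b : 'I_r -> Defs.mx3 F p) (c : 'I_r -> K) :
  let w := \sum_(i < r) mxsc (c i) (ratmap (b i)) in
  (forall j, mform w (ratmap (b j)) = 0) -> w = 0.
Proof.
move=> w hw; pose G : 'M[F]_r := \matrix_(i, j) mform (b i) (b j).
pose C : 'rV[K]_r := \row_i c i.
have kerC : (C <= map_mx phi (kermx G))%MS.
  rewrite map_kermx; apply/sub_kermxP/rowP => j; rewrite !mxE -[RHS](hw j) mform_suml.
  by apply: eq_bigr => i _; rewrite mformZl mform_ratmap !mxE.
have [e eC] := submxP kerC.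
have ker0 k : \sum_(i < r) mxsc (kermx G k i) (b i) = 0.
  apply: mform_anisotropic; rewrite mform_sumr big1 // => j _.
  rewrite mformZr mform_suml.
  under eq_bigr => i _ do rewrite mformZl.
  have : (kermx G *m G) k j = 0 by rewrite mulmx_ker mxE.
  rewrite mxE => e0; rewrite (_ : \sum_i _ = 0) ?mulr0 // -[RHS]e0.
  by apply: eq_bigr => i _; rewrite [G i j]mxE.
have cE i : mxsc (c i) (ratmap (b i)) =
    \sum_k mxsc (e 0 k) (ratmap (mxsc (kermx G k i) (b i))).
  have -> : c i = (e *m map_mx phi (kermx G)) 0 i by rewrite -eC mxE.
  by rewrite mxE mxsc_suml; apply: eq_bigr => k _; rewrite mxE -mxscA -ratmap_sc.
rewrite /w; under eq_bigr => i _ do rewrite cE.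
rewrite exchange_big big1 // => k _ /=.
by rewrite -mxsc_sumr -raddf_sum ker0 raddf0 /mxsc scaler0.
Qed.

Lemma gspan_nondegenerate (u0 : Defs.mx3 F p) w : gspan (ratmap u0) w ->
  (forall g, mform w (gact g (ratmap u0)) = 0) -> w = 0.
Proof.
move=> /(gspanP charK0)[s ->] hw; rewrite big_tnth.
pose b i := gact (natmx F (tnth (in_tuple s) i).2) u0.
rewrite (eq_bigr (fun i => mxsc (tnth (in_tuple s) i).1 (ratmap (b i)))); last first.
  by move=> i _; rewrite gact_ratmap.
apply: gram_nondegenerate => j; rewrite -gact_ratmap -[RHS](hw (natmx K (tnth (in_tuple s) j).2)).
congr mform; rewrite [RHS]big_tnth.
by apply: eq_bigr => i _; rewrite gact_ratmap.
Qed.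

Lemma mform_self_neq0 (u0 : Defs.mx3 F p) : ratmap u0 <> 0 -> mform (ratmap u0) (ratmap u0) != 0.
Proof.
move=> u0n; rewrite mform_ratmap fmorph_eq0; apply/eqP => /mform_anisotropic e.
by apply: u0n; rewrite e raddf0.
Qed.

End Gram.

(** * Highest weight theory *)

Section HighestWeight.
Variables (K F : fieldType) (p : nat) (phi : {rmorphism F -> K}).
Hypothesis charK0 : [pchar K] =i pred0.
Hypothesis mform_anisotropic : forall B : Defs.mx3 F p, mform B B = 0 -> B = 0.
Local Notation poly := (Defs.poly K p).
Local Notation mx3 := (mx3 K p).
Local Notation ratmap := (@ratmap K F p phi).
Implicit Types (A B u v w : mx3) (g : 'M[K]_p) (V : mx3 -> Prop) (nu : part3).

Definition rational_mx u := exists B : Defs.mx3 F p, u = ratmap B.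
Definition unipotent_fixed v := forall N : 'M[K]_p, upper_unitri N -> gact N v = v.
Definition torus_char nu (d : 'rV[K]_p) : K := \prod_(k < p) d 0 k ^+ ptk nu k.

Lemma hw_unipotent_fixed nu u : hw_vector nu u -> unipotent_fixed u.
Proof. by move=> [_ _ hN] N [h1 h2]; apply: hN. Qed.

Lemma hw_torus nu u (d : 'rV[K]_p) : hw_vector nu u -> (forall k, d 0 k != 0) ->
  gact (diag_mx d) u = mxsc (torus_char nu d) u.
Proof. by move=> [_ hd _]; apply: hd. Qed.

(* Only the big cell has to be examined, and there the lower unitriangular factor moves over to
   [v] by transposition. *)
Lemma hw_orth_orbit nu u v g : hw_vector nu u -> unipotent_fixed v ->
  mform u v = 0 -> mform (gact g u) v = 0.
Proof.
move=> hu hv uv; rewrite mformC; move: g; apply: (gact_cell charK0 (orth_subspace v)).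
move=> g [L [d [N [hL hd hN ->]]]].
rewrite !gactM (hw_unipotent_fixed hu hN) (hw_torus hu hd) gact_sc mformZr.
by rewrite mformC mform_gact (hv _ (lower_unitri_tr hL)) uv mulr0.
Qed.

(** Orthogonality to a whole orbit cuts out a submodule, so it passes from [u] to the module
    generated by [u]. *)
Lemma gspan_orth nu u v w : hw_vector nu u -> unipotent_fixed v ->
  mform u v = 0 -> gspan u w -> forall g, mform w (gact g v) = 0.
Proof.
move=> hu hv uv /(_ (fun w => forall g, mform w (gact g v) = 0)); apply.
  split; first split.
  - by move=> g; rewrite mformC mform0r.
  - by move=> A B hA hB g; rewrite mformDl hA hB addr0.
  - by move=> c A hA g; rewrite mformZl hA mulr0.
  - move=> h _ A hA g; rewrite mform_gact -gactM; exact: hA.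
by move=> g; rewrite -(trmxK g) -mform_gact; apply: hw_orth_orbit hu hv uv.
Qed.

Lemma rational_self_neq0 u : rational_mx u -> u <> 0 -> mform u u != 0.
Proof. by move=> [B ->]; apply: mform_self_neq0. Qed.

Lemma gspan_nondeg u w : rational_mx u -> gspan u w ->
  (forall g, mform w (gact g u) = 0) -> w = 0.
Proof. by move=> [B ->]; apply: gspan_nondegenerate. Qed.

(** The one-parameter subgroup diag(1, s, s^2, ...). Its exponents increase, so conjugation by it
    contracts lower unitriangular matrices to the identity as [s] tends to 0. *)
Definition cochar_poly : 'M[{poly K}]_p := diag_mx (\row_(k < p) 'X^k).
Definition cochar (s : K) : 'M[K]_p := diag_mx (\row_(k < p) s ^+ k).

Lemma evmx_cochar s : evmx cochar_poly s = cochar s.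
Proof.
apply/matrixP => i j; rewrite !mxE; case: eqP => _; last by rewrite !mulr0n horner0.
by rewrite !mulr1n hornerXn.
Qed.

Lemma cocharM s t : cochar (s * t) = cochar s *m cochar t.
Proof.
rewrite /cochar mulmx_diag; congr diag_mx; apply/rowP => k.
by rewrite !mxE exprMn.
Qed.

Definition cochar_weight nu : nat := \sum_(k < p) k * ptk nu k.

Lemma hw_cochar nu u s : hw_vector nu u -> s != 0 ->
  gact (cochar s) u = mxsc (s ^+ cochar_weight nu) u.
Proof.
move=> hu s0; rewrite (hw_torus hu) => [|k]; last by rewrite mxE expf_neq0.
congr mxsc; rewrite /torus_char /cochar_weight.
rewrite (eq_bigr (fun k : 'I_p => s ^+ (k * ptk nu k))); last first.
  by move=> k _; rewrite mxE exprM.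
by rewrite -(big_morph (GRing.exp s) (exprD s) (expr0 s)).
Qed.

(** Subtracting the projection to [u] leaves a vector orthogonal to [u]. Its pairing with the
    translate of [u] by a lower unitriangular [L] does not change when [L] is contracted, so it
    equals the pairing with [u] itself, which is 0. *)
Lemma weight_vector_uniq nu u w : hw_vector nu u -> rational_mx u ->
  gspan u w ->
  (forall s, s != 0 -> gact (cochar s) w = mxsc (s ^+ cochar_weight nu) w) ->
  exists c, w = mxsc c u.
Proof.
move=> hu ru uw hw; have uu := rational_self_neq0 ru (let: And3 h _ _ := hu in h).
pose c := mform w u / mform u u; exists c.
set m := cochar_weight nu in hw; pose w' := w - mxsc c u.
have w'u : mform w' u = 0.
  by rewrite mformBl mformZl /c divfK // subrr.
have hw' s : s != 0 -> gact (cochar s) w' = mxsc (s ^+ m) w'.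
  move=> s0; rewrite gactB gact_sc hw // (hw_cochar hu) // mxscBr.
  by rewrite !mxscA mulrC.
suff : w' = 0 by move/eqP; rewrite subr_eq0 => /eqP.
apply: (gspan_nondeg ru).
  have hV := (gspan_submodule u).1.
  by apply: (subspB hV uw); apply: (subspZ hV); apply: gspan_id.
apply: (gact_cell charK0 (orth_subspace w')) => g [L [d [N [hL hd hN ->]]]].
rewrite !gactM (hw_unipotent_fixed hu hN) (hw_torus hu hd) gact_sc mformZr.
suff -> : mform w' (gact L u) = 0 by rewrite mulr0.
(* The conjugate of [L] by [cochar s], polynomial in [s]. Above the diagonal the truncated exponent
   does no harm, because [L] vanishes there. *)
pose Ls : 'M[{poly K}]_p := \matrix_(i, j) ((L i j)%:P * 'X^(i - j)).
have [P hP] := polymx_form w' (polymx_gact Ls u).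
have [hL1 hL2] := hL.
have Ls0 : evmx Ls 0 = 1%:M.
  apply/matrixP => i j; rewrite !mxE hornerM hornerC hornerXn expr0n subn_eq0.
  case: (ltngtP i j) => [lt_ij|lt_ji|/val_inj ->].
  - by rewrite hL2 // mul0r -val_eqE (ltn_eqF lt_ij).
  - by rewrite mulr0 -val_eqE eq_sym (ltn_eqF lt_ji).
  - by rewrite hL1 eqxx mul1r.
have Lscommute s : cochar s *m L = evmx Ls s *m cochar s.
  apply/matrixP => i j; rewrite mul_diag_mx mul_mx_diag !mxE hornerM hornerC hornerXn.
  case: (leqP j i) => [le_ji|lt_ij]; last by rewrite hL2 // !(mul0r, mulr0).
  by rewrite -mulrA -exprD subnK // mulrC.
have Pconst s : s != 0 -> P.[s] = mform w' (gact L u).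
  move=> s0; apply: (mulfI (expf_neq0 m s0)).
  rewrite hP -mformZr -gact_sc -(hw_cochar hu s0) -gactM -Lscommute gactM.
  by rewrite -mformZl -(hw' s s0) mform_gact /cochar tr_diag_mx.
have /eqP : P - (mform w' (gact L u))%:P = 0.
  apply: (poly_nat_eq0 charK0) => k; rewrite hornerD hornerN hornerC Pconst ?subrr //.
  by rewrite ((pcharf0P K).1 charK0).
rewrite subr_eq0 => /eqP eP; have := hP 0.
by rewrite Ls0 gact1 w'u eP hornerC.
Qed.

(** Expanding the action of [cochar s] in powers of [s] splits [w] into weight components inside
    [V]. Since [cochar s] is self-adjoint, only the component with the weight of [u] pairs with
    [u]. *)
Lemma cochar_component nu u V w : hw_vector nu u -> submodule V -> V w ->
  mform w u != 0 ->
  exists w', [/\ V w', mform w' u != 0 &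
    forall s, gact (cochar s) w' = mxsc (s ^+ cochar_weight nu) w'].
Proof.
move=> hu hV Vw wu; set m := cochar_weight nu.
have [n [A hA]] := polymx_gact cochar_poly w.
have {}hA s : gact (cochar s) w = \sum_(k < n) mxsc (s ^+ k) (A k).
  by rewrite -hA evmx_cochar.
have VA k : (k < n)%N -> V (A k).
  move=> lt_kn; apply: (subspace_coefs charK0 hV.1 (oner_neq0 _) _ lt_kn) => j _.
  by rewrite -hA; apply: (submodule_gact charK0).
(* For the zero subspace, [subspace_coefs] says that a polynomial curve vanishing at the natural
   numbers has zero coefficients. *)
have hsub0 : subspace (fun B : mx3 => B = 0).
  split=> // [B1 B2 -> ->|c B ->]; first by rewrite addr0.
  by rewrite /mxsc scaler0.
have eigA k s : (k < n)%N -> gact (cochar s) (A k) = mxsc (s ^+ k) (A k).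
  move=> lt_kn; apply/eqP; rewrite -subr_eq0; apply/eqP.
  apply: (subspace_coefs (A := fun k => gact (cochar s) (A k) - mxsc (s ^+ k) (A k))
    charK0 hsub0 (oner_neq0 _) _ lt_kn) => j _.
  rewrite (eq_bigr (fun k : 'I_n => gact (cochar s) (mxsc (j%:R ^+ k) (A k))
      - mxsc ((s * j%:R) ^+ k) (A k))); last first.
    by move=> i _; rewrite gact_sc mxscBr mxscA exprMn mulrC.
  by rewrite sumrB -gact_sum -hA -hA cocharM gactM subrr.
pose P : {poly K} := \poly_(k < n) mform (A k) u.
have hP s : P.[s] = mform (gact (cochar s) w) u.
  rewrite horner_poly hA mform_suml; apply: eq_bigr => k _.
  by rewrite mformZl mulrC.
have /eqP : P - (mform w u) *: 'X^m = 0.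
  apply: (poly_nat_eq0 charK0) => k.
  have k0 : k.+1%:R != 0 :> K by rewrite ((pcharf0P K).1 charK0).
  rewrite hornerD hornerN hornerZ hornerXn hP mform_gact tr_diag_mx (hw_cochar hu k0).
  by rewrite mformZr mulrC subrr.
rewrite subr_eq0 => /eqP eP.
have := congr1 (fun q : {poly K} => q`_m) eP; rewrite coef_poly coefZ coefXn eqxx mulr1.
case: ltnP => [lt_mn e|_ e]; last by rewrite -e eqxx in wu.
exists (A m); split; [exact: VA| by rewrite e|].
by move=> s; rewrite eigA.
Qed.

(** Either [V] pairs non-trivially with [u], and then it contains a nonzero multiple of [u] and
    hence everything, or it is orthogonal to the orbit of [u] and vanishes by non-degeneracy. *)
Lemma gspan_irreducible nu u : hw_vector nu u -> rational_mx u ->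
  irreducible_submodule (gspan u).
Proof.
move=> hu ru; have u0 : u <> 0 by case: hu.
split; [exact: gspan_submodule|by exists u; split; [exact: gspan_id|]|move=> V hV Vu].
case: (Classical_Prop.classic (exists2 w, V w & mform w u != 0)) => [[w Vw wu]|no].
  right; have [w' [Vw' w'u hw']] := cochar_component hu hV Vw wu.
  have [c ec] := weight_vector_uniq hu ru (Vu _ Vw') (fun s _ => hw' s).
  have c0 : c != 0 by apply: contraNneq w'u => c0; rewrite ec c0 mformZl mul0r.
  by move=> A hA; apply: (hA V hV); apply: (subspZK hV.1 c0); rewrite -ec.
left=> w Vw; apply: (gspan_nondeg ru (Vu _ Vw)) => g.
apply/eqP; apply: contraT => wgu; case: no; exists (gact g^T w).
  exact: (submodule_gact charK0).
by rewrite mform_gact trmxK.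
Qed.

(* A dual basis [v] of the [u i] exists because the Gram matrix is invertible; it is
   unipotent-fixed, so pairing with the orbit of [v j] isolates the [j]-th summand. *)
Lemma gspan_independent r (nu : 'I_r -> part3) (u w : 'I_r -> mx3) :
  (forall i, hw_vector (nu i) (u i)) -> (forall i, rational_mx (u i)) ->
  (forall c : 'I_r -> K, \sum_i mxsc (c i) (u i) = 0 -> forall i, c i = 0) ->
  (forall i, gspan (u i) (w i)) -> \sum_i w i = 0 -> forall i, w i = 0.
Proof.
move=> hu ru lin uw sw0.
have [b hb] := fin_all_exists ru.
pose G : 'M[K]_r := \matrix_(i, j) mform (u i) (u j).
have uG : G \in unitmx.
  rewrite -row_free_unit; apply: inj_row_free => v vG.
  apply/rowP => i; rewrite mxE.
  apply: (lin (fun i => v 0 i)) i.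
  rewrite (eq_bigr (fun i => mxsc (v 0 i) (ratmap (b i)))); last by move=> i _; rewrite hb.
  apply: (gram_nondegenerate mform_anisotropic) => j.
  rewrite mform_suml; have := congr1 (fun M : 'rV_r => M 0 j) vG; rewrite !mxE => e.
  by rewrite -[RHS]e; apply: eq_bigr => i _; rewrite mformZl mxE !hb.
pose v j := \sum_k mxsc (invmx G k j) (u k).
have uv i j : mform (u i) (v j) = (i == j)%:R.
  rewrite mform_sumr; transitivity ((G *m invmx G) i j); last by rewrite mulmxV // mxE.
  by rewrite mxE; apply: eq_bigr => k _; rewrite mformZr mxE mulrC.
have fixv j : unipotent_fixed (v j).
  move=> N hN; rewrite gact_sum; apply: eq_bigr => k _.
  by rewrite gact_sc (hw_unipotent_fixed (hu k) hN).
move=> j; apply: (gspan_nondeg (ru j) (uw j)) => g.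
pose c := mform (u j) (u j).
have fixuv : unipotent_fixed (u j - mxsc c (v j)).
  by move=> N hN; rewrite gactB gact_sc fixv // (hw_unipotent_fixed (hu j) hN).
have orth : mform (u j) (u j - mxsc c (v j)) = 0.
  by rewrite mformBr mformZr uv eqxx mulr1 subrr.
have := gspan_orth (hu j) fixuv orth (uw j) g.
rewrite gactB gact_sc mformBr mformZr.
suff -> : mform (w j) (gact g (v j)) = 0 by rewrite mulr0 subr0.
have : mform (\sum_i w i) (gact g (v j)) = 0 by rewrite sw0 mformC mform0r.
rewrite mform_suml (bigD1 j) //= big1 ?addr0 // => i ne.
by apply: (gspan_orth (hu i) (fixv j) _ (uw i)); rewrite uv (negbTE ne).
Qed.

(** Diagonal matrices are self-adjoint, and the one with 2 at place [k] and 1 elsewhere tells the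
    weights apart, since distinct powers of 2 differ in characteristic 0. *)
Lemma weights_orth nu nu' u u' : hw_vector nu u -> hw_vector nu' u' ->
  (exists k : 'I_p, ptk nu k != ptk nu' k) -> mform u u' = 0.
Proof.
move=> hu hu' [k ne]; pose d : 'rV[K]_p := \row_i (2%:R ^+ (i == k)).
have hd i : d 0 i != 0.
  by rewrite mxE expf_neq0 // ((pcharf0P K).1 charK0 2).
have chd mu : torus_char mu d = (2 ^ ptk mu k)%:R.
  rewrite /torus_char (bigD1 k) //= big1 => [|i ik].
    by rewrite mxE eqxx expr1 mulr1 natrX.
  by rewrite mxE (negbTE ik) expr0 expr1n.
have : mform (gact (diag_mx d) u) u' = mform u (gact (diag_mx d) u').
  by rewrite mform_gact tr_diag_mx.
rewrite (hw_torus hu hd) (hw_torus hu' hd) mformZl mformZr !chd => /eqP.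
rewrite -subr_eq0 -mulrBl mulf_eq0 subr_eq0 (natr_inj charK0) eqn_exp2l //.
by rewrite (negbTE ne) => /eqP.
Qed.

End HighestWeight.

(** * Infinitesimal action *)

Section Polarization.
Variables (K : fieldType) (p : nat).
Local Notation poly := (Defs.poly K p).
Local Notation mx3 := (mx3 K p).
Implicit Types (f g : poly) (A B u v w : mx3) (V : mx3 -> Prop) (nu : part3).
Implicit Types i j k l : 'I_p.

(* The infinitesimal action of the elementary matrix [E_ij]. *)
Definition polar i j f : poly := \sum_(r < 3) 'X_(tvar i r) * mderiv (tvar j r) f.

Lemma polarC i j c : polar i j c%:MP = 0.
Proof. by rewrite /polar big1 // => r _; rewrite mderivC mulr0. Qed.

Lemma polar0 i j : polar i j 0 = 0.
Proof. by rewrite -[X in polar _ _ X]mpolyC0 polarC. Qed.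

Lemma polarX i j k r : polar i j 'X_(tvar k r) = (j == k)%:R * 'X_(tvar i r).
Proof.
rewrite /polar (bigD1 r) //= big1 ?addr0 => [|s ne].
  by rewrite mderivXU tvar_inj eqxx andbT mulrC.
by rewrite mderivXU tvar_inj (negbTE ne) andbF mulr0.
Qed.

Lemma polarD i j : {morph polar i j : f g / f + g}.
Proof. by move=> f g; rewrite -big_split; apply: eq_bigr => r _; rewrite raddfD mulrDr. Qed.

Lemma polarM i j f g : polar i j (f * g) = polar i j f * g + f * polar i j g.
Proof.
rewrite mulr_suml mulr_sumr -big_split; apply: eq_bigr => r _ /=.
by rewrite mderivM; ring.
Qed.

Lemma polarN i j f : polar i j (- f) = - polar i j f.
Proof. by rewrite -mulN1r polarM -mpolyC1 -mpolyCN polarC mpolyCN mpolyC1; ring. Qed.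

Lemma polarB i j f g : polar i j (f - g) = polar i j f - polar i j g.
Proof. by rewrite polarD polarN. Qed.

Lemma polar_exp i j f n : polar i j (f ^+ n) = n%:R * f ^+ n.-1 * polar i j f.
Proof.
elim: n => [|n IH]; first by rewrite expr0 -mpolyC1 polarC !mul0r.
rewrite exprS polarM IH /=; case: n {IH} => [|n] /=; first by rewrite expr0; ring.
by rewrite exprS -[n.+2%:R]natr1; ring.
Qed.

Lemma polar_comm i j k l f :
  polar i j (polar k l f) - polar k l (polar i j f) =
  (j == k)%:R * polar i l f - (l == i)%:R * polar k j f.
Proof.
elim/mpoly_ring_ind: f => [c|v|f1 f2 IH1 IH2|f1 f2 IH1 IH2].
- by rewrite !polarC ?polar0; ring.
- rewrite -(tvar_eta v) !polarX !polarM !polarX.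
  have z a b n : polar a b n%:R = 0 by rewrite -mpolyC_nat polarC.
  by rewrite !z; ring.
- by rewrite !polarD opprD addrACA IH1 IH2; ring.
- rewrite !polarM !polarD !polarM.
  have e1 : polar i j (polar k l f1) = polar k l (polar i j f1) +
     ((j == k)%:R * polar i l f1 - (l == i)%:R * polar k j f1).
    by rewrite -IH1; ring.
  have e2 : polar i j (polar k l f2) = polar k l (polar i j f2) +
     ((j == k)%:R * polar i l f2 - (l == i)%:R * polar k j f2).
    by rewrite -IH2; ring.
  by rewrite e1 e2; ring.
Qed.

Definition Emx i j A : mx3 := map_mx (polar i j) A.

Lemma EmxM i j A B : Emx i j (A * B) = Emx i j A * B + A * Emx i j B.
Proof.
apply/matrixP => r s; rewrite !mxE /= -big_split (big_morph _ (polarD i j) (id1 := 0)).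
  by apply: eq_bigr => k _; rewrite polarM !mxE.
by rewrite polar0.
Qed.

Lemma Emx_scale i j f A : Emx i j (f *: A) = polar i j f *: A + f *: Emx i j A.
Proof. by apply/matrixP => r s; rewrite !mxE polarM. Qed.

Lemma Emx_sc i j c A : Emx i j (mxsc c A) = mxsc c (Emx i j A).
Proof. by rewrite /mxsc Emx_scale polarC scale0r add0r. Qed.

Lemma Emx0 i j : Emx i j 0 = 0.
Proof. by apply/matrixP => r s; rewrite !mxE -mpolyC0 polarC. Qed.

Lemma Emx_comm i j k l A :
  Emx i j (Emx k l A) = Emx k l (Emx i j A) +
    (mxsc (j == k)%:R (Emx i l A) - mxsc (l == i)%:R (Emx k j A)).
Proof.
apply/matrixP => r s; rewrite !mxE !mpolyC_nat.
by rewrite -polar_comm; ring.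
Qed.

Lemma Emx_tgen i j k : Emx i j (tgen K k) = if j == k then tgen K i else 0.
Proof.
apply/matrixP => r s; rewrite !mxE.
case: eqP => [<-|/eqP/negbTE ne]; rewrite !mxE;
  by case: ifP => _; [|case: ifP => _]; rewrite ?polarN ?polarX ?polar0 ?eqxx ?ne;
     rewrite ?mul1r ?mul0r ?oppr0.
Qed.

End Polarization.

Section Infinitesimal.
Variables (K : fieldType) (p : nat).
Hypothesis charK0 : [pchar K] =i pred0.
Local Notation poly := (Defs.poly K p).
Local Notation mx3 := (mx3 K p).
Implicit Types (f g : poly) (A B u v w : mx3) (V : mx3 -> Prop) (nu : part3).
Implicit Types i j k l : 'I_p.

Definition elem_mx i j (s : K) : 'M[K]_p := 1%:M + s *: delta_mx i j.

Lemma gact_elem_taylor i j f : exists Q : {poly poly},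
  [/\ Q`_0 = f, Q`_1 = polar i j f & forall s, gact_poly (elem_mx i j s) f = Q.[s%:MP]].
Proof.
elim/mpoly_ring_ind: f => [c|v|f1 f2 [P1 [h1 k1 e1]] [P2 [h2 k2 e2]]
    |f1 f2 [P1 [h1 k1 e1]] [P2 [h2 k2 e2]]].
- exists (c%:MP)%:P; rewrite !coefC polarC; split=> // s.
  by rewrite gact_polyC hornerC.
- set k := vk v; set r := vr v; rewrite -(tvar_eta v) polarX -/k -/r.
  exists (('X_(tvar k r))%:P + (((j == k)%:R * 'X_(tvar i r)) *: 'X)).
  rewrite !coefD !coefZ !coefX !coefC /= mulr0 mulr1 addr0 add0r; split=> // s.
  rewrite gact_polyX hornerD hornerC hornerZ hornerX.
  rewrite (eq_bigr (fun l => (l == k)%:R * 'X_(tvar l r) +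
      (j == k)%:R * ((l == i)%:R * 'X_(tvar l r)) * s%:MP)); last first.
    move=> l _; rewrite !mxE mpolyCD mpolyCM !mpolyC_nat -mulnb natrM [k == j]eq_sym; ring.
  rewrite big_split (bigD1 k) //= big1 => [|l /negbTE ->]; last by rewrite mul0r.
  rewrite (bigD1 i) //= big1 => [|l /negbTE ->]; last by rewrite mul0r mulr0 mul0r.
  by rewrite !eqxx /= !mul1r !addr0.
- exists (P1 + P2); rewrite !coefD h1 h2 k1 k2 polarD; split=> // s.
  by rewrite rmorphD /= e1 e2 hornerD.
- exists (P1 * P2); rewrite coef0M h1 h2 polarM; split=> // [|s].
    by rewrite coefM !big_ord_recl big_ord0 /= h1 h2 k1 k2 addr0 addrC.
  by rewrite rmorphM /= e1 e2 hornerM.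
Qed.

Lemma elem_mx_family A i j : exists n (B : nat -> mx3), [/\ (1 < n)%N, B 0%N = A,
  B 1%N = Emx i j A & forall s, gact (elem_mx i j s) A = \sum_(k < n) mxsc (s ^+ k) (B k)].
Proof.
have hQ r : exists Q : 'I_3 -> {poly poly}, forall t, [/\ (Q t)`_0 = A r t,
    (Q t)`_1 = polar i j (A r t) &
    forall s, gact_poly (elem_mx i j s) (A r t) = (Q t).[s%:MP]].
  have [Q hQ] := fin_all_exists (fun t => gact_elem_taylor i j (A r t)).
  by exists Q.
have {hQ} [Q hQ] := fin_all_exists hQ.
have [n hn] : exists n, forall r t, (size (Q r t) <= n)%N.
  exists (\max_(r < 3) \max_(t < 3) size (Q r t)) => r t.
  by apply: leq_trans (leq_bigmax r); apply: (leq_bigmax t).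
exists n.+2, (fun k : nat => \matrix_(r, t) (Q r t)`_k); split=> //.
- by apply/matrixP => r t; rewrite mxE; case: (hQ r t).
- by apply/matrixP => r t; rewrite !mxE; case: (hQ r t).
move=> s; apply/matrixP => r t; rewrite mxE summxE; have [_ _ ->] := hQ r t.
rewrite (@horner_coef_wide _ n.+2) ?(leq_trans (hn r t)) ?leqW //.
by apply: eq_bigr => k _; rewrite !mxE rmorphXn /= mulrC.
Qed.

(** The derivative is the linear coefficient of the polynomial curve given by 1 + s E_ij, so
    interpolation puts it in [V]. *)
Lemma Emx_stable V i j A : submodule V -> V A -> V (Emx i j A).
Proof.
move=> hV VA; have [n [B [n1 _ <- hB]]] := elem_mx_family A i j.
apply: (subspace_coefs charK0 hV.1 (oner_neq0 _) _ n1) => m _.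
by rewrite -hB; apply: (submodule_gact charK0).
Qed.

End Infinitesimal.

(* Peels one head symbol at a time: [mxE] does not terminate in reasonable time on nested sums of
   matrices of polynomials. *)
Ltac mx3_entries := repeat match goal with
  | |- context [@fun_of_matrix ?R ?m ?n ?S ?i ?j] =>
    let H := fresh in
    match S with
    | @Algebra.add _ ?A ?B => pose proof (mx3D A B i j :
        @fun_of_matrix R m n S i j = fun_of_matrix A i j + fun_of_matrix B i j) as H
    | @Algebra.opp _ ?A => pose proof (mx3N A i j :
        @fun_of_matrix R m n S i j = - fun_of_matrix A i j) as H
    | @GRing.scale _ _ ?f ?A => pose proof (mx3Z f A i j :
        @fun_of_matrix R m n S i j = f * fun_of_matrix A i j) as H
    | @Algebra.zero _ => pose proof (mx30 _ _ i j : @fun_of_matrix R m n S i j = 0) as H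
    end; rewrite -> H; clear H
  end.
Ltac mxring := apply/matrixP => ? ?; mx3_entries; rewrite ?(natrM, natrD, =^~ natr1); ring.

(** * Lowering operators applied to products with the generators *)

Section Reduction.
Variables (K : fieldType) (p : nat).
Hypothesis charK0 : [pchar K] =i pred0.
Local Notation poly := (Defs.poly K p).
Local Notation mx3 := (mx3 K p).
Local Notation t := (tgen K).
Local Notation E := Emx.
Variables (V : mx3 -> Prop) (hV : submodule V).
Implicit Types (f : poly) (A B u : mx3).

Lemma submodN A : V A -> V (- A). Proof. exact: (subspN hV.1). Qed.
Lemma submodD A B : V A -> V B -> V (A + B). Proof. exact: (subspD hV.1). Qed.
Lemma submodB A B : V A -> V B -> V (A - B). Proof. exact: (subspB hV.1). Qed.

Lemma submodMn n A : V A -> V (n%:R *: A).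
Proof. by move=> VA; rewrite -mpolyC_nat; apply: (subspZ hV.1). Qed.

Lemma submodMnK n A : V (n.+1%:R *: A) -> V A.
Proof.
by rewrite -mpolyC_nat; apply: (subspZK hV.1); rewrite ((pcharf0P K).1 charK0).
Qed.

Lemma submodE i j A : V A -> V (E i j A). Proof. exact: Emx_stable. Qed.

Lemma mx3_scaleAl f A B : f *: (A * B) = (f *: A) * B :> mx3.
Proof. exact: scalemxAl. Qed.

Lemma mx3_scaleAr f A B : f *: (A * B) = A * (f *: B) :> mx3.
Proof. exact: scalemxAr. Qed.

Lemma Emx_t i j A : E j i (t i * A) = t j * A + t i * E j i A.
Proof. by rewrite EmxM Emx_tgen eqxx. Qed.

Lemma Emx_tC i j k A : j != i -> E k j (t i * A) = t i * E k j A.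
Proof. by move=> /negbTE ne; rewrite EmxM Emx_tgen ne mul0r add0r. Qed.

(** The Leibniz rule for [E i2 i1 (t i1 * u)] brings in [t i2 * u]. If [u] is a highest weight
    vector whose first two weights differ by [al], the combination assumed in [V] is the one killed
    by the raising operator [E i1 i2]. *)
Lemma submod_t2 (i1 i2 : 'I_p) (al : nat) u : V (t i1 * u) ->
  V (t i1 * E i2 i1 u - al%:R *: (t i2 * u)) -> V (t i2 * u).
Proof.
move=> V1 Vw; apply: (@submodMnK al).
have -> : al.+1%:R *: (t i2 * u) =
    E i2 i1 (t i1 * u) - (t i1 * E i2 i1 u - al%:R *: (t i2 * u)).
  rewrite Emx_t; move: (t i2 * u) (t i1 * _) => a b.
  by mxring.
by apply: submodB => //; apply: submodE.
Qed.

(** The coefficients are those for which the combination is killed by the raising operators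
    [E i1 i2] and [E i2 i3], when [u] is a highest weight vector with gaps [al] and [be]. *)
Lemma submod_t3 (i1 i2 i3 : 'I_p) (al be : nat) u : i1 != i2 ->
  V (t i1 * u) -> V (t i2 * u) ->
  V ((al + be).+1%:R *: (t i2 * E i3 i2 u - be%:R *: (t i3 * u)) + be%:R *: (t i1 * E i3 i1 u)
     - t i1 * E i2 i1 (E i3 i2 u)) -> V (t i3 * u).
Proof.
move=> n12 V1 V2 Vw; have n21 : i2 != i1 by rewrite eq_sym.
have A1 := Emx_t i2 i3 u; have A2 := Emx_t i1 i3 u.
have A3 : E i2 i1 (E i3 i2 (t i1 * u)) = t i2 * E i3 i2 u + t i1 * E i2 i1 (E i3 i2 u).
  by rewrite -(Emx_t i1 i2 (E i3 i2 u)) -(Emx_tC i3 u n21).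
have W1 := submodE i3 i2 V2; have W2 := submodE i3 i1 V1.
have W3 := submodE i2 i1 (submodE i3 i2 V1).
(* The coefficient of [t i3 * u] in the combination below is (be + 1)(al + be + 2); [submodMnK]
   wants it as a successor. *)
apply: (@submodMnK ((be.+1 * (al + be).+2).-1)).
have -> : (be.+1 * (al + be).+2).-1.+1%:R *: (t i3 * u) =
   (al + be).+2%:R *: E i3 i2 (t i2 * u) + be%:R *: E i3 i1 (t i1 * u)
   - E i2 i1 (E i3 i2 (t i1 * u)) -
   ((al + be).+1%:R *: (t i2 * E i3 i2 u - be%:R *: (t i3 * u)) + be%:R *: (t i1 * E i3 i1 u)
     - t i1 * E i2 i1 (E i3 i2 u)).
  rewrite A1 A2 A3 prednK ?muln_gt0 //.
  move: (t i3 * u) (t i2 * _) (t i1 * E i3 i1 u) (t i1 * _) => a b c d.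
  by mxring.
apply: submodB => //; apply: submodB => //.
by apply: submodD; apply: submodMn.
Qed.

(* If [u = d u'] with [d] the determinant of the first three vectors, then Cramer's rule writes
   [t_4 u] as the sum of the products [d_j t_j u'], where [d_j] is [d] with the [j]-th vector
   replaced by the fourth.  Up to elements of [V], the lowering operators turn each of them into a
   negative multiple of [t_4 u]. *)
Lemma submod_t4 (i1 i2 i3 i4 : 'I_p) (d d1 d2 d3 : poly) (al be n3 : nat) u' :
  i1 != i2 -> i1 != i3 -> i2 != i3 ->
  let u := d *: u' in
  let X i r : poly := 'X_(tvar i r) in
  (forall r, d * X i4 r = d1 * X i1 r + d2 * X i2 r + d3 * X i3 r) ->
  polar i4 i1 d = d1 -> polar i4 i2 d = d2 -> polar i4 i3 d = d3 ->
  polar i2 i1 d = 0 -> polar i3 i1 d = 0 -> polar i3 i2 d = 0 ->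
  E i1 i2 u' = 0 -> E i1 i3 u' = 0 -> E i2 i3 u' = 0 ->
  E i1 i1 u' = (al + be + n3)%:R *: u' -> E i2 i2 u' = (be + n3)%:R *: u' ->
  E i3 i3 u' = n3%:R *: u' ->
  V (t i1 * u) -> V (t i2 * u) -> V (t i3 * u) -> V (t i4 * u).
Proof.
move=> n12 n13 n23 u X cramer dd1 dd2 dd3 d21 d31 d32 E12 E13 E23 E11 E22 E33 V1 V2 V3.
rewrite /X {X} in cramer.
have cramerE k A : d *: E i4 k A = d1 *: E i1 k A + d2 *: E i2 k A + d3 *: E i3 k A.
  apply/matrixP => r s; mx3_entries; rewrite !mxE /polar !mulr_sumr -!big_split /=.
  by apply: eq_bigr => q _; rewrite mulrA cramer; ring.
have cramer_t : d *: t i4 = d1 *: t i1 + d2 *: t i2 + d3 *: t i3.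
  apply/matrixP => r s; mx3_entries; rewrite !mxE.
  by case: ifP => _; [|case: ifP => _]; rewrite ?mulrN ?cramer; ring.
have comm i j k l A : E i j (E k l A) = E k l (E i j A) +
    ((j == k)%:R *: E i l A - (l == i)%:R *: E k j A).
  by rewrite Emx_comm /mxsc !mpolyC_nat.
have [n21 n31 n32] : [/\ i2 != i1, i3 != i1 & i3 != i2] by split; rewrite eq_sym.
have cmp := (eqxx, negbTE n12, negbTE n13, negbTE n23, negbTE n21, negbTE n31, negbTE n32).
have EmxZ n i j A : E i j (n%:R *: A) = n%:R *: E i j A.
  by rewrite -mpolyC_nat -/(mxsc _ _) Emx_sc.
have E4 k h : E i4 k (d *: h) =
    polar i4 k d *: h + (d1 *: E i1 k h + d2 *: E i2 k h + d3 *: E i3 k h).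
  by rewrite Emx_scale cramerE.
pose u21 := E i2 i1 u'; pose u31 := E i3 i1 u'; pose u32 := E i3 i2 u'.
pose g := E i3 i2 u21.
have Eu21 : E i2 i1 u = d *: u21 by rewrite Emx_scale d21 scale0r add0r.
have Eu31 : E i3 i1 u = d *: u31 by rewrite Emx_scale d31 scale0r add0r.
have Eu32 : E i3 i2 u = d *: u32 by rewrite (Emx_scale _ _ d) d32 scale0r add0r.
have Eg : E i3 i2 (d *: u21) = d *: g by rewrite (Emx_scale _ _ d) d32 scale0r add0r.
pose z := t i4 * u.
(* By Cramer's rule [z] is the sum of [a1], [a2], [a3]. The terms [b2], [b], [c], [e], built from
   lowered [u'], arise from applying [E i4 k] and have to be eliminated. *)
pose a1 := d1 *: (t i1 * u'); pose a2 := d2 *: (t i2 * u'); pose a3 := d3 *: (t i3 * u').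
pose b2 := d3 *: (t i2 * u32).
pose b := d2 *: (t i1 * u21); pose c := d3 *: (t i1 * u31); pose e := d3 *: (t i1 * g).
have tZ k f A : t k * (f *: A) = f *: (t k * A) by rewrite mx3_scaleAr.
have zE : z = a1 + a2 + a3.
  rewrite /z /u tZ mx3_scaleAl cramer_t 2!mulrDl /a1 /a2 /a3.
  by rewrite (mx3_scaleAl d1) (mx3_scaleAl d2) (mx3_scaleAl d3).
have Vt j k A : V (t j * A) -> k != j -> V (t j * E i4 k A).
  by move=> VA ne; rewrite -Emx_tC //; apply: submodE.
have Vz j : V (t j * u) -> V (z + t j * E i4 j u).
  by move=> Vj; rewrite -Emx_t; apply: submodE.
have Vlow j k h : V (t j * u) -> V (t k * u) -> E k j u = d *: h -> V (t j * (d *: h)).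
  move=> Vj Vk <-; have -> : t j * E k j u = E k j (t j * u) - t k * u.
    by rewrite Emx_t addrC addKr.
  by apply: submodB => //; apply: submodE.
have V32 := Vlow _ _ _ V2 V3 Eu32.
have V21 := Vlow _ _ _ V1 V2 Eu21.
have V31 := Vlow _ _ _ V1 V3 Eu31.
have Vg : V (t i1 * (d *: g)).
  by rewrite -Eg -Emx_tC //; apply: submodE.
(* [R1], [R2], [R3] come from [E i4 j] applied to [t j * u]. The relations [R2'], [F1], [F2], [F3]
   apply [E i4 k] to [t j] times a lowered vector with [k] different from [j], so that [z] does not
   enter. *)
have R3 : V (z + n3.+1%:R *: a3).
  have := Vz _ V3; rewrite (E4 i3 u') dd3 E13 E23 E33 !mulrDr !tZ mulr0 /a3.
  move: (t i3 * u') => x; congr (V (z + _)).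
  by mxring.
have R2 : V (z + ((be + n3).+1%:R *: a2 + b2)).
  have := Vz _ V2; rewrite (E4 i2 u') dd2 E12 E22 -/u32 !mulrDr !tZ mulr0 /a2 /b2.
  move: (t i2 * u') (t i2 * u32) => x y; congr (V (z + _)).
  by mxring.
have R1 : V (z + ((al + be + n3).+1%:R *: a1 + b + c)).
  have := Vz _ V1; rewrite (E4 i1 u') dd1 E11 -/u21 -/u31 !mulrDr !tZ /a1 /b /c.
  move: (t i1 * u') (t i1 * u21) (t i1 * u31) => x y w; congr (V (z + _)).
  by mxring.
have R2' : V (be%:R *: a2 + n3.+2%:R *: b2).
  have e13 : E i1 i3 u32 = 0.
    rewrite /u32 comm !cmp /= E13 E12 Emx0; mxring.
  have e23 : E i2 i3 u32 = be%:R *: u'.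
    rewrite /u32 comm !cmp /= E23 E22 E33 Emx0; mxring.
  have e33 : E i3 i3 u32 = n3.+1%:R *: u32.
    rewrite /u32 comm !cmp /= E33 EmxZ -/u32.
    by mxring.
  have := Vt _ _ _ V32 n32; rewrite (E4 i3 u32) dd3 e13 e23 e33 !mulrDr !tZ mulr0 /a2 /b2.
  move: (t i2 * u') (t i2 * u32) => x y; congr V.
  by mxring.
have F1 : V (al%:R *: a1 + (be + n3).+2%:R *: b + e).
  have e12 : E i1 i2 u21 = al%:R *: u'.
    rewrite /u21 comm !cmp /= E12 E11 E22 Emx0; mxring.
  have e22 : E i2 i2 u21 = (be + n3).+1%:R *: u21.
    rewrite /u21 comm !cmp /= E22 EmxZ -/u21.
    by mxring.
  have := Vt _ _ _ V21 n21; rewrite (E4 i2 u21) dd2 e12 e22 -/g !mulrDr !tZ /a1 /b /e.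
  move: (t i1 * u') (t i1 * u21) (t i1 * g) => x y w; congr V.
  by mxring.
have F2 : V ((al + be)%:R *: a1 + b + n3.+2%:R *: c).
  have e13 : E i1 i3 u31 = (al + be)%:R *: u'.
    rewrite /u31 comm !cmp /= E13 E11 E33 Emx0; mxring.
  have e23 : E i2 i3 u31 = u21.
    rewrite /u31 comm !cmp /= E23 E33 Emx0 -/u21.
    by mxring.
  have e33 : E i3 i3 u31 = n3.+1%:R *: u31.
    rewrite /u31 comm !cmp /= E33 EmxZ -/u31.
    by mxring.
  have := Vt _ _ _ V31 n31; rewrite (E4 i3 u31) dd3 e13 e23 e33 !mulrDr !tZ /a1 /b /c.
  move: (t i1 * u') (t i1 * u21) (t i1 * u31) => x y w; congr V.
  by mxring.
have F3 : V (al%:R *: a1 + be.+1%:R *: b + n3.+2%:R *: e).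
  have e12 : E i1 i2 u21 = al%:R *: u'.
    rewrite /u21 comm !cmp /= E12 E11 E22 Emx0; mxring.
  have e13' : E i1 i3 u21 = 0.
    rewrite /u21 comm !cmp /= E13 E23 Emx0; mxring.
  have e23' : E i2 i3 u21 = 0.
    rewrite /u21 comm !cmp /= E23 Emx0; mxring.
  have e22 : E i2 i2 u21 = (be + n3).+1%:R *: u21.
    rewrite /u21 comm !cmp /= E22 EmxZ -/u21.
    by mxring.
  have e33' : E i3 i3 u21 = n3%:R *: u21.
    rewrite /u21 comm !cmp /= E33 E23 EmxZ -/u21.
    by mxring.
  have e13 : E i1 i3 g = al%:R *: u'.
    rewrite /g comm !cmp /= e13' e12 Emx0; mxring.
  have e23 : E i2 i3 g = be.+1%:R *: u21.
    rewrite /g comm !cmp /= e23' e22 e33' Emx0.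
    by mxring.
  have e33 : E i3 i3 g = n3.+1%:R *: g.
    rewrite /g comm !cmp /= e33' EmxZ -/g.
    by mxring.
  have := Vt _ _ _ Vg n31; rewrite (E4 i3 g) dd3 e13 e23 e33 !mulrDr !tZ /a1 /b /e.
  move: (t i1 * u') (t i1 * u21) (t i1 * g) => x y w; congr V.
  by mxring.
(* [e] is eliminated here between [F1] and [F3]. Then [HA] removes [c] from [R1] by [F2] and [b] by
   [G1], and [H2] removes [b2] from [R2] by [R2']. *)
have G1 : V (al%:R *: a1 + (be + n3).+3%:R *: b).
  apply: (@submodMnK n3).
  have -> : n3.+1%:R *: (al%:R *: a1 + (be + n3).+3%:R *: b) =
    n3.+2%:R *: (al%:R *: a1 + (be + n3).+2%:R *: b + e) -
    (al%:R *: a1 + be.+1%:R *: b + n3.+2%:R *: e).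
    by clearbody a1 b e; mxring.
  by apply: submodB => //; apply: submodMn.
have HA : V ((n3.+2 * (be + n3).+3)%:R *: z
    + (n3.+1 * (be + n3).+2 * (al + be + n3).+3)%:R *: a1).
  have -> : (n3.+2 * (be + n3).+3)%:R *: z
      + (n3.+1 * (be + n3).+2 * (al + be + n3).+3)%:R *: a1 =
    (be + n3).+3%:R *: (n3.+2%:R *: (z + ((al + be + n3).+1%:R *: a1 + b + c)) -
      ((al + be)%:R *: a1 + b + n3.+2%:R *: c)) -
    n3.+1%:R *: (al%:R *: a1 + (be + n3).+3%:R *: b).
    by clearbody a1 b c z; mxring.
  by do 3!(apply: submodB || apply: submodMn) => //; apply: submodMn.
have H2 : V (n3.+2%:R *: z + (n3.+1 * (be + n3).+2)%:R *: a2).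
  have -> : n3.+2%:R *: z + (n3.+1 * (be + n3).+2)%:R *: a2 =
    n3.+2%:R *: (z + ((be + n3).+1%:R *: a2 + b2)) - (be%:R *: a2 + n3.+2%:R *: b2).
    by clearbody a2 b2 z; mxring.
  by apply: submodB => //; apply: submodMn.
(* The multipliers give [a1], [a2], [a3] one common coefficient, so that together they are again a
   multiple of [z]; [N] is a sum of positive terms. *)
pose N := (n3.+2 * (be + n3).+3 + (al + be + n3).+3 * n3.+2
   + (be + n3).+2 * (al + be + n3).+3 + n3.+1 * (be + n3).+2 * (al + be + n3).+3)%N.
apply: (@submodMnK N.-1); rewrite prednK //.
have -> : N%:R *: z =
   ((n3.+2 * (be + n3).+3)%:R *: z + (n3.+1 * (be + n3).+2 * (al + be + n3).+3)%:R *: a1)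
   + (al + be + n3).+3%:R *: (n3.+2%:R *: z + (n3.+1 * (be + n3).+2)%:R *: a2)
   + ((be + n3).+2 * (al + be + n3).+3)%:R *: (z + n3.+1%:R *: a3).
  by rewrite /N zE; clearbody a1 a2 a3; mxring.
by apply: submodD; [apply: submodD|]; rewrite -/z //; apply: submodMn.
Qed.

End Reduction.

(** * Vector algebra in dimension three *)

Definition o0 : 'I_3 := @Ordinal 3 0 isT.
Definition o1 : 'I_3 := @Ordinal 3 1 isT.
Definition o2 : 'I_3 := @Ordinal 3 2 isT.

Lemma ord3_ind (P : 'I_3 -> Prop) : P o0 -> P o1 -> P o2 -> forall i, P i.
Proof.
move=> h0 h1 h2 [[|[|[|//]]] hi].
- by rewrite (_ : Ordinal hi = o0) //; apply: val_inj.
- by rewrite (_ : Ordinal hi = o1) //; apply: val_inj.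
- by rewrite (_ : Ordinal hi = o2) //; apply: val_inj.
Qed.

Lemma sum3 (V : nmodType) (F : 'I_3 -> V) : \sum_i F i = F o0 + F o1 + F o2.
Proof.
rewrite !big_ord_recl big_ord0 addr0 addrA.
by congr (F _ + F _ + F _); apply: val_inj.
Qed.

Definition vec3 T (a b c : T) (i : 'I_3) : T :=
  match val i with 0%N => a | 1%N => b | _ => c end.

(* [X], [Y], [Z] stand for [x], [y], [cross x y]: two letters denote an outer product, [S] a skew
   matrix (see [bmx]). *)
Inductive kind := K1 | KXX | KYY | KSX | KSY | KXY | KYX | KZX | KZY.

Definition degx h : nat :=
  match h with KXX | KZX => 2 | KSX | KXY | KYX | KZY => 1 | _ => 0 end.
Definition degy h : nat :=
  match h with KYY | KZY => 2 | KSY | KXY | KYX | KZX => 1 | _ => 0 end.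

Section Vectors.
Variable R : comNzRingType.
Implicit Types (x y a b xi eta : 'I_3 -> R) (h : kind).

Definition cross a b : 'I_3 -> R :=
  vec3 (a o1 * b o2 - a o2 * b o1) (a o2 * b o0 - a o0 * b o2) (a o0 * b o1 - a o1 * b o0).
Definition dot a b : R := a o0 * b o0 + a o1 * b o1 + a o2 * b o2.
Definition outer a b : 'M[R]_3 := \matrix_(i, j) (a i * b j).
Definition skew a : 'M[R]_3 := \matrix_(i, j)
  vec3 (vec3 0 (- a o2) (a o1) j) (vec3 (a o2) 0 (- a o0) j) (vec3 (- a o1) (a o0) 0 j) i.
Definition det3 a b c : R := dot (cross a b) c.
Definition unitv (i : 'I_3) : 'I_3 -> R := fun j => (i == j)%:R.

Definition bmx h x y : 'M[R]_3 :=
  match h with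
  | K1 => 1 | KXX => outer x x | KYY => outer y y | KSX => skew x | KSY => skew y
  | KXY => outer x y | KYX => outer y x
  | KZX => outer (cross x y) x | KZY => outer (cross x y) y
  end.

(* Directional derivatives of [bmx h]: in [x] along [xi], in [y] along [eta], and mixed. *)
Definition bmx_x h xi x y : 'M[R]_3 :=
  match h with
  | KXX => outer xi x + outer x xi | KSX => skew xi
  | KXY => outer xi y | KYX => outer y xi
  | KZX => outer (cross xi y) x + outer (cross x y) xi | KZY => outer (cross xi y) y
  | _ => 0
  end.
Definition bmx_y h eta x y : 'M[R]_3 :=
  match h with
  | KYY => outer eta y + outer y eta | KSY => skew eta
  | KXY => outer x eta | KYX => outer eta x
  | KZX => outer (cross x eta) x | KZY => outer (cross x eta) y + outer (cross x y) eta
  | _ => 0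
  end.
Definition bmx_xy h xi eta x y : 'M[R]_3 :=
  match h with
  | KXY => outer xi eta | KYX => outer eta xi
  | KZX => outer (cross xi eta) x + outer (cross x eta) xi
  | KZY => outer (cross xi eta) y + outer (cross xi y) eta
  | _ => 0
  end.

Section Derivation.
Variable D : R -> R.
Hypotheses (derD : {morph D : f g / f + g})
  (derM : forall f g, D (f * g) = D f * g + f * D g).

Lemma der0 : D 0 = 0. Proof. by apply: (addrI (D 0)); rewrite -derD !addr0. Qed.
Lemma derN f : D (- f) = - D f.
Proof. by apply: (addrI (D f)); rewrite -derD !subrr der0. Qed.
Lemma derB f g : D (f - g) = D f - D g. Proof. by rewrite derD derN. Qed.
Lemma der1 : D 1 = 0.
Proof. by apply: (addrI (D 1)); rewrite addr0 -{1}[D 1]mulr1 -{2}[D 1]mul1r -derM mulr1. Qed.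

Lemma der_cross a b i : D (cross a b i) = cross (D \o a) b i + cross a (D \o b) i.
Proof. by elim/ord3_ind: i; rewrite /cross /vec3 /= derB !derM; ring. Qed.

Lemma der_dot a b : D (dot a b) = dot (D \o a) b + dot a (D \o b).
Proof. by rewrite /dot !derD !derM /=; ring. Qed.

Lemma der_outer a b : map_mx D (outer a b) = outer (D \o a) b + outer a (D \o b).
Proof. by apply/matrixP => i j; rewrite !mxE derM. Qed.

Lemma der_skew a : map_mx D (skew a) = skew (D \o a).
Proof.
by apply/matrixP => i j; elim/ord3_ind: i; elim/ord3_ind: j;
  rewrite !mxE /vec3 /= ?derN ?der0.
Qed.

Lemma eq_cross a a' b b' : a =1 a' -> b =1 b' -> cross a b =1 cross a' b'.
Proof. by move=> ea eb i; rewrite /cross !ea !eb. Qed.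

Lemma eq_outer a a' b b' : a =1 a' -> b =1 b' -> outer a b = outer a' b'.
Proof. by move=> ea eb; apply/matrixP => i j; rewrite !mxE ea eb. Qed.

Lemma eq_skew a a' : a =1 a' -> skew a = skew a'.
Proof. by move=> ea; apply/matrixP => i j; rewrite !mxE /vec3 !ea. Qed.

Lemma der_outer_cross a b c :
  map_mx D (outer (cross a b) c) =
  outer (cross (D \o a) b) c + outer (cross a (D \o b)) c + outer (cross a b) (D \o c).
Proof.
by apply/matrixP => i j; rewrite !mxE derM der_cross mulrDl.
Qed.

Lemma der_mxD (A B : 'M[R]_3) : map_mx D (A + B) = map_mx D A + map_mx D B.
Proof. by apply/matrixP => i j; rewrite !mxE derD. Qed.

Lemma der_mxZ f (A : 'M[R]_3) : map_mx D (f *: A) = D f *: A + f *: map_mx D A.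
Proof. by apply/matrixP => i j; rewrite !mxE derM. Qed.

Lemma der_mx0 : map_mx D (0 : 'M[R]_3) = 0.
Proof. by apply/matrixP => i j; rewrite !mxE der0. Qed.

Lemma der_bmx h x y :
  map_mx D (bmx h x y) = bmx_x h (D \o x) x y + bmx_y h (D \o y) x y.
Proof.
case: h => /=; rewrite ?der_outer_cross ?der_outer ?der_skew ?add0r ?addr0 //.
- by apply/matrixP => i j; rewrite !mxE; case: eqP; rewrite ?der1 ?der0.
- by apply: addrC.
- by rewrite addrAC.
- by rewrite -addrA.
Qed.

Lemma der_bmx_y h eta x y : D \o y =1 (fun=> 0) ->
  map_mx D (bmx_y h eta x y) = bmx_xy h (D \o x) eta x y + bmx_y h (D \o eta) x y.
Proof.
move=> Dy0.
have c0 a i : cross a (D \o y) i = 0.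
  by rewrite (eq_cross (frefl a) Dy0) /cross /vec3; case: (val i) => [|[|?]] /=; ring.
have m0 a : outer a (D \o y) = 0 by apply/matrixP => i j; rewrite !mxE Dy0 mulr0.
have m1 a : outer (D \o y) a = 0 by apply/matrixP => i j; rewrite !mxE Dy0 mul0r.
have m2 a b : outer (cross a (D \o y)) b = 0.
  by apply/matrixP => i j; rewrite !mxE c0 mul0r.
case: h => /=; rewrite ?der_mxD ?der_outer_cross ?der_outer ?der_skew ?der_mx0 ?m0 ?m1 ?m2
  ?add0r ?addr0 //.
- by apply: addrC.
- by rewrite addrAC.
- by rewrite addrACA.
Qed.

End Derivation.

(** Lagrange's formula for an iterated cross product with a basis vector. *)
Lemma cross_unitv_skew (x s : 'I_3 -> R) i :
  s i *: skew x - x i *: skew s = skew (cross (unitv i) (cross x s)).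
Proof.
apply/matrixP => r t; elim/ord3_ind: i; elim/ord3_ind: r; elim/ord3_ind: t;
  by rewrite !mxE /cross /vec3 /unitv /=; ring.
Qed.

(** Cramer's rule, expanding the determinant times the [j]-th basis vector in [x], [s], [v], carried
    over by the linear map [skew]. *)
Lemma skew_cramer (x s v : 'I_3 -> R) j :
  cross x v j *: skew s - cross x s j *: skew v =
  cross s v j *: skew x - det3 x s v *: skew (unitv j).
Proof.
apply/matrixP => r t; elim/ord3_ind: j; elim/ord3_ind: r; elim/ord3_ind: t;
  by rewrite !mxE /det3 /dot /cross /vec3 /unitv /=; ring.
Qed.

(* The second-order terms collapse to the contraction of [M] because [x_i (s x v)_j + v_i (x x
   s)_j - s_i (x x v)_j = det3 x s v] times the Kronecker delta, modulo the Euler relations. *)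
Lemma mixed_contraction (x s v : 'I_3 -> R) i j :
  x i * cross s v j + v i * cross x s j - s i * cross x v j = det3 x s v * (i == j)%:R.
Proof.
by elim/ord3_ind: i; elim/ord3_ind: j; rewrite /det3 /dot /cross /vec3 /=; ring.
Qed.

(** [P], [Q], [M] stand for the partial derivatives of [f] in [y = cross x s], in [x], and in both;
    the hypotheses are Euler's relations. The left side is the combination of [submod_t3]: the
    determinant factors out and leaves a traced mixed derivative and a curl. *)
Lemma w3_algebra (x s v : 'I_3 -> R) (f : 'M[R]_3) (P Q : 'I_3 -> 'M[R]_3)
    (M : 'I_3 -> 'I_3 -> 'M[R]_3) (al be : nat) :
  be%:R *: f = \sum_j cross x s j *: P j ->
  (forall j, al%:R *: P j = \sum_i x i *: M i j) ->
  (forall i, be%:R *: Q i = \sum_j cross x s j *: M i j) ->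
  (al + be).+1%:R *: (skew s * (\sum_j cross x v j *: P j) - be%:R *: (skew v * f))
   + be%:R *: (skew x * (\sum_i v i *: Q i + \sum_j cross v s j *: P j))
   - skew x * (\sum_i \sum_j (s i * cross x v j) *: M i j + \sum_j cross s v j *: P j)
  = det3 x s v *: (skew x * (\sum_i M i i)
      - (al + be).+1%:R *: (\sum_j skew (unitv j) * P j)).
Proof.
move=> ef eP eQ; set d := det3 x s v.
pose C := \sum_j cross s v j *: P j; pose G := \sum_j skew (unitv j) * P j.
pose W := \sum_i v i *: Q i; pose S := \sum_i \sum_j (s i * cross x v j) *: M i j.
have -> : be%:R *: (skew v * f) = skew v * (\sum_j cross x s j *: P j).
  by rewrite -ef scalerAr.
have step1 : skew s * (\sum_j cross x v j *: P j) - skew v * (\sum_j cross x s j *: P j)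
    = skew x * C - d *: G.
  rewrite !mulr_sumr scaler_sumr -!sumrB; apply: eq_bigr => j _.
  rewrite -!scalerAr !scalerAl -mulrBl (skew_cramer x s v j) mulrBl.
  by rewrite -!scalerAl.
have eC : \sum_j cross v s j *: P j = - C.
  rewrite -sumrN; apply: eq_bigr => j _; rewrite -scaleNr; congr (_ *: _).
  by elim/ord3_ind: j; rewrite /cross /vec3 /=; ring.
(* The Euler relations turn all three terms into double sums over [M], of which [mixed_contraction]
   keeps the diagonal. *)
have eL : al%:R *: C + be%:R *: W - S = d *: \sum_i M i i.
  rewrite !scaler_sumr.
  rewrite (eq_bigr (fun j => \sum_i (x i * cross s v j) *: M i j)); last first.
    move=> j _; rewrite scalerA mulrC -scalerA eP scaler_sumr.
    by apply: eq_bigr => i _; rewrite scalerA mulrC.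
  rewrite exchange_big /=.
  rewrite [X in _ + X - _](eq_bigr (fun i => \sum_j (v i * cross x s j) *: M i j)); last first.
    move=> i _; rewrite scalerA mulrC -scalerA eQ scaler_sumr.
    by apply: eq_bigr => j _; rewrite scalerA.
  rewrite -big_split -sumrB; apply: eq_bigr => i _.
  rewrite -big_split -sumrB (bigD1 i) //= big1 => [|j ne]; rewrite -scalerDl -scalerBl.
    by rewrite mixed_contraction eqxx mulr1 addr0.
  by rewrite mixed_contraction eq_sym (negbTE ne) mulr0 scale0r.
rewrite step1 eC -/C -/W -/S -/G.
have -> : d *: (skew x * (\sum_i M i i) - (al + be).+1%:R *: G) =
    skew x * (al%:R *: C + be%:R *: W - S) - d *: ((al + be).+1%:R *: G).
  by rewrite scalerBr scalerAr -eL.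
rewrite !(mulrDr (skew x)) !mulrN -!scalerAr.
move: (skew x * C) (skew x * W) (skew x * S) => c w z.
by apply/matrixP => i j; rewrite !mxE; ring.
Qed.

(** [Q] stands for the gradient of [f] in [x], the hypothesis is Euler's relation, and the left side
    is the combination of [submod_t2]. *)
Lemma w2_algebra (x s : 'I_3 -> R) (f : 'M[R]_3) (Q : 'I_3 -> 'M[R]_3) (al : nat) :
  al%:R *: f = \sum_i x i *: Q i ->
  skew x * (\sum_i s i *: Q i) - al%:R *: (skew s * f) =
  \sum_i skew (cross (unitv i) (cross x s)) * Q i.
Proof.
move=> ef; rewrite scalerAr ef !mulr_sumr -sumrB; apply: eq_bigr => i _.
by rewrite -!scalerAr !scalerAl -mulrBl cross_unitv_skew.
Qed.

End Vectors.

Ltac mx33 := let i := fresh in let j := fresh in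
  apply/matrixP => i j; elim/ord3_ind: i; elim/ord3_ind: j;
  rewrite !mxE /cross /vec3 /unitv /dot /=; ring.

(** * Powers of norms times the nine matrices, and their derivatives *)

Section Families.
Variable R : comNzRingType.
Implicit Types (x y a b xi eta : 'I_3 -> R) (h : kind).

Definition qr (m n : nat) x y : R := dot x x ^+ m * dot y y ^+ n.
(** Derivatives along [xi] and [eta], and the mixed one. Truncated predecessors are harmless, as the
    numerical factor vanishes whenever the exponent is 0. *)
Definition qr_x m n xi x y : R := (2 * m)%:R * dot xi x * qr m.-1 n x y.
Definition qr_y m n eta x y : R := (2 * n)%:R * dot eta y * qr m n.-1 x y.
Definition qr_xy m n xi eta x y : R :=
  (4 * (m * n))%:R * dot xi x * dot eta y * qr m.-1 n.-1 x y.

Definition fam h m n x y : 'M[R]_3 := qr m n x y *: bmx h x y.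
Definition fam_x h m n xi x y : 'M[R]_3 :=
  qr_x m n xi x y *: bmx h x y + qr m n x y *: bmx_x h xi x y.
Definition fam_y h m n eta x y : 'M[R]_3 :=
  qr_y m n eta x y *: bmx h x y + qr m n x y *: bmx_y h eta x y.
Definition fam_xy h m n xi eta x y : 'M[R]_3 :=
  qr_xy m n xi eta x y *: bmx h x y + qr_x m n xi x y *: bmx_y h eta x y
  + qr_y m n eta x y *: bmx_x h xi x y + qr m n x y *: bmx_xy h xi eta x y.

Section Derivation.
Variable D : R -> R.
Hypotheses (derD : {morph D : f g / f + g})
  (derM : forall f g, D (f * g) = D f * g + f * D g).

Lemma der_exp f n : D (f ^+ n) = n%:R * f ^+ n.-1 * D f.
Proof.
elim: n => [|n IH]; first by rewrite expr0 (der1 derM) !mul0r.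
rewrite exprS derM IH -natr1; case: n {IH} => [|n] /=; first by rewrite expr0; ring.
by rewrite exprS; ring.
Qed.

Lemma dotC x y : dot x y = dot y x. Proof. by rewrite /dot; ring. Qed.

Lemma der_qr m n x y :
  D (qr m n x y) = qr_x m n (D \o x) x y + qr_y m n (D \o y) x y.
Proof.
rewrite /qr /qr_x /qr_y /qr derM !der_exp !(der_dot derD derM).
rewrite (dotC x (D \o x)) (dotC y (D \o y)).
by rewrite !natrM; ring.
Qed.

Lemma der_fam h m n x y :
  map_mx D (fam h m n x y) = fam_x h m n (D \o x) x y + fam_y h m n (D \o y) x y.
Proof.
rewrite /fam (der_mxZ derM) der_qr (der_bmx derD derM) /fam_x /fam_y scalerDl scalerDr.
by rewrite addrACA.
Qed.

(** The hypothesis fits the lowering operator that replaces v_1 by v_2, which kills y, the cross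
    product of v_1 and v_2. *)
Lemma der_fam_y h m n eta x y : D \o y =1 (fun=> 0) ->
  map_mx D (fam_y h m n eta x y) =
  fam_xy h m n (D \o x) eta x y + fam_y h m n (D \o eta) x y.
Proof.
move=> Dy0.
have qy0 k : qr_y m k (D \o y) x y = 0 by rewrite /qr_y /dot !Dy0; ring.
have by0 : bmx_y h (D \o y) x y = 0.
  have c0 a i : cross a (D \o y) i = 0.
    by rewrite (eq_cross (frefl a) Dy0) /cross /vec3; case: (val i) => [|[|?]] /=; ring.
  by case: h => //=; apply/matrixP => i j; rewrite !mxE /vec3 ?c0 ?Dy0 /=;
    rewrite ?mul0r ?mulr0 ?addr0 //; elim/ord3_ind: i; elim/ord3_ind: j; rewrite /= ?oppr0.
have Dqy : D (qr_y m n eta x y) = qr_xy m n (D \o x) eta x y + qr_y m n (D \o eta) x y.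
  have c2 : D (2 * n)%:R = 0.
    by elim: (2 * n)%N => [|k IH]; rewrite ?(der0 derD) // -natr1 derD IH (der1 derM) addr0.
  rewrite /qr_y 2!derM c2 der_qr (der_dot derD derM) (_ : dot eta (D \o y) = 0); last first.
    by rewrite /dot !Dy0; ring.
  rewrite (_ : qr_y m n.-1 (D \o y) x y = 0); last by rewrite /qr_y /dot !Dy0; ring.
  by rewrite /qr_x /qr_xy !natrM; ring.
rewrite /fam_y (der_mxD derD) !(der_mxZ derM) Dqy der_qr qy0 (der_bmx derD derM) by0 (der_bmx_y derD derM) // !addr0.
rewrite /fam_xy !scalerDl !scalerDr.
move: (bmx h x y) (bmx_x h _ x y) (bmx_y h eta x y) (bmx_xy h _ eta x y)
  (bmx_y h (D \o eta) x y) => A B C E F.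
by apply/matrixP => i j; rewrite !mxE; ring.
Qed.

End Derivation.

Lemma dot_unitv xi x : dot xi x = \sum_i xi i * dot (unitv R i) x.
Proof. by rewrite sum3 /dot /unitv /=; ring. Qed.

Lemma qr_x_lin m n xi x y : qr_x m n xi x y = \sum_i xi i * qr_x m n (unitv R i) x y.
Proof.
by rewrite {1}/qr_x dot_unitv mulr_sumr mulr_suml; apply: eq_bigr => i _; rewrite /qr_x; ring.
Qed.

Lemma qr_y_lin m n eta x y : qr_y m n eta x y = \sum_i eta i * qr_y m n (unitv R i) x y.
Proof.
by rewrite {1}/qr_y dot_unitv mulr_sumr mulr_suml; apply: eq_bigr => i _; rewrite /qr_y; ring.
Qed.

Lemma bmx_x_lin h xi x y : bmx_x h xi x y = \sum_i xi i *: bmx_x h (unitv R i) x y.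
Proof. by rewrite sum3; case: h => /=; mx33. Qed.

Lemma bmx_y_lin h eta x y : bmx_y h eta x y = \sum_i eta i *: bmx_y h (unitv R i) x y.
Proof. by rewrite sum3; case: h => /=; mx33. Qed.

Lemma bmx_xy_linl h xi eta x y :
  bmx_xy h xi eta x y = \sum_i xi i *: bmx_xy h (unitv R i) eta x y.
Proof. by rewrite sum3; case: h => /=; mx33. Qed.

Lemma bmx_xy_linr h xi eta x y :
  bmx_xy h xi eta x y = \sum_j eta j *: bmx_xy h xi (unitv R j) x y.
Proof. by rewrite sum3; case: h => /=; mx33. Qed.

Lemma fam_x_lin h m n xi x y :
  fam_x h m n xi x y = \sum_i xi i *: fam_x h m n (unitv R i) x y.
Proof.
rewrite {1}/fam_x qr_x_lin bmx_x_lin scaler_suml scaler_sumr -big_split.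
by apply: eq_bigr => i _ /=; rewrite /fam_x scalerDr !scalerA [qr _ _ _ _ * _]mulrC.
Qed.

Lemma fam_y_lin h m n eta x y :
  fam_y h m n eta x y = \sum_i eta i *: fam_y h m n (unitv R i) x y.
Proof.
rewrite {1}/fam_y qr_y_lin bmx_y_lin scaler_suml scaler_sumr -big_split.
by apply: eq_bigr => i _ /=; rewrite /fam_y scalerDr !scalerA [qr _ _ _ _ * _]mulrC.
Qed.

Lemma fam_xy_linl h m n xi eta x y :
  fam_xy h m n xi eta x y = \sum_i xi i *: fam_xy h m n (unitv R i) eta x y.
Proof.
have e : qr_xy m n xi eta x y = \sum_i xi i * qr_xy m n (unitv R i) eta x y.
  rewrite {1}/qr_xy dot_unitv mulr_sumr !mulr_suml.
  by apply: eq_bigr => i _; rewrite /qr_xy; ring.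
rewrite {1}/fam_xy e qr_x_lin bmx_x_lin bmx_xy_linl !scaler_suml !scaler_sumr -!big_split.
apply: eq_bigr => i _ /=; rewrite /fam_xy !scalerDr !scalerA.
by rewrite [qr_y _ _ _ _ _ * _]mulrC [qr _ _ _ _ * _]mulrC.
Qed.

Lemma fam_xy_linr h m n xi eta x y :
  fam_xy h m n xi eta x y = \sum_i eta i *: fam_xy h m n xi (unitv R i) x y.
Proof.
have e : qr_xy m n xi eta x y = \sum_i eta i * qr_xy m n xi (unitv R i) x y.
  rewrite {1}/qr_xy [dot eta y]dot_unitv mulr_sumr !mulr_suml.
  by apply: eq_bigr => i _; rewrite /qr_xy; ring.
rewrite {1}/fam_xy e qr_y_lin bmx_y_lin bmx_xy_linr !scaler_suml !scaler_sumr -!big_split.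
apply: eq_bigr => i _ /=; rewrite /fam_xy !scalerDr !scalerA.
by rewrite [qr_x _ _ _ _ _ * _]mulrC [qr _ _ _ _ * _]mulrC.
Qed.

Lemma bmx_x_euler h x y : bmx_x h x x y = (degx h)%:R *: bmx h x y.
Proof. by case: h => /=; mx33. Qed.

Lemma bmx_y_euler h x y : bmx_y h y x y = (degy h)%:R *: bmx h x y.
Proof. by case: h => /=; mx33. Qed.

Lemma bmx_xy_eulerl h eta x y : bmx_xy h x eta x y = (degx h)%:R *: bmx_y h eta x y.
Proof. by case: h => /=; mx33. Qed.

Lemma bmx_xy_eulerr h xi x y : bmx_xy h xi y x y = (degy h)%:R *: bmx_x h xi x y.
Proof. by case: h => /=; mx33. Qed.

Lemma qr_x_euler m n x y : qr_x m n x x y = (2 * m)%:R * qr m n x y.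
Proof. by case: m => [|m]; rewrite /qr_x /qr ?muln0 ?mul0r //= exprS; ring. Qed.

Lemma qr_y_euler m n x y : qr_y m n y x y = (2 * n)%:R * qr m n x y.
Proof. by case: n => [|n]; rewrite /qr_y /qr ?muln0 ?mul0r //= exprS; ring. Qed.

Lemma qr_xy_eulerl m n eta x y : qr_xy m n x eta x y = (2 * m)%:R * qr_y m n eta x y.
Proof.
case: m => [|m]; rewrite /qr_xy /qr_y /qr ?muln0 ?mul0n ?muln0 ?mul0r //= exprS.
by rewrite !natrM; ring.
Qed.

Lemma qr_xy_eulerr m n xi x y : qr_xy m n xi y x y = (2 * n)%:R * qr_x m n xi x y.
Proof.
case: n => [|n]; rewrite /qr_xy /qr_x /qr ?muln0 ?mul0n ?muln0 ?mul0r //= exprS.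
by rewrite !natrM; ring.
Qed.

Lemma fam_x_euler h m n x y : fam_x h m n x x y = (2 * m + degx h)%:R *: fam h m n x y.
Proof.
rewrite /fam_x /fam qr_x_euler bmx_x_euler natrD scalerDl !scalerA.
by rewrite [qr _ _ _ _ * _]mulrC.
Qed.

Lemma fam_y_euler h m n x y : fam_y h m n y x y = (2 * n + degy h)%:R *: fam h m n x y.
Proof.
rewrite /fam_y /fam qr_y_euler bmx_y_euler natrD scalerDl !scalerA.
by rewrite [qr _ _ _ _ * _]mulrC.
Qed.

Lemma fam_xy_eulerl h m n eta x y :
  fam_xy h m n x eta x y = (2 * m + degx h)%:R *: fam_y h m n eta x y.
Proof.
rewrite /fam_xy /fam_y qr_xy_eulerl qr_x_euler bmx_x_euler bmx_xy_eulerl natrD.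
move: (bmx h x y) (bmx_y h _ x y) => A B.
by apply/matrixP => i j; rewrite !mxE; ring.
Qed.

Lemma fam_xy_eulerr h m n xi x y :
  fam_xy h m n xi y x y = (2 * n + degy h)%:R *: fam_x h m n xi x y.
Proof.
rewrite /fam_xy /fam_x qr_xy_eulerr qr_y_euler bmx_y_euler bmx_xy_eulerr natrD.
move: (bmx h x y) (bmx_x h _ x y) => A B.
by apply/matrixP => i j; rewrite !mxE; ring.
Qed.

(** Values of the contractions left over by [w2_algebra] and [w3_algebra]: the trace of the mixed
    derivative and, next, the two skew contractions. *)
Definition bmx_lap h x y : 'M[R]_3 :=
  match h with KXY | KYX => 1 | KZX => skew x | KZY => - skew y | _ => 0 end.
Definition bmx_curlx h x y : 'M[R]_3 :=
  match h with
  | KXX => 3%:R *: outer y x - dot x y *: 1 | KSX => skew y | KXY => 2%:R *: outer y y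
  | KYX => outer y y - dot y y *: 1 | KZX => outer y (cross x y) | _ => 0
  end.
Definition bmx_curly h x y : 'M[R]_3 :=
  match h with
  | KYY => - skew y | KSY => - 2%:R *: 1 | KXY => - skew x
  | KZX => 2%:R *: outer x x | KZY => 3%:R *: outer x y - outer y x | _ => 0
  end.

Lemma bmx_lapE h x y : \sum_i bmx_xy h (unitv R i) (unitv R i) x y = bmx_lap h x y.
Proof. by rewrite sum3; case: h => /=; mx33. Qed.

Lemma bmx_curlxE h x y :
  \sum_i skew (cross (unitv R i) y) * bmx_x h (unitv R i) x y = bmx_curlx h x y.
Proof.
rewrite sum3; case: h => /=; apply/matrixP => i j; elim/ord3_ind: i; elim/ord3_ind: j;
  by rewrite !mxE !sum3 !mxE /cross /vec3 /unitv /dot /=; ring.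
Qed.

Lemma bmx_curlyE h x y :
  \sum_i skew (unitv R i) * bmx_y h (unitv R i) x y = bmx_curly h x y.
Proof.
rewrite sum3; case: h => /=; apply/matrixP => i j; elim/ord3_ind: i; elim/ord3_ind: j;
  by rewrite !mxE !sum3 !mxE /cross /vec3 /unitv /dot /=; ring.
Qed.

End Families.

(** * Multiplication tables for the nine matrices *)

Section Tables.
Variable R : comNzRingType.
Implicit Types (x y : 'I_3 -> R) (h : kind).
Local Notation B h x y := (bmx h x y).

Ltac mxprod33 := let i := fresh in let j := fresh in
  apply/matrixP => i j; elim/ord3_ind: i; elim/ord3_ind: j;
  rewrite !mxE ?sum3 !mxE /cross /vec3 /dot /=; ring.

Definition skewx_bmx h x y : 'M[R]_3 :=
  match h with
  | K1 => B KSX x y | KYY => B KZY x y | KSX => B KXX x y - dot x x *: 1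
  | KSY => B KYX x y - dot x y *: 1 | KYX => B KZX x y
  | KZX => dot x y *: B KXX x y - dot x x *: B KYX x y
  | KZY => dot x y *: B KXY x y - dot x x *: B KYY x y
  | _ => 0
  end.

Lemma skewx_bmxE h x y : skew x * B h x y = skewx_bmx h x y.
Proof. by case: h => /=; mxprod33. Qed.

Definition skewy_bmx h x y : 'M[R]_3 :=
  match h with
  | K1 => B KSY x y | KXX => - B KZX x y | KSX => B KXY x y - dot x y *: 1
  | KSY => B KYY x y - dot y y *: 1 | KXY => - B KZY x y
  | KZX => dot y y *: B KXX x y - dot x y *: B KYX x y
  | KZY => dot y y *: B KXY x y - dot x y *: B KYY x y
  | _ => 0
  end.

Lemma skewy_bmxE h x y : skew y * B h x y = skewy_bmx h x y.
Proof. by case: h => /=; mxprod33. Qed.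

Definition skewz_bmx h x y : 'M[R]_3 :=
  match h with
  | K1 => B KYX x y - B KXY x y
  | KXX => dot x x *: B KYX x y - dot x y *: B KXX x y
  | KYY => dot x y *: B KYY x y - dot y y *: B KXY x y
  | KSX => B KZX x y - dot x y *: B KSX x y + dot x x *: B KSY x y
  | KSY => B KZY x y - dot y y *: B KSX x y + dot x y *: B KSY x y
  | KXY => dot x x *: B KYY x y - dot x y *: B KXY x y
  | KYX => dot x y *: B KYX x y - dot y y *: B KXX x y
  | _ => 0
  end.

Lemma skewz_bmxE h x y : skew (cross x y) * B h x y = skewz_bmx h x y.
Proof. by case: h => /=; mxprod33. Qed.

Lemma outer_y_cross x y :
  outer y (cross x y) = B KZY x y - dot y y *: B KSX x y + dot x y *: B KSY x y.
Proof. by mx33. Qed.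

Lemma skewx_bmx_y h x y : skew x * bmx_y h x x y =
  match h with
  | KYY => B KZX x y | KSY => B KXX x y - dot x x *: 1
  | KZY => dot x y *: B KXX x y - dot x x *: B KYX x y | _ => 0
  end.
Proof. by case: h => /=; mxprod33. Qed.

Lemma skewx_bmx_x h x y : skew x * bmx_x h y x y =
  match h with
  | KXX => B KZX x y | KSX => B KYX x y - dot x y *: 1
  | KXY | KYX => B KZY x y | KZX => dot x y *: B KXY x y - dot x x *: B KYY x y
  | _ => 0
  end.
Proof. by case: h => /=; mxprod33. Qed.

Lemma skewx_bmx_lap h x y : skew x * bmx_lap h x y =
  match h with
  | KXY | KYX => B KSX x y | KZX => B KXX x y - dot x x *: 1
  | KZY => - (B KYX x y - dot x y *: 1) | _ => 0
  end.
Proof. by case: h => /=; mxprod33. Qed.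

(** The gradient of |x|^(2m) is proportional to [x], so its contribution assembles to
    [skew (cross x y)], for which there is a multiplication table. *)
Lemma fam_curlx h m n x y :
  \sum_i skew (cross (unitv R i) y) * fam_x h m n (unitv R i) x y =
  ((2 * m)%:R * qr m.-1 n x y) *: (skew (cross x y) * B h x y)
  + qr m n x y *: bmx_curlx h x y.
Proof.
rewrite -bmx_curlxE scaler_sumr.
have -> : skew (cross x y) = \sum_i x i *: skew (cross (unitv R i) y).
  by rewrite sum3; mx33.
rewrite mulr_suml scaler_sumr -big_split; apply: eq_bigr => i _ /=.
rewrite /fam_x mulrDr -!scalerAr -!scalerAl scalerA; congr (_ *: _ + _).
by rewrite /qr_x (_ : dot (unitv R i) x = x i); [ring|elim/ord3_ind: i; rewrite /dot /unitv /=; ring].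
Qed.

Lemma fam_curly h m n x y :
  \sum_i skew (unitv R i) * fam_y h m n (unitv R i) x y =
  ((2 * n)%:R * qr m n.-1 x y) *: (skew y * B h x y) + qr m n x y *: bmx_curly h x y.
Proof.
rewrite -bmx_curlyE scaler_sumr.
have -> : skew y = \sum_i y i *: skew (unitv R i) by rewrite sum3; mx33.
rewrite mulr_suml scaler_sumr -big_split; apply: eq_bigr => i _ /=.
rewrite /fam_y mulrDr -!scalerAr -!scalerAl scalerA; congr (_ *: _ + _).
by rewrite /qr_y (_ : dot (unitv R i) y = y i); [ring|elim/ord3_ind: i; rewrite /dot /unitv /=; ring].
Qed.

Lemma fam_lap h m n x y : \sum_i fam_xy h m n (unitv R i) (unitv R i) x y =
  ((4 * (m * n))%:R * dot x y * qr m.-1 n.-1 x y) *: B h x y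
  + ((2 * m)%:R * qr m.-1 n x y) *: bmx_y h x x y
  + ((2 * n)%:R * qr m n.-1 x y) *: bmx_x h y x y + qr m n x y *: bmx_lap h x y.
Proof.
have du i a : dot (unitv R i) a = a i by elim/ord3_ind: i; rewrite /dot /unitv /=; ring.
rewrite -bmx_lapE (bmx_y_lin h x) (bmx_x_lin h y) !scaler_sumr.
have -> : ((4 * (m * n))%:R * dot x y * qr m.-1 n.-1 x y) *: B h x y =
    \sum_i ((4 * (m * n))%:R * (x i * y i) * qr m.-1 n.-1 x y) *: B h x y.
  by rewrite -scaler_suml -mulr_suml -mulr_sumr sum3.
rewrite -!big_split; apply: eq_bigr => i _ /=.
rewrite /fam_xy /qr_xy /qr_x /qr_y !du !scalerA.
by congr (_ *: _ + _ *: _ + _ *: _ + _); ring.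
Qed.

End Tables.

Section ExtraAlgebra.
Variable R : comNzRingType.
Implicit Types (A B C : 'M[R]_3) (x y xi eta : 'I_3 -> R).

Lemma eq_fam_x h m n xi xi' x y : xi =1 xi' -> fam_x h m n xi x y = fam_x h m n xi' x y.
Proof.
by move=> e; rewrite fam_x_lin [RHS]fam_x_lin; apply: eq_bigr => i _; rewrite e.
Qed.

Lemma eq_fam_y h m n xi xi' x y : xi =1 xi' -> fam_y h m n xi x y = fam_y h m n xi' x y.
Proof.
by move=> e; rewrite fam_y_lin [RHS]fam_y_lin; apply: eq_bigr => i _; rewrite e.
Qed.

Lemma eq_fam_xy h m n xi xi' eta x y : xi =1 xi' ->
  fam_xy h m n xi eta x y = fam_xy h m n xi' eta x y.
Proof.
by move=> e; rewrite fam_xy_linl [RHS]fam_xy_linl; apply: eq_bigr => i _; rewrite e.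
Qed.

Lemma fam_x0 h m n x y : fam_x h m n (fun=> 0) x y = 0.
Proof. by rewrite fam_x_lin big1 // => i _; rewrite scale0r. Qed.

Lemma fam_y0 h m n x y : fam_y h m n (fun=> 0) x y = 0.
Proof. by rewrite fam_y_lin big1 // => i _; rewrite scale0r. Qed.

Lemma scale_w3 (k b c : R) (A1 A2 A3 B F C E : 'M[R]_3) :
  k *: (A2 * (c *: B) - b *: (A3 * (c *: F))) + b *: (A1 * (c *: C)) - A1 * (c *: E) =
  c *: (k *: (A2 * B - b *: (A3 * F)) + b *: (A1 * C) - A1 * E).
Proof.
rewrite -!scalerAr; move: (A2 * B) (A3 * F) (A1 * C) (A1 * E) => X Y Z W.
by apply/matrixP => i j; rewrite !mxE; ring.
Qed.

Lemma scale_w2 (k c : R) (A1 A2 B F : 'M[R]_3) :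
  A1 * (c *: B) - k *: (A2 * (c *: F)) = c *: (A1 * B - k *: (A2 * F)).
Proof.
rewrite -!scalerAr; move: (A2 * F) (A1 * B) => X Y.
by apply/matrixP => i j; rewrite !mxE; ring.
Qed.

(** All derivatives along [s] and [v] are gone, and the new factor [det3 x s v] raises the exponent
    of the determinant by one. *)
Lemma fam_w3 h m n (x s v : 'I_3 -> R) (c : R) :
  let y := cross x s in let al := (2 * m + degx h)%N in let be := (2 * n + degy h)%N in
  (al + be).+1%:R *: (skew s * (c *: fam_y h m n (cross x v) x y)
     - be%:R *: (skew v * (c *: fam h m n x y)))
   + be%:R *: (skew x * (c *: (fam_x h m n v x y + fam_y h m n (cross v s) x y)))
   - skew x * (c *: (fam_xy h m n s (cross x v) x y + fam_y h m n (cross s v) x y))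
  = (c * det3 x s v) *: (((2 * m)%:R * qr m.-1 n x y) *: (skew x * bmx_y h x x y)
      + ((2 * n)%:R * qr m n.-1 x y) *: (skew x * bmx_x h y x y)
      + qr m n x y *: (skew x * bmx_lap h x y)
      - (al + be).+1%:R *: (((2 * n)%:R * qr m n.-1 x y) *: (skew y * bmx h x y)
           + qr m n x y *: bmx_curly h x y)).
Proof.
move=> y al be.
(* This kills the first term of [fam_lap]. *)
have pxy : dot x y = 0 by rewrite /y /dot /cross /vec3 /=; ring.
rewrite scale_w3 -scalerA; congr (c *: _).
rewrite (fam_y_lin _ _ _ (cross x v)) (fam_x_lin _ _ _ v) (fam_y_lin _ _ _ (cross v s)).
rewrite (fam_y_lin _ _ _ (cross s v)) fam_xy_linl.
rewrite [X in _ - skew x * (X + _)](eq_bigr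
  (fun i => \sum_j (s i * cross x v j) *: fam_xy h m n (unitv R i) (unitv R j) x y)); last first.
  move=> i _; rewrite fam_xy_linr scaler_sumr; apply: eq_bigr => j _; exact: scalerA.
rewrite (@w3_algebra R x s v (fam h m n x y) (fun j => fam_y h m n (unitv R j) x y)
   (fun i => fam_x h m n (unitv R i) x y)
   (fun i j => fam_xy h m n (unitv R i) (unitv R j) x y)); first last.
- by move=> i; rewrite -fam_xy_linr fam_xy_eulerr.
- by move=> j; rewrite -fam_xy_linl fam_xy_eulerl.
- by rewrite -fam_y_lin fam_y_euler.
congr (_ *: (_ - _ *: _)); last exact: fam_curly.
rewrite fam_lap pxy mulr0 mul0r scale0r add0r !mulrDr.
by congr (_ + _ + _); apply/esym/scalerAr.
Qed.

Lemma fam_w2 h m n (x s : 'I_3 -> R) (c : R) :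
  let y := cross x s in let al := (2 * m + degx h)%N in
  skew x * (c *: fam_x h m n s x y) - al%:R *: (skew s * (c *: fam h m n x y)) =
  c *: (((2 * m)%:R * qr m.-1 n x y) *: (skew (cross x y) * bmx h x y)
        + qr m n x y *: bmx_curlx h x y).
Proof.
move=> y al; rewrite scale_w2; congr (c *: _).
rewrite fam_x_lin -fam_curlx.
apply: w2_algebra; rewrite -fam_x_lin fam_x_euler //.
Qed.

End ExtraAlgebra.

(** * Stability under left multiplication by the generators *)

Section Closure.
Variables (K : fieldType) (p : nat).
Hypothesis charK0 : [pchar K] =i pred0.
Local Notation poly := (Defs.poly K p).
Local Notation mx3 := (mx3 K p).
Local Notation t := (tgen K).
Local Notation E := Emx.

(* With this choice of signs the generic matrix [t_k] is the matrix of the cross product with [tv k]. *)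
Definition tv (k : 'I_p) : 'I_3 -> poly :=
  vec3 (- 'X_(tvar k o2)) 'X_(tvar k o1) (- 'X_(tvar k o0)).

(** Indices from [p] on give the zero vector, so that formulas in v_1, v_2, v_3 make sense for every
    [p]. *)
Definition vec (k : nat) : 'I_3 -> poly :=
  if insub k is Some i then tv i else fun=> 0.

Lemma vecE (i : 'I_p) : vec i = tv i.
Proof. by rewrite /vec valK. Qed.

Lemma vec_out k : (p <= k)%N -> vec k = fun=> 0.
Proof. by move=> le_pk; rewrite /vec insubF // ltnNge le_pk. Qed.

Lemma tgen_skew k : t k = skew (tv k).
Proof.
have e01 : pairidx o0 o1 = o0 by apply: val_inj; rewrite /= inordK.
have e02 : pairidx o0 o2 = o1 by apply: val_inj; rewrite /= inordK.
have e12 : pairidx o1 o2 = o2 by apply: val_inj; rewrite /= inordK.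
apply/matrixP => i j; elim/ord3_ind: i; elim/ord3_ind: j;
  by rewrite !mxE /tv /vec3 /= ?e01 ?e02 ?e12 ?opprK.
Qed.

Lemma polar_tv i j k r : polar i j (tv k r) = (j == k)%:R * tv i r.
Proof.
by elim/ord3_ind: r; rewrite /tv /vec3 /= ?polarN polarX ?mulrN.
Qed.

Local Notation x := (vec 0).
Local Notation y := (cross (vec 0) (vec 1)).
Local Notation d := (det3 (vec 0) (vec 1) (vec 2)).

(* A highest weight vector of weight [wt h m n c], unless it vanishes (see [hwm_invalid]). *)
Definition hwm h m n c : mx3 := d ^+ c *: fam h m n x y.

Lemma dot_xy : dot x y = 0.
Proof. by rewrite /dot /cross /vec3 /=; ring. Qed.

Lemma polar_fam i j (c : nat) h m n xi eta dd :
  polar i j \o x =1 xi -> polar i j \o y =1 eta -> polar i j d = dd ->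
  E i j (hwm h m n c) = (dd * (c%:R * d ^+ c.-1)) *: fam h m n x y
    + d ^+ c *: (fam_x h m n xi x y + fam_y h m n eta x y).
Proof.
move=> e1 e2 e3; rewrite /hwm Emx_scale polar_exp mulrC e3; congr (_ + _ *: _).
rewrite /Emx (der_fam (polarD i j) (polarM i j)).
by rewrite (eq_fam_x _ _ _ _ _ e1) (eq_fam_y _ _ _ _ _ e2).
Qed.

(** Excluded are |x|^(2m) with m > 0 and |x|^(2m) x x^T, unless a factor |y|^2 or [d] is present;
    [axV] supplies their difference. *)
Definition allowed h (m n c : nat) : bool :=
  [|| (0 < n)%N, (0 < c)%N |
      match h with KXX => false | K1 => m == 0%N | _ => true end].

Variables (V : mx3 -> Prop) (hV : submodule V).
Hypothesis famV : forall h m n c, allowed h m n c -> V (hwm h m n c).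
Hypothesis axV : forall m, V (qr m 0 x y *: (bmx KXX x y - dot x x *: 1)).

(** Quantifying over the exponents closes the notion under the factors [dot x x] and [dot y y] that
    the tables contain. *)
Definition qr_stable (c : nat) (A : mx3) := forall m n, V ((d ^+ c * qr m n x y) *: A).

Lemma qr_stableD c A B : qr_stable c A -> qr_stable c B -> qr_stable c (A + B).
Proof. by move=> hA hB m n; rewrite scalerDr; apply: (submodD hV). Qed.
Lemma qr_stableN c A : qr_stable c A -> qr_stable c (- A).
Proof. by move=> hA m n; rewrite scalerN; apply: (submodN hV). Qed.
Lemma qr_stableB c A B : qr_stable c A -> qr_stable c B -> qr_stable c (A - B).
Proof. by move=> hA hB; apply/qr_stableD/qr_stableN. Qed.
Lemma qr_stableMn c k A : qr_stable c A -> qr_stable c (k%:R *: A).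
Proof. by move=> hA m n; rewrite scalerA mulrC -scalerA; apply: (submodMn hV). Qed.
Lemma qr_stable0 c : qr_stable c 0.
Proof. by move=> m n; rewrite scaler0; apply: (subsp0 hV.1). Qed.

Lemma qr_stable_q c A : qr_stable c A -> qr_stable c (dot x x *: A).
Proof.
move=> hA m n; rewrite scalerA (_ : _ * dot x x = d ^+ c * qr m.+1 n x y) //.
by rewrite /qr exprS; ring.
Qed.
Lemma qr_stable_r c A : qr_stable c A -> qr_stable c (dot y y *: A).
Proof.
move=> hA m n; rewrite scalerA (_ : _ * dot y y = d ^+ c * qr m n.+1 x y) //.
by rewrite /qr exprS; ring.
Qed.

Lemma hwmE h m n c : hwm h m n c = (d ^+ c * qr m n x y) *: bmx h x y.
Proof. by rewrite /hwm /fam scalerA. Qed.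

Definition plain h : bool := match h with K1 | KXX => false | _ => true end.

Lemma qr_stable_plain c h : plain h || (0 < c)%N -> qr_stable c (bmx h x y).
Proof.
move=> ph m n; rewrite -hwmE; apply: famV; rewrite /allowed.
by case/orP: ph => [|->]; rewrite ?orbT //; case: h; rewrite ?orbT.
Qed.

(** The factor |y|^2 raises [n], which makes the excluded kinds allowed, here 1 and in the next
    lemma x x^T. *)
Lemma qr_stable_r1 c : qr_stable c (dot y y *: 1).
Proof.
move=> m n; rewrite scalerA (_ : _ * dot y y = d ^+ c * qr m n.+1 x y).
  by rewrite -[1]/(bmx K1 x y) -hwmE; apply: famV.
by rewrite /qr exprS; ring.
Qed.

Lemma qr_stable_rXX c : qr_stable c (dot y y *: bmx KXX x y).
Proof.
move=> m n; rewrite scalerA (_ : _ * dot y y = d ^+ c * qr m n.+1 x y).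
  by rewrite -hwmE; apply: famV.
by rewrite /qr exprS; ring.
Qed.

Lemma qr_stable_ax c : qr_stable c (bmx KXX x y - dot x x *: 1).
Proof.
(* With a factor |y|^2 or [d] both terms are allowed separately; without one this is [axV]. *)
move=> m n; case: (boolP ((0 < n) || (0 < c))%N) => [nc|].
  have -> : (d ^+ c * qr m n x y) *: (bmx KXX x y - dot x x *: 1) =
      hwm KXX m n c - hwm K1 m.+1 n c.
    rewrite scalerBr scalerA !hwmE; congr (_ - _ *: _).
    by rewrite /qr exprS; ring.
  by apply: (submodB hV); apply: famV; rewrite /allowed orbA nc.
rewrite negb_or -!leqNgt !leqn0 => /andP[/eqP -> /eqP ->].
by rewrite expr0 mul1r; apply: axV.
Qed.

(** Once [dot x y] is 0, this table contains 1 and x x^T only through the difference x x^T -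
    |x|^2. *)
Lemma qr_stable_skewx c h : qr_stable c (skew x * bmx h x y).
Proof.
rewrite skewx_bmxE; case: h; rewrite /skewx_bmx ?dot_xy ?scale0r ?sub0r ?subr0.
- exact: qr_stable_plain.
- exact: qr_stable0.
- exact: qr_stable_plain.
- exact: qr_stable_ax.
- exact: qr_stable_plain.
- exact: qr_stable0.
- exact: qr_stable_plain.
- by apply/qr_stableN/qr_stable_q; apply: qr_stable_plain.
- by apply/qr_stableN/qr_stable_q; apply: qr_stable_plain.
Qed.

Lemma qr_stable_skewz c h : qr_stable c (skew (cross x y) * bmx h x y).
Proof.
rewrite skewz_bmxE; case: h; rewrite /skewz_bmx ?dot_xy ?scale0r ?sub0r ?subr0 ?addr0.
- by apply: qr_stableB; apply: qr_stable_plain.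
- by apply: qr_stable_q; apply: qr_stable_plain.
- by apply/qr_stableN/qr_stable_r; apply: qr_stable_plain.
- by apply: qr_stableD; [|apply: qr_stable_q]; apply: qr_stable_plain.
- by apply: qr_stableB; [|apply: qr_stable_r]; apply: qr_stable_plain.
- by apply: qr_stable_q; apply: qr_stable_plain.
- by apply/qr_stableN/qr_stable_rXX.
- exact: qr_stable0.
- exact: qr_stable0.
Qed.

Lemma qr_stable_curlx c h : qr_stable c (bmx_curlx h x y).
Proof.
case: h; rewrite /bmx_curlx ?dot_xy ?scale0r ?subr0; try exact: qr_stable0.
- by apply: qr_stableMn; apply: (@qr_stable_plain c KYX).
- exact: (@qr_stable_plain c KSY).
- by apply: qr_stableMn; apply: (@qr_stable_plain c KYY).
- by apply: qr_stableB; [apply: (@qr_stable_plain c KYY)|apply: qr_stable_r1].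
- rewrite outer_y_cross dot_xy scale0r addr0.
  by apply: qr_stableB; [|apply: qr_stable_r]; apply: qr_stable_plain.
Qed.

Lemma qr_stable_skewy c h : (0 < c)%N -> qr_stable c (skew y * bmx h x y).
Proof.
move=> c0; have all h' : qr_stable c (bmx h' x y) by apply: qr_stable_plain; rewrite c0 orbT.
rewrite skewy_bmxE; case: h; rewrite /skewy_bmx ?dot_xy ?scale0r ?sub0r ?subr0 //;
  try exact: qr_stable0.
- exact: qr_stableN.
- by apply: qr_stableB => //; apply: qr_stable_r1.
- exact: qr_stableN.
- exact: qr_stable_r.
- exact: qr_stable_r.
Qed.

(** Some values are bare multiples of 1 and of x x^T, which a positive power of [d] makes
    allowed. *)
Lemma qr_stable_curly c h : (0 < c)%N -> qr_stable c (bmx_curly h x y).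
Proof.
move=> c0; have all h' : qr_stable c (bmx h' x y) by apply: qr_stable_plain; rewrite c0 orbT.
case: h; rewrite /bmx_curly; try exact: qr_stable0.
- by apply: qr_stableN; apply: (all KSY).
- by rewrite scaleNr; apply/qr_stableN/qr_stableMn; apply: (all K1).
- by apply: qr_stableN; apply: (all KSX).
- by apply: qr_stableMn; apply: (all KXX).
- by apply: qr_stableB; [apply: qr_stableMn; apply: (all KXY)|apply: (all KYX)].
Qed.

Lemma qr_stable_skewx_bmx_y c h : qr_stable c (skew x * bmx_y h x x y).
Proof.
rewrite skewx_bmx_y; case: h; rewrite ?dot_xy ?scale0r ?sub0r; try exact: qr_stable0.
- exact: qr_stable_plain.
- exact: qr_stable_ax.
- by apply/qr_stableN/qr_stable_q; apply: qr_stable_plain.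
Qed.

Lemma qr_stable_skewx_bmx_x c h : qr_stable c (skew x * bmx_x h y x y).
Proof.
rewrite skewx_bmx_x; case: h; rewrite ?dot_xy ?scale0r ?sub0r ?subr0; try exact: qr_stable0;
  try exact: qr_stable_plain.
by apply/qr_stableN/qr_stable_q; apply: qr_stable_plain.
Qed.

Lemma qr_stable_skewx_bmx_lap c h : qr_stable c (skew x * bmx_lap h x y).
Proof.
rewrite skewx_bmx_lap; case: h; rewrite ?dot_xy ?scale0r ?subr0; try exact: qr_stable0;
  try exact: qr_stable_plain; first exact: qr_stable_ax.
by apply: qr_stableN; apply: qr_stable_plain.
Qed.

Lemma qr_stable_term c k m n A : qr_stable c A -> V (d ^+ c *: ((k%:R * qr m n x y) *: A)).
Proof.
move=> hA; rewrite scalerA mulrCA -scalerA; apply: (submodMn hV); exact: hA.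
Qed.

Lemma qr_stable_term1 c m n A : qr_stable c A -> V (d ^+ c *: (qr m n x y *: A)).
Proof. by move=> hA; rewrite scalerA; apply: hA. Qed.

Lemma V_scaleD c A B : V (c *: A) -> V (c *: B) -> V (c *: (A + B)).
Proof. by move=> VA VB; rewrite scalerDr; apply: (submodD hV). Qed.

Lemma V_scaleB c A B : V (c *: A) -> V (c *: B) -> V (c *: (A - B)).
Proof. by move=> VA VB; rewrite scalerBr; apply: (submodB hV). Qed.

Lemma V_scaleMn c k A : V (c *: A) -> V (c *: (k%:R *: A)).
Proof. by move=> VA; rewrite scalerA mulrC -scalerA; apply: (submodMn hV). Qed.

Lemma t_hwm_0 (i1 : 'I_p) h m n c : i1 = 0%N :> nat -> V (t i1 * hwm h m n c).
Proof.
move=> e1; rewrite tgen_skew -vecE e1 hwmE -mx3_scaleAr; exact: qr_stable_skewx.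
Qed.

Local Notation s := (vec 1).
Local Notation v := (vec 2).

Lemma tgen_vec (k : 'I_p) m : k = m :> nat -> t k = skew (vec m).
Proof. by move=> e; rewrite tgen_skew -vecE e. Qed.

Lemma polar_vec (j k : 'I_p) m i :
  polar j k (vec m i) = (nat_of_ord k == m)%:R * vec j i.
Proof.
rewrite vecE; case: (ltnP m p) => [lt_mp|le_pm]; last first.
  by rewrite vec_out //= polar0 (ltn_eqF (leq_trans (ltn_ord k) le_pm)) mul0r.
have -> : vec m = tv (Ordinal lt_mp) by rewrite -vecE.
by rewrite polar_tv -val_eqE.
Qed.

Lemma polar_y (j k : 'I_p) i : polar j k (y i) =
  (nat_of_ord k == 0)%:R * cross (vec j) s i + (nat_of_ord k == 1%N)%:R * cross x (vec j) i.
Proof.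
by elim/ord3_ind: i; rewrite /cross /vec3 /= polarB !polarM !polar_vec; ring.
Qed.

Lemma polar_d (j k : 'I_p) : polar j k d =
  (nat_of_ord k == 0)%:R * det3 (vec j) s v + (nat_of_ord k == 1%N)%:R * det3 x (vec j) v
  + (nat_of_ord k == 2%N)%:R * det3 x s (vec j).
Proof.
rewrite /det3 /dot !polarD !polarM !polar_y !polar_vec.
by rewrite /cross /vec3 /=; ring.
Qed.

Lemma cross_self (a : 'I_3 -> poly) i : cross a a i = 0.
Proof. by elim/ord3_ind: i; rewrite /cross /vec3 /=; ring. Qed.

Lemma det3_12 (a b : 'I_3 -> poly) : det3 a a b = 0.
Proof. by rewrite /det3 /dot !cross_self; ring. Qed.
Lemma det3_13 (a b : 'I_3 -> poly) : det3 a b a = 0.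
Proof. by rewrite /det3 /dot /cross /vec3 /=; ring. Qed.
Lemma det3_23 (a b : 'I_3 -> poly) : det3 a b b = 0.
Proof. by rewrite /det3 /dot /cross /vec3 /=; ring. Qed.

Lemma Emx_hwm0 (j k : 'I_p) h m n c : k = 0%N :> nat ->
  E j k (hwm h m n c) = (det3 (vec j) s v * (c%:R * d ^+ c.-1)) *: fam h m n x y
    + d ^+ c *: (fam_x h m n (vec j) x y + fam_y h m n (cross (vec j) s) x y).
Proof.
move=> ek; apply: polar_fam => [i|i|]; rewrite /= ?polar_vec ?polar_y ?polar_d ek /=; ring.
Qed.

Lemma Emx_hwm1 (j k : 'I_p) h m n c : k = 1%N :> nat ->
  E j k (hwm h m n c) = (det3 x (vec j) v * (c%:R * d ^+ c.-1)) *: fam h m n x y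
    + d ^+ c *: fam_y h m n (cross x (vec j)) x y.
Proof.
move=> ek; rewrite -[fam_y _ _ _ _ _ _]add0r -(fam_x0 h m n x y).
apply: polar_fam => [i|i|]; rewrite /= ?polar_vec ?polar_y ?polar_d ek /=; ring.
Qed.

Lemma Emx_hwm2 (j k : 'I_p) h m n c : k = 2%N :> nat ->
  E j k (hwm h m n c) = (det3 x s (vec j) * (c%:R * d ^+ c.-1)) *: fam h m n x y.
Proof.
move=> ek; rewrite (@polar_fam j k c h m n (fun=> 0) (fun=> 0) (det3 x s (vec j))).
- by rewrite fam_x0 fam_y0 addr0 scaler0 addr0.
- by move=> i; rewrite /= polar_vec ek /=; ring.
- by move=> i; rewrite /= polar_y ek /=; ring.
- by rewrite polar_d ek /=; ring.
Qed.

Lemma t_hwm_1 (i2 : 'I_p) h m n c : i2 = 1%N :> nat -> V (t i2 * hwm h m n c).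
Proof.
move=> e2; have p0 : (0 < p)%N by apply: leq_ltn_trans (ltn_ord i2).
pose i1 : 'I_p := Ordinal p0.
(* The gap between the first two weights of [hwm h m n c] is its degree in [x]. *)
apply: (submod_t2 charK0 hV (i1 := i1) (al := (2 * m + degx h)%N)); first exact: t_hwm_0.
rewrite Emx_hwm0 // e2 det3_12 mul0r scale0r add0r.
have -> : fam_y h m n (cross s s) x y = 0.
  by rewrite (eq_fam_y _ _ _ _ _ (cross_self s)) fam_y0.
rewrite addr0 (tgen_vec (m := 0)) // (tgen_vec e2) /hwm fam_w2.
apply: V_scaleD; first by apply: qr_stable_term; apply: qr_stable_skewz.
by apply: qr_stable_term1; apply: qr_stable_curlx.
Qed.

Lemma t_hwm_2 (i3 : 'I_p) h m n c : i3 = 2%N :> nat -> V (t i3 * hwm h m n c).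
Proof.
move=> e3; have p1 : (1 < p)%N by apply: leq_trans (ltn_ord i3); rewrite e3.
pose i1 : 'I_p := Ordinal (ltnW p1); pose i2 : 'I_p := Ordinal p1.
apply: (submod_t3 charK0 hV (i1 := i1) (i2 := i2) (al := (2 * m + degx h)%N)
  (be := (2 * n + degy h)%N)) => //; [exact: t_hwm_0|exact: t_hwm_1|].
have E32 : E i3 i2 (hwm h m n c) = d ^+ c *: fam_y h m n (cross x v) x y.
  by rewrite Emx_hwm1 // e3 det3_23 mul0r scale0r add0r.
have E31 : E i3 i1 (hwm h m n c) =
    d ^+ c *: (fam_x h m n v x y + fam_y h m n (cross v s) x y).
  by rewrite Emx_hwm0 // e3 det3_13 mul0r scale0r add0r.
have E21 : E i2 i1 (d ^+ c *: fam_y h m n (cross x v) x y) =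
    d ^+ c *: (fam_xy h m n s (cross x v) x y + fam_y h m n (cross s v) x y).
  have d0 : polar i2 i1 d = 0 by rewrite polar_d /= det3_12; ring.
  rewrite Emx_scale polar_exp d0 mulr0 scale0r add0r; congr (_ *: _).
  rewrite /Emx (der_fam_y (polarD i2 i1) (polarM i2 i1)) => [|i]; last first.
    by rewrite /= polar_y /= cross_self; ring.
  have ex : polar i2 i1 \o x =1 s by move=> i; rewrite /= polar_vec /=; ring.
  have ey : polar i2 i1 \o cross x v =1 cross s v.
    by move=> i; elim/ord3_ind: i; rewrite /cross /vec3 /= polarB !polarM !polar_vec /=; ring.
  by rewrite (eq_fam_xy _ _ _ _ _ _ ex) (eq_fam_y _ _ _ _ _ ey).
rewrite E31 E32 E21 (tgen_vec (k := i1) (m := 0)) // (tgen_vec (k := i2) (m := 1)) // (tgen_vec e3).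
(* The extra factor [d] from [fam_w3] makes the exponent c + 1 positive, as the terms with [skew y]
   and [bmx_curly] require. *)
rewrite /hwm fam_w3 -exprSr; apply: V_scaleB; last first.
  by apply: V_scaleMn; apply: V_scaleD;
    [apply: qr_stable_term; apply: qr_stable_skewy|apply: qr_stable_term1; apply: qr_stable_curly].
apply: V_scaleD; first apply: V_scaleD.
- by apply: qr_stable_term; apply: qr_stable_skewx_bmx_y.
- by apply: qr_stable_term; apply: qr_stable_skewx_bmx_x.
- by apply: qr_stable_term1; apply: qr_stable_skewx_bmx_lap.
Qed.

Lemma t_hwm_3 (i4 : 'I_p) h m n c : (2 < i4)%N -> V (t i4 * hwm h m n c).
Proof.
move=> lt2; have p2 : (2 < p)%N by apply: ltn_trans (ltn_ord i4).
pose i1 : 'I_p := Ordinal (ltnW (ltnW p2)); pose i2 : 'I_p := Ordinal (ltnW p2).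
pose i3 : 'I_p := Ordinal p2.
case: c => [|c].
  (* Without a factor [d] the third vector does not occur in the matrix, so [E i4 i3] acts on [t i3]
     alone. *)
  have -> : t i4 * hwm h m n 0 = E i4 i3 (t i3 * hwm h m n 0).
    by rewrite Emx_t Emx_hwm2 // mul0r mulr0 scale0r mulr0 addr0.
  by apply: (submodE charK0 hV); apply: t_hwm_2.
have eu c' : hwm h m n c'.+1 = d *: hwm h m n c' by rewrite /hwm exprS scalerA.
have zy a : a =1 (fun=> 0) -> fam_y h m n a x y = 0.
  by move=> e; rewrite (eq_fam_y _ _ _ _ _ e) fam_y0.
rewrite eu; apply: (submod_t4 charK0 hV (i1 := i1) (i2 := i2) (i3 := i3)
  (d1 := det3 (vec i4) s v) (d2 := det3 x (vec i4) v) (d3 := det3 x s (vec i4))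
  (al := (2 * m + degx h)%N) (be := (2 * n + degy h)%N) (n3 := c)); rewrite -?eu //.
- move=> r.
  have eX (i : 'I_p) : [/\ 'X_(tvar i o0) = - vec i o2, 'X_(tvar i o1) = vec i o1 &
      'X_(tvar i o2) = - vec i o0 :> poly].
    by rewrite vecE /tv /vec3 /= !opprK.
  have [a0 a1 a2] := eX i1; have [b0 b1 b2] := eX i2; have [c0 c1 c2] := eX i3.
  have [f0 f1 f2] := eX i4.
  by elim/ord3_ind: r; rewrite ?a0 ?a1 ?a2 ?b0 ?b1 ?b2 ?c0 ?c1 ?c2 ?f0 ?f1 ?f2 /=;
    rewrite /det3 /dot /cross /vec3 /=; ring.
- by rewrite polar_d /=; ring.
- by rewrite polar_d /=; ring.
- by rewrite polar_d /=; ring.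
- by rewrite polar_d /= det3_12; ring.
- by rewrite polar_d /= det3_13; ring.
- by rewrite polar_d /= det3_23; ring.
- by rewrite Emx_hwm1 //= det3_12 mul0r scale0r add0r zy ?scaler0 // => i; apply: cross_self.
- by rewrite Emx_hwm2 //= det3_13 mul0r scale0r.
- by rewrite Emx_hwm2 //= det3_23 mul0r scale0r.
- rewrite Emx_hwm0 //= fam_x_euler fam_y_euler /hwm -scalerDl -natrD !scalerA -scalerDl.
  congr (_ *: _); case: c {eu} => [|c]; rewrite /= ?exprS; first by rewrite !natrD; ring.
  by rewrite !natrD; ring.
- rewrite Emx_hwm1 //= fam_y_euler /hwm !scalerA -scalerDl.
  congr (_ *: _); case: c {eu} => [|c]; rewrite /= ?exprS; first by rewrite !natrD; ring.
  by rewrite !natrD; ring.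
- rewrite Emx_hwm2 //= /hwm !scalerA.
  congr (_ *: _); case: c {eu} => [|c]; rewrite /= ?exprS; first by ring.
  by ring.
- exact: t_hwm_0.
- exact: t_hwm_1.
- exact: t_hwm_2.
Qed.

Lemma t_hwm k h m n c : V (t k * hwm h m n c).
Proof.
case: (ltnP 2 k) => [|]; first exact: t_hwm_3.
case e : (nat_of_ord k) => [|[|[|//]]] _.
- exact: t_hwm_0.
- exact: t_hwm_1.
- exact: t_hwm_2.
Qed.

End Closure.

(** * Weights *)

Section Naturality.
Variables (R S : comNzRingType) (f : {rmorphism R -> S}).
Implicit Types (x y : 'I_3 -> R).

Lemma map_cross x y i : f (cross x y i) = cross (f \o x) (f \o y) i.
Proof. by elim/ord3_ind: i; rewrite /cross /vec3 /= rmorphB !rmorphM. Qed.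

Lemma map_dot x y : f (dot x y) = dot (f \o x) (f \o y).
Proof. by rewrite /dot !rmorphD !rmorphM. Qed.

Lemma map_outer x y : map_mx f (outer x y) = outer (f \o x) (f \o y).
Proof. by apply/matrixP => i j; rewrite !mxE rmorphM. Qed.

Lemma map_skew x : map_mx f (skew x) = skew (f \o x).
Proof.
by apply/matrixP => i j; elim/ord3_ind: i; elim/ord3_ind: j;
  rewrite !mxE /vec3 /= ?rmorphN ?rmorph0.
Qed.

Lemma map_bmx h x y : map_mx f (bmx h x y) = bmx h (f \o x) (f \o y).
Proof.
have ez : f \o cross x y =1 cross (f \o x) (f \o y) by move=> i; apply: map_cross.
case: h => /=; rewrite ?map_outer ?map_skew ?rmorph1 //.
- exact: eq_outer.
- exact: eq_outer.
Qed.

Lemma map_qr m n x y : f (qr m n x y) = qr m n (f \o x) (f \o y).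
Proof. by rewrite /qr rmorphM !rmorphXn !map_dot. Qed.

Lemma map_fam h m n x y : map_mx f (fam h m n x y) = fam h m n (f \o x) (f \o y).
Proof. by rewrite /fam map_mxZ map_qr map_bmx. Qed.

Lemma map_det3 x y z : f (det3 x y z) = det3 (f \o x) (f \o y) (f \o z).
Proof. by rewrite /det3 /dot !rmorphD !rmorphM !map_cross. Qed.

End Naturality.

Section Scaling.
Variable R : comNzRingType.
Implicit Types (x y z : 'I_3 -> R).

Lemma eq_dot x x' y y' : x =1 x' -> y =1 y' -> dot x y = dot x' y'.
Proof. by move=> ex ey; rewrite /dot !ex !ey. Qed.

Lemma eq_fam h m n x x' y y' : x =1 x' -> y =1 y' -> fam h m n x y = fam h m n x' y'.
Proof.
move=> ex ey; have ez := eq_cross ex ey.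
rewrite /fam /qr (eq_dot ex ex) (eq_dot ey ey); congr (_ *: _).
by case: h => /=; do ?[exact: eq_outer|exact: eq_skew].
Qed.

Lemma eq_det3 x x' y y' z z' : x =1 x' -> y =1 y' -> z =1 z' -> det3 x y z = det3 x' y' z'.
Proof. by move=> ex ey ez; apply: eq_dot => //; apply: eq_cross. Qed.

Lemma fam_scale h m n (a b : R) x y :
  fam h m n (fun i => a * x i) (fun i => b * y i) =
  (a ^+ (2 * m + degx h) * b ^+ (2 * n + degy h)) *: fam h m n x y.
Proof.
have eB : bmx h (fun i => a * x i) (fun i => b * y i) =
    (a ^+ degx h * b ^+ degy h) *: bmx h x y.
  case: h; rewrite /= ?expr0 ?expr1 ?mul1r ?mulr1 ?scale1r //;
    apply/matrixP => i j; rewrite !mxE;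
    by elim/ord3_ind: i; elim/ord3_ind: j; rewrite /cross /vec3 /=; ring.
rewrite /fam eB !scalerA; congr (_ *: _); rewrite /qr.
have -> : dot (fun i => a * x i) (fun i => a * x i) = a ^+ 2 * dot x x by rewrite /dot; ring.
have -> : dot (fun i => b * y i) (fun i => b * y i) = b ^+ 2 * dot y y by rewrite /dot; ring.
rewrite (exprD a (2 * m)) (exprD b (2 * n)) (exprM a 2) (exprM b 2).
by rewrite !exprMn; ring.
Qed.

End Scaling.

Section HighestWeightVectors.
Variables (K : fieldType) (p : nat).
Local Notation poly := (Defs.poly K p).
Local Notation mx3 := (mx3 K p).
Local Notation vec := (vec K p).
Local Notation hwm := (hwm K p).
Local Notation x := (vec 0).
Local Notation s := (vec 1).
Local Notation v := (vec 2).
Local Notation y := (cross x s).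
Local Notation d := (det3 x s v).

Lemma gact_poly_tv g (k : 'I_p) i :
  gact_poly g (tv K k i) = \sum_(l < p) (g l k)%:MP * tv K l i.
Proof.
elim/ord3_ind: i; rewrite /tv /vec3 /= ?rmorphN /= gact_polyX // -sumrN;
  by apply: eq_bigr => l _; rewrite mulrN.
Qed.

Lemma gact_hwm g (a b : 'I_3 -> poly) h m n c :
  gact_poly g \o x =1 a -> gact_poly g \o y =1 b -> 
  gact g (hwm h m n c) = gact_poly g d ^+ c *: fam h m n a b.
Proof.
move=> ea eb; rewrite /gact /hwm map_mxZ rmorphXn /=; congr (_ *: _).
by rewrite map_fam; apply: eq_fam.
Qed.

Lemma gact_vec_unitri (N : 'M[K]_p) m : upper_unitri N ->
  exists c : nat -> K, forall i,
    gact_poly N (vec m i) = vec m i + \sum_(l < m) (c l)%:MP * vec l i.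
Proof.
move=> [N1 N2]; case: (ltnP m p) => [lt_mp|le_pm]; last first.
  exists (fun=> 0) => i; rewrite vec_out //= rmorph0 big1 ?addr0 // => l _.
  by rewrite mpolyC0 mul0r.
pose k := Ordinal lt_mp; have vk : vec m = tv K k by rewrite -vecE.
exists (fun l => if insub l is Some o then N o k else 0) => i.
pose G (l : nat) := (if insub l is Some o then N o k else 0)%:MP * vec l i.
rewrite vk gact_poly_tv (eq_bigr (fun l : 'I_p => G l)); last first.
  by move=> l _; rewrite /G valK vecE.
rewrite -(big_mkord xpredT G) -(big_mkord xpredT G) (big_cat_nat (n := m)) ?(ltnW lt_mp) //=.
rewrite addrC; congr (_ + _); rewrite big_ltn // big_nat_cond big1 ?addr0 => [|l].
  by rewrite /G vk (_ : m = k) // valK N1 mpolyC1 mul1r.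
rewrite andbT => /andP[lt_ml _]; rewrite /G; case: insubP => [o _ eo|_].
  by rewrite N2 ?mpolyC0 ?mul0r //= eo.
by rewrite mpolyC0 mul0r.
Qed.

(** [x], [y], [d] are alternating in the first one, two and three vectors, and an upper
    unitriangular matrix adds to each vector a combination of earlier ones. *)
Lemma hwm_unipotent_fixed h m n c : unipotent_fixed (hwm h m n c).
Proof.
move=> N hN; have [c0 h0] := gact_vec_unitri 0 hN.
have [c1 h1] := gact_vec_unitri 1 hN; have [c2 h2] := gact_vec_unitri 2 hN.
have e0 : gact_poly N \o x =1 x by move=> i; rewrite /= h0 big_ord0 addr0.
have ey : gact_poly N \o y =1 y.
  move=> i; elim/ord3_ind: i; rewrite /= !(map_cross, rmorphB) /cross /vec3 /= ?rmorphM /= !h0 !h1;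
    by rewrite !big_ord_recr !big_ord0 /=; ring.
rewrite (gact_hwm _ _ _ _ e0 ey); congr (_ ^+ c *: _).
rewrite /det3 map_dot (eq_dot ey (frefl _)) /dot /= !h2 !big_ord_recr !big_ord0 /=.
by rewrite /cross /vec3 /=; ring.
Qed.

(** The default 1 makes the three-factor formula [torus_charE] hold for [p < 3] as well. *)
Definition dval (dd : 'rV[K]_p) (m : nat) : K := if insub m is Some k then dd 0 k else 1.

Lemma gact_vec_diag (dd : 'rV[K]_p) m i :
  gact_poly (diag_mx dd) (vec m i) = (dval dd m)%:MP * vec m i.
Proof.
case: (ltnP m p) => [lt_mp|le_pm]; last by rewrite vec_out //= rmorph0 mulr0.
have vk : vec m = tv K (Ordinal lt_mp) by rewrite -vecE.
rewrite /dval (insubT (fun k => k < p)%N lt_mp) vk gact_poly_tv (bigD1 (Ordinal lt_mp)) //=.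
rewrite big1 ?addr0 => [|l ne]; first by rewrite mxE eqxx mulr1n.
by rewrite mxE (negbTE ne) mulr0n mpolyC0 mul0r.
Qed.

Lemma torus_charE nu dd :
  torus_char nu dd = dval dd 0 ^+ pt1 nu * dval dd 1 ^+ pt2 nu * dval dd 2 ^+ pt3 nu.
Proof.
pose F (m : nat) := dval dd m ^+ ptk nu m.
have -> : torus_char nu dd = \prod_(0 <= m < p) F m.
  by rewrite big_mkord; apply: eq_bigr => k _; rewrite /F /dval valK.
have ext k : (p <= k)%N || (3 <= k)%N -> F k = 1.
  rewrite /F => /orP[le_pk|le_3k].
    by rewrite /dval insubF ?expr1n // ltnNge le_pk.
  by rewrite /ptk nth_default ?expr0.
(* The ranges up to [p] and up to 3 are both extended to [p + 3] by factors equal to 1. *)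
have widen q : (q == p) || (q == 3)%N -> \prod_(0 <= m < q) F m = \prod_(0 <= m < p + 3) F m.
  move=> hq; rewrite [RHS](big_cat_nat (n := q)) //=; last first.
    by case/orP: hq => /eqP ->; rewrite ?leq_addr ?leq_addl.
  rewrite [X in _ * X]big_nat_cond [X in _ * X]big1 ?mulr1 // => k.
  by rewrite andbT => /andP[le_qk _]; apply: ext; case/orP: hq le_qk => /eqP -> ->; rewrite ?orbT.
rewrite widen ?eqxx // -(widen 3) ?eqxx ?orbT //.
by rewrite !big_nat_recr // big_geq //= mul1r.
Qed.

(** [x], [y], [d] have weights (1,0,0), (1,1,0), (1,1,1), so [al], [be] and [c] are the successive
    gaps. *)
Definition wt h (m n c : nat) : part3 :=
  let al := (2 * m + degx h)%N in let be := (2 * n + degy h)%N in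
  ((al + be + c, be + c), c)%N.

Lemma hwm_torus h m n c dd :
  gact (diag_mx dd) (hwm h m n c) = mxsc (torus_char (wt h m n c) dd) (hwm h m n c).
Proof.
set a := dval dd 0; set b := dval dd 1; set e := dval dd 2.
have ex : gact_poly (diag_mx dd) \o x =1 (fun i => a%:MP * x i).
  by move=> i; apply: gact_vec_diag.
have ey : gact_poly (diag_mx dd) \o y =1 (fun i => (a * b)%:MP * y i).
  move=> i; elim/ord3_ind: i; rewrite /cross /vec3 /= rmorphB !rmorphM /= !gact_vec_diag;
    by rewrite -/a -/b; ring.
rewrite (gact_hwm _ _ _ _ ex ey) fam_scale.
have -> : gact_poly (diag_mx dd) d = (a * b * e)%:MP * d.
  rewrite /det3 map_dot (eq_dot ey (frefl _)) /dot /= !gact_vec_diag -/e !mpolyCM; ring.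
rewrite torus_charE /mxsc /hwm !scalerA -/a -/b -/e; congr (_ *: _).
rewrite /wt /pt1 /pt2 /pt3 /= exprMn !mpolyCM !rmorphXn /=.
by rewrite !exprMn !exprD; ring.
Qed.

End HighestWeightVectors.

(** * Highest weight vectors in F_p *)

Section AlgebraFp.
Variables (K : fieldType) (p : nat).
Hypothesis charK0 : [pchar K] =i pred0.
Local Notation poly := (Defs.poly K p).
Local Notation mx3 := (mx3 K p).
Local Notation Fp := (@inFp K p).
Local Notation t := (tgen K).
Local Notation vec := (vec K p).
Local Notation x := (vec 0).
Local Notation s := (vec 1).
Local Notation v := (vec 2).
Local Notation y := (cross x s).
Local Notation d := (det3 x s v).
Implicit Types (A B : mx3) (f : poly).

Lemma mxsc_mull c A B : mxsc c A * B = mxsc c (A * B).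
Proof. by rewrite /mxsc mx3_scaleAl. Qed.

Lemma mxsc_mulr c A B : A * mxsc c B = mxsc c (A * B).
Proof. by rewrite /mxsc mx3_scaleAr. Qed.

Lemma inFp_subspace : subspace Fp.
Proof.
split; first by exists [::]; rewrite big_nil.
  by move=> A B [s1 ->] [s2 ->]; exists (s1 ++ s2); rewrite big_cat.
move=> c A [s1 ->]; exists [seq (c * z.1, z.2) | z <- s1].
by rewrite big_map mxsc_sumr; apply: eq_bigr => z _; rewrite mxscA.
Qed.

Lemma inFp_word w : Fp (word K w).
Proof. by exists [:: (1, w)]; rewrite big_seq1 mxsc1. Qed.

Lemma inFp_t k : Fp (t k).
Proof. by have := inFp_word [:: k]; rewrite /word big_seq1. Qed.

Lemma inFp_1 : Fp 1.
Proof. by have := inFp_word [::]; rewrite /word big_nil. Qed.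

Lemma inFp_mul A B : Fp A -> Fp B -> Fp (A * B).
Proof.
move=> [s1 ->] [s2 ->]; rewrite mulr_suml; apply: (subsp_sum inFp_subspace) => z _.
rewrite mulr_sumr; apply: (subsp_sum inFp_subspace) => z' _.
rewrite mxsc_mull mxsc_mulr; do 2!apply: (subspZ inFp_subspace).
by rewrite /word -big_cat; apply: inFp_word.
Qed.

Lemma gact_t g k : gact g (t k) = \sum_(l < p) mxsc (g l k) (t l).
Proof.
apply/matrixP => i j; rewrite summxE.
rewrite (eq_bigr (fun l => (g l k)%:MP * t l i j)); last by move=> l _; rewrite mxscE.
rewrite /gact [LHS]mxE; under [RHS]eq_bigr do rewrite mxE; rewrite mxE.
case: ifP => _; first exact: gact_polyX.
case: ifP => _; last by rewrite rmorph0 big1 // => l _; rewrite mulr0.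
by rewrite rmorphN /= gact_polyX -sumrN; apply: eq_bigr => l _; rewrite mulrN.
Qed.

Lemma inFp_submodule : submodule Fp.
Proof.
split; first exact: inFp_subspace.
move=> g _ A [s1 ->]; rewrite gact_sum; apply: (subsp_sum inFp_subspace) => z _.
rewrite gact_sc; apply: (subspZ inFp_subspace).
elim: z.2 => [|k w IH]; rewrite /word ?big_nil ?big_cons.
  by rewrite rmorph1; apply: inFp_1.
rewrite gact_mul; apply: inFp_mul => //.
rewrite gact_t; apply: (subsp_sum inFp_subspace) => l _.
by apply: (subspZ inFp_subspace); apply: inFp_t.
Qed.

Lemma inFp_skew_vec m : Fp (skew (vec m)).
Proof.
case: (ltnP m p) => [lt_mp|le_pm]; last first.
  rewrite vec_out // (_ : skew _ = 0); first exact: (subsp0 inFp_subspace).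
  by apply/matrixP => i j; rewrite !mxE /vec3 oppr0; case: (val i) => [|[|?]]; case: (val j) => [|[|?]].
by rewrite -(@tgen_vec K p (Ordinal lt_mp) m erefl); apply: inFp_t.
Qed.

(* [t_1^3 = - dot x x *: t_1] makes [stableq] a two-sided ideal of F_p containing [t_1]. *)
Definition stableq A := forall m, Fp (dot x x ^+ m *: A).

Lemma stableq_Fp A : stableq A -> Fp A.
Proof. by move=> /(_ 0%N); rewrite expr0 scale1r. Qed.

Lemma stableqD A B : stableq A -> stableq B -> stableq (A + B).
Proof. by move=> hA hB m; rewrite scalerDr; apply: (subspD inFp_subspace). Qed.

Lemma stableqN A : stableq A -> stableq (- A).
Proof. by move=> hA m; rewrite scalerN; apply: (subspN inFp_subspace). Qed.

Lemma stableqB A B : stableq A -> stableq B -> stableq (A - B).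
Proof. by move=> hA hB; apply/stableqD/stableqN. Qed.

Lemma stableq_q A : stableq A -> stableq (dot x x *: A).
Proof. by move=> hA m; rewrite scalerA -exprSr; apply: hA. Qed.

Lemma stableq_qC f A : stableq (f *: A) -> stableq (f *: (dot x x *: A)).
Proof. by rewrite scalerA mulrC -scalerA; apply: stableq_q. Qed.

Lemma stableq_mull A B : Fp A -> stableq B -> stableq (A * B).
Proof. by move=> hA hB m; rewrite mx3_scaleAr; apply: inFp_mul. Qed.

Lemma stableq_mulr A B : stableq A -> Fp B -> stableq (A * B).
Proof. by move=> hA hB m; rewrite mx3_scaleAl; apply: inFp_mul. Qed.

Lemma stableqX : stableq (skew x).
Proof.
elim=> [|m IH]; first by rewrite expr0 scale1r; apply: inFp_skew_vec.
have -> : dot x x ^+ m.+1 *: skew x = - (skew x * (skew x * (dot x x ^+ m *: skew x))).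
  rewrite -!mx3_scaleAr -[skew x * skew x]/(skew x * bmx KSX x y) skewx_bmxE /skewx_bmx.
  rewrite mulrBr skewx_bmxE /= sub0r.
  by rewrite -mx3_scaleAr mulr1 scalerN opprK scalerA exprSr.
apply: (subspN inFp_subspace); apply: inFp_mul; first exact: inFp_skew_vec.
by apply: inFp_mul => //; apply: inFp_skew_vec.
Qed.

(** The cross product is the Lie bracket of so_3; this is how [skew y] gets into F_p. *)
Lemma skew_cross (R : comNzRingType) (a b : 'I_3 -> R) :
  skew (cross a b) = skew a * skew b - skew b * skew a.
Proof.
apply/matrixP => i j; elim/ord3_ind: i; elim/ord3_ind: j;
  by rewrite !mxE !sum3 !mxE /cross /vec3 /=; ring.
Qed.

Lemma inFp_skew_cross m n : Fp (skew (cross (vec m) (vec n))).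
Proof.
rewrite skew_cross; apply: (subspB inFp_subspace);
  by apply: inFp_mul; apply: inFp_skew_vec.
Qed.

Lemma stableqY : stableq (skew y).
Proof.
rewrite skew_cross; apply: stableqB.
- exact: stableq_mulr stableqX (inFp_skew_vec 1).
- exact: stableq_mull (inFp_skew_vec 1) stableqX.
Qed.

Lemma stableqYX : stableq (bmx KYX x y).
Proof.
have -> : bmx KYX x y = skew x * skew y.
  by rewrite -[skew y]/(bmx KSY x y) skewx_bmxE /skewx_bmx dot_xy scale0r subr0.
exact: stableq_mull (inFp_skew_vec 0) stableqY.
Qed.

Lemma stableqXY : stableq (bmx KXY x y).
Proof.
have -> : bmx KXY x y = skew y * skew x.
  by rewrite -[skew x]/(bmx KSX x y) skewy_bmxE /skewy_bmx dot_xy scale0r subr0.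
exact: stableq_mull (inFp_skew_cross 0 1) stableqX.
Qed.

Lemma stableqZX : stableq (bmx KZX x y).
Proof.
have -> : bmx KZX x y = skew x * bmx KYX x y by rewrite skewx_bmxE.
exact: stableq_mull (inFp_skew_vec 0) stableqYX.
Qed.

Lemma outer_skew (R : comNzRingType) (a b c : 'I_3 -> R) :
  outer a b * skew c = outer a (cross b c).
Proof.
apply/matrixP => i j; elim/ord3_ind: i; elim/ord3_ind: j;
  by rewrite !mxE !sum3 !mxE /cross /vec3 /=; ring.
Qed.

Lemma stableqYY : stableq (bmx KYY x y).
Proof.
(* Multiplying y x^T on the right by [skew s] turns the factor [x] into [cross x s], that is [y]. *)
rewrite /bmx -outer_skew; exact: stableq_mulr stableqYX (inFp_skew_vec 1).
Qed.

Lemma stableqZY : stableq (bmx KZY x y).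
Proof.
have -> : bmx KZY x y = skew x * bmx KYY x y by rewrite skewx_bmxE.
exact: stableq_mull (inFp_skew_vec 0) stableqYY.
Qed.

Lemma stableq_plain h : plain h -> stableq (bmx h x y).
Proof.
case: h => // _; [exact: stableqYY|exact: stableqX|exact: stableqY|exact: stableqXY
  |exact: stableqYX|exact: stableqZX|exact: stableqZY].
Qed.

Lemma stableq_r1 : stableq (dot y y *: 1).
Proof.
have -> : dot y y *: 1 = bmx KYY x y - skew y * skew y.
  by rewrite -[skew y * skew y]/(skew y * bmx KSY x y) skewy_bmxE /= opprB addrC subrK.
by apply: stableqB; [exact: stableqYY|apply: stableq_mull (inFp_skew_cross 0 1) stableqY].
Qed.

(** A product [skew u * skew w] is w u^T minus the scalar [dot u w]. Here each scalar is the
    determinant, and the three outer products add up to the determinant times 1, whence 1 - 3 =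
    -2. *)
Lemma det3_scalar (R : comNzRingType) (a b c : 'I_3 -> R) :
  - 2%:R *: (det3 a b c *: (1 : 'M[R]_3)) =
  skew a * skew (cross b c) + skew b * skew (cross c a) + skew c * skew (cross a b).
Proof.
apply/matrixP => i j; elim/ord3_ind: i; elim/ord3_ind: j;
  by rewrite !mxE !sum3 !mxE /det3 /dot /cross /vec3 /=; ring.
Qed.

Lemma stableq_d1 : stableq (d *: 1).
Proof.
(* Each of the three products contains [x] in one factor, possibly inside a commutator. *)
have h : stableq (- 2%:R *: (d *: 1)).
  rewrite det3_scalar; apply: stableqD; first apply: stableqD.
  - exact: stableq_mulr stableqX (inFp_skew_cross 1 2).
  - apply: stableq_mull (inFp_skew_vec 1) _; rewrite skew_cross; apply: stableqB.
      exact: stableq_mull (inFp_skew_vec 2) stableqX.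
    exact: stableq_mulr stableqX (inFp_skew_vec 2).
  - exact: stableq_mull (inFp_skew_vec 2) stableqY.
move=> m; have := subspN inFp_subspace (h m).
rewrite scaleNr scalerN opprK scalerA [_ * 2%:R]mulrC -scalerA -mpolyC_nat.
by apply: (subspZK inFp_subspace); rewrite ((pcharf0P K).1 charK0).
Qed.

Lemma scale_as_mul f A : f *: A = (f *: 1) * A.
Proof. by rewrite -mx3_scaleAl mul1r. Qed.

Lemma stableq_r A : stableq A -> stableq (dot y y *: A).
Proof.
by move=> hA; rewrite scale_as_mul; apply: stableq_mulr stableq_r1 (stableq_Fp hA).
Qed.

(** The scalar matrix [d] is itself in the ideal, so it carries all of F_p into the ideal. *)
Lemma stableq_d A : Fp A -> stableq (d *: A).
Proof. by move=> hA; rewrite scale_as_mul; apply: stableq_mulr stableq_d1 hA. Qed.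

Lemma stableq_ax : stableq (bmx KXX x y - dot x x *: 1).
Proof.
have -> : bmx KXX x y - dot x x *: 1 = skew x * skew x.
  by rewrite -[skew x * skew x]/(skew x * bmx KSX x y) skewx_bmxE.
exact: stableq_mull (inFp_skew_vec 0) stableqX.
Qed.

Lemma stableq_rd n c A : stableq A -> stableq ((d ^+ c * dot y y ^+ n) *: A).
Proof.
move=> hA; elim: c => [|c IH]; last first.
  rewrite exprS -mulrA -scalerA; apply: stableq_d; exact: stableq_Fp.
rewrite expr0 mul1r; elim: n => [|n IH]; first by rewrite expr0 scale1r.
by rewrite exprS -scalerA; apply: stableq_r.
Qed.

Lemma inFp_hwm h m n c : allowed h m n c -> Fp (hwm K p h m n c).
Proof.
have key A : stableq A -> Fp ((d ^+ c * qr m n x y) *: A).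
  move=> hA; have := stableq_rd n c hA m; rewrite scalerA.
  by rewrite /qr mulrCA.
(* For the kinds outside [plain], one factor |y|^2 or [d] is set aside to bring the matrix into the
   ideal. *)
have key1 A : (0 < n)%N || (0 < c)%N -> stableq (dot y y *: A) -> stableq (d *: A) ->
    Fp ((d ^+ c * qr m n x y) *: A).
  move=> nc hr hd; case: (posnP n) nc => [-> /=|n0 _].
    move=> c0; have := stableq_rd 0 c.-1 hd m; rewrite !scalerA /qr.
    rewrite (_ : dot x x ^+ m * _ * d = d ^+ c * (dot x x ^+ m * dot y y ^+ 0)) //.
    by rewrite -{2}(prednK c0) exprS; ring.
  have := stableq_rd n.-1 c hr m; rewrite !scalerA /qr.
  rewrite (_ : dot x x ^+ m * _ * dot y y = d ^+ c * (dot x x ^+ m * dot y y ^+ n)) //.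
  by rewrite -{2}(prednK n0) exprS; ring.
rewrite hwmE; case: (boolP ((0 < n) || (0 < c))%N) => [nc _|nc].
  case: (boolP (plain h)) => [/stableq_plain|]; first exact: key.
  have hd1 : stableq (d *: 1) := stableq_d1.
  have hr1 : stableq (dot y y *: 1) := stableq_r1.
  case: h => hh; try discriminate hh; first exact: (key1 1 nc hr1 hd1).
  have eXX : bmx KXX x y = (bmx KXX x y - dot x x *: 1) + dot x x *: 1 by rewrite subrK.
  apply: (key1 _ nc); rewrite eXX scalerDr; apply: stableqD.
  - exact: stableq_r stableq_ax.
  - exact: stableq_qC hr1.
  - exact: stableq_d (stableq_Fp stableq_ax).
  - exact: stableq_qC hd1.
rewrite /allowed orbA (negbTE nc) /=.
case: (boolP (plain h)) => [/stableq_plain hp _|]; first exact: key.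
move: nc; rewrite negb_or -!leqNgt !leqn0 => /andP[/eqP -> /eqP ->].
case: h => hh; try discriminate hh; last by [].
move/eqP=> ->; rewrite /qr !expr0 !mul1r scale1r; exact: inFp_1.
Qed.

End AlgebraFp.

(** * Multiplicities *)

Definition kinds := [:: K1; KXX; KYY; KSX; KSY; KXY; KYX; KZX; KZY].

Definition kind_code h : nat :=
  match h with
  | K1 => 0 | KXX => 1 | KYY => 2 | KSX => 3 | KSY => 4 | KXY => 5 | KYX => 6 | KZX => 7 | KZY => 8
  end.

Lemma kind_codeK : cancel kind_code (nth K1 kinds). Proof. by case. Qed.

HB.instance Definition _ := Equality.copy kind (can_type kind_codeK).

Lemma mem_kinds h : h \in kinds. Proof. by case: h. Qed.

(* The kinds [h] for which some [fam h m n] has bidegree [(al, be)]; then [m] and [n] are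
   determined by [h]. *)
Definition kinds_of_degree (al be : nat) : seq kind :=
  [seq h <- kinds | [&& (degx h <= al)%N, (degy h <= be)%N,
                        ~~ odd (al - degx h) & ~~ odd (be - degy h)]].

Lemma uniq_kinds_of_degree al be : uniq (kinds_of_degree al be).
Proof. exact: filter_uniq. Qed.

Lemma even_half (a b : nat) : (b <= a)%N -> ~~ odd (a - b) ->
  a = (2 * (a - b)./2 + b)%N.
Proof. by move=> le_ba ev; rewrite mul2n even_halfK // subnK. Qed.

Lemma mem_kinds_of_degree al be h : h \in kinds_of_degree al be ->
  al = (2 * (al - degx h)./2 + degx h)%N /\ be = (2 * (be - degy h)./2 + degy h)%N.
Proof. by rewrite mem_filter => /andP[/and4P[? ? ? ?] _]; split; apply: even_half. Qed.

Lemma kinds_of_degree_mem h m n : h \in kinds_of_degree (2 * m + degx h) (2 * n + degy h).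
Proof. by rewrite mem_filter mem_kinds !leq_addl !addnK !oddM. Qed.

Definition exceptional (nu : part3) : bool :=
  (pt2 nu == 0%N) && (pt3 nu == 0%N) && (0 < pt1 nu)%N && ~~ odd (pt1 nu).

(** The kinds have degrees at most 2, so their number depends only on the parity of each gap and on
    whether it is 0, 1 or larger. The same data determine [mult_nu], which leaves finitely many
    cases. *)
Lemma size_kinds_of_degree al be c : ~~ exceptional ((al + be + c, be + c), c)%N ->
  mult_nu ((al + be + c, be + c), c)%N = size (kinds_of_degree al be).
Proof.
rewrite /exceptional /mult_nu /pt1 /pt2 /pt3 /= => /negbTE ->.
have -> : (be + c < al + be + c)%N = (0 < al)%N by rewrite -addnA -[X in (X < _)%N]add0n ltn_add2r.
have -> : (c < be + c)%N = (0 < be)%N by rewrite -[X in (X < _)%N]add0n ltn_add2r.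
have -> : (al + be + c == be + c)%N = (al == 0)%N by rewrite -addnA -[X in (_ == X)%N]add0n eqn_add2r.
have -> : (be + c == c)%N = (be == 0)%N by rewrite -[X in (_ == X)%N]add0n eqn_add2r.
rewrite !oddD /kinds_of_degree.
by case: al => [|[|al]]; case: be => [|[|be]]; rewrite /= ?subn0 ?subSS ?subn0 /=;
  try case: (odd al); try case: (odd be); case: (odd c).
Qed.

(** * Evaluation at a frame *)

Section Evaluation.
Variables (K : fieldType) (p : nat).
Local Notation mx3 := (mx3 K p).
Local Notation vec := (vec K p).
Local Notation hwm := (hwm K p).
Local Notation x := (vec 0).
Local Notation s := (vec 1).
Local Notation v := (vec 2).
Local Notation y := (cross x s).
Local Notation d := (det3 x s v).
Local Notation e0 := (unitv K o0).
Local Notation e2 := (unitv K o2).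

(* At this point [vec k] becomes the [k]-th standard basis vector. *)
Definition frame (i : 'I_(p * 3)) : K :=
  if (vk i + vr i == 2)%N then if vk i == 1%N :> nat then 1 else -1 else 0.

Definition ev_frame (A : mx3) : 'M[K]_3 := map_mx (mpoly.meval frame) A.

Lemma meval_vec k i : (k < p)%N -> mpoly.meval frame (vec k i) = (nat_of_ord i == k)%:R.
Proof.
move=> lt_kp; have -> : vec k = tv K (Ordinal lt_kp) by rewrite -vecE.
elim/ord3_ind: i; rewrite /tv /vec3 /= ?mevalN mevalXU /frame !(proj1 (tvarK _ _)) !(proj2 (tvarK _ _)) /=;
  by case: k lt_kp => [|[|[|k]]] lt_kp /=; rewrite ?opprK ?oppr0.
Qed.

(** At x = e_0 and y = e_2, where [cross x y] is -e_1, the nine matrices form a basis of the 3 by 3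
    matrices; these are the dual coordinates. *)
Definition bmx_coord h (A : 'M[K]_3) : K :=
  match h with
  | K1 => A o1 o1 | KXX => A o0 o0 - A o1 o1 | KYY => A o2 o2 - A o1 o1
  | KSX => A o2 o1 | KSY => - A o0 o1 | KXY => A o0 o2 | KYX => A o2 o0
  | KZX => - (A o1 o0 + A o0 o1) | KZY => - (A o1 o2 + A o2 o1)
  end.

Lemma bmx_coord_bmx h h' : bmx_coord h (bmx h' e0 e2) = (h == h')%:R.
Proof.
by case: h; case: h'; rewrite /bmx_coord /= !mxE /unitv /cross /vec3 /=; ring.
Qed.

Lemma bmx_coordB h A B : bmx_coord h (A - B) = bmx_coord h A - bmx_coord h B.
Proof. by case: h; rewrite /bmx_coord !mxE; ring. Qed.

Lemma bmx_coordZ h c A : bmx_coord h (c *: A) = c * bmx_coord h A.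
Proof. by case: h; rewrite /bmx_coord !mxE; ring. Qed.

Lemma bmx_coord_sum h I (r : seq I) (P : pred I) (F : I -> 'M[K]_3) :
  bmx_coord h (\sum_(i <- r | P i) F i) = \sum_(i <- r | P i) bmx_coord h (F i).
Proof.
apply: big_morph => [A B|]; last by case: h; rewrite /bmx_coord !mxE; ring.
by case: h; rewrite /bmx_coord !mxE; ring.
Qed.

(** Takes care of [p = 1], where [vec 1] is zero and [y] does not evaluate to e_2. *)
Lemma fam_y0E (R : comNzRingType) h m n (a b b' : 'I_3 -> R) :
  (2 * n + degy h = 0)%N -> fam h m n a b = fam h m n a b'.
Proof. by rewrite /fam /qr; case: n => // /eqP; case: h => //= _; rewrite !expr0. Qed.

Lemma ev_hwm h m n c : (0 < p)%N -> valid_part p (wt h m n c) ->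
  ev_frame (hwm h m n c) = bmx h e0 e2.
Proof.
move=> p0 /and3P[_ _]; rewrite /wt /pt1 /pt2 /pt3 /= => hv.
have ex : mpoly.meval frame \o x =1 e0 by move=> i; rewrite /= meval_vec // eq_sym.
have ey : (0 < 2 * n + degy h + c)%N -> mpoly.meval frame \o y =1 e2.
  move=> bc0; have p1 : (1 < p)%N.
    by apply: leq_trans hv; rewrite -!lt0n -addnA addn_gt0 bc0 orbT.
  move=> i; rewrite /= map_cross.
  by elim/ord3_ind: i; rewrite /cross /vec3 /= !meval_vec //= /unitv /=; ring.
have ed : mpoly.meval frame d ^+ c = 1.
  case: c hv ey => [|c] hv ey; first by rewrite expr0.
  have p2 : (2 < p)%N by apply: leq_trans hv; rewrite !addnS.
  have {}ey : mpoly.meval frame \o y =1 e2 by apply: ey; rewrite addnS.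
  rewrite /det3 map_dot (eq_dot ey (frefl _)).
  by rewrite /dot /= !meval_vec //= /unitv /= !mul0r !add0r mul1r expr1n.
rewrite /ev_frame /hwm map_mxZ rmorphXn /= ed scale1r map_fam.
rewrite (eq_fam _ _ _ ex (frefl _)).
have -> : fam h m n e0 (mpoly.meval frame \o y) = fam h m n e0 e2.
  case: (posnP (2 * n + degy h)) => [|h0]; first exact: fam_y0E.
  by apply: eq_fam => //; apply: ey; rewrite addn_gt0 h0.
have d0 : dot e0 e0 = 1 by rewrite /dot /unitv /=; ring.
have d2 : dot e2 e2 = 1 by rewrite /dot /unitv /=; ring.
by rewrite /fam /qr d0 d2 !expr1n mulr1 scale1r.
Qed.

End Evaluation.

Section HighestWeightFamily.
Variables (K : fieldType) (p : nat).
Hypothesis charK0 : [pchar K] =i pred0.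
Hypothesis p0 : (0 < p)%N.
Local Notation poly := (Defs.poly K p).
Local Notation mx3 := (mx3 K p).
Local Notation vec := (vec K p).
Local Notation hwm := (hwm K p).
Local Notation x := (vec 0).
Local Notation s := (vec 1).
Local Notation v := (vec 2).
Local Notation y := (cross x s).
Local Notation d := (det3 x s v).
Implicit Types (nu : part3) (i j : nat) (A : mx3).

Definition kind_of nu i : kind := nth K1 (kinds_of_degree (pt1 nu - pt2 nu) (pt2 nu - pt3 nu)) i.

(* For an exceptional [nu], i.e. (2k, 0, 0) with k > 0, only this difference is in F_p. *)
Definition hwv nu i : mx3 :=
  if exceptional nu then hwm KXX (pt1 nu).-2./2 0 0 - hwm K1 (pt1 nu)./2 0 0
  else let h := kind_of nu i in
    hwm h (pt1 nu - pt2 nu - degx h)./2 (pt2 nu - pt3 nu - degy h)./2 (pt3 nu).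

Lemma wt_gaps nu : valid_part p nu ->
  nu = ((pt1 nu - pt2 nu + (pt2 nu - pt3 nu) + pt3 nu, pt2 nu - pt3 nu + pt3 nu), pt3 nu)%N.
Proof.
by case: nu => [[a b] c] /and3P[/= h1 h2 _]; rewrite -addnA !subnK.
Qed.

Lemma mult_nuE nu : valid_part p nu -> ~~ exceptional nu ->
  mult_nu nu = size (kinds_of_degree (pt1 nu - pt2 nu) (pt2 nu - pt3 nu)).
Proof. by move=> hnu; rewrite {1 2}(wt_gaps hnu); apply: size_kinds_of_degree. Qed.

Lemma mult_exceptional nu : exceptional nu -> mult_nu nu = 1%N.
Proof. by rewrite /exceptional /mult_nu => ->. Qed.

Lemma exceptional_even nu : exceptional nu ->
  exists m, nu = ((2 * m.+1, 0), 0)%N.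
Proof.
case: nu => [[a b] c]; rewrite /exceptional /pt1 /pt2 /pt3 /= => /andP[/andP[/andP[/eqP -> /eqP ->]]].
case: a => [|[|a]] //= _; rewrite negbK => ev; exists a./2.
by rewrite mulnS mul2n even_halfK.
Qed.

Lemma hwv_exceptional m i : hwv ((2 * m.+1, 0), 0)%N i = hwm KXX m 0 0 - hwm K1 m.+1 0 0.
Proof.
have ex : exceptional ((2 * m.+1, 0), 0)%N by rewrite /exceptional /pt1 /pt2 /pt3 [_.1.1]/= muln_gt0 oddM.
have e1 : ((2 * m.+1)./2 = m.+1)%N by rewrite mul2n doubleK.
have e2 : ((2 * m.+1).-2./2 = m)%N by rewrite mul2n /= doubleK.
by rewrite /hwv ex [(pt1 _).-2./2]e2 [(pt1 _)./2]e1.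
Qed.

Lemma wt_exc1 m : wt K1 m 0 0 = ((2 * m, 0), 0)%N.
Proof. by rewrite /wt !addn0. Qed.

Lemma wt_excXX m : wt KXX m 0 0 = ((2 * m.+1, 0), 0)%N.
Proof. by rewrite /wt !addn0 mulnS addnC. Qed.

Lemma hwv_hwm nu i : idxJ p (nu, i) -> ~~ exceptional nu ->
  exists h m n c, [/\ h = kind_of nu i, wt h m n c = nu & hwv nu i = hwm h m n c].
Proof.
move=> /andP[/= hnu hi] ex; rewrite /hwv (negbTE ex) /=; set h := kind_of nu i.
exists h, (pt1 nu - pt2 nu - degx h)./2, (pt2 nu - pt3 nu - degy h)./2, (pt3 nu).
split=> //; have /mem_kinds_of_degree[e1 e2] : h \in kinds_of_degree (pt1 nu - pt2 nu) (pt2 nu - pt3 nu).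
  by apply: mem_nth; rewrite -mult_nuE.
by rewrite /wt -e1 -e2 -wt_gaps.
Qed.

(** The vector of an exceptional weight also has a component along 1; its coordinate along x x^T is
    the one equal to 1. *)
Definition coef_hwv nu i A : K :=
  bmx_coord (if exceptional nu then KXX else kind_of nu i) (ev_frame A).

Lemma coef_hwv_sum nu i I (r : seq I) (P : pred I) (c : I -> K) (F : I -> mx3) :
  coef_hwv nu i (\sum_(k <- r | P k) mxsc (c k) (F k)) =
  \sum_(k <- r | P k) c k * coef_hwv nu i (F k).
Proof.
rewrite /coef_hwv /ev_frame raddf_sum /= bmx_coord_sum; apply: eq_bigr => k _.
by rewrite /mxsc map_mxZ /= mevalC bmx_coordZ.
Qed.

Lemma bmx_coord_evB h A B MA MB : ev_frame A = MA -> ev_frame B = MB ->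
  bmx_coord h (ev_frame (A - B)) = bmx_coord h MA - bmx_coord h MB.
Proof. by move=> <- <-; rewrite /ev_frame map_mxB bmx_coordB. Qed.

Lemma coef_hwvE nu i j : idxJ p (nu, i) -> idxJ p (nu, j) ->
  coef_hwv nu i (hwv nu j) = (i == j)%:R.
Proof.
move=> hi hj; rewrite /coef_hwv; case: (boolP (exceptional nu)) => ex.
  have hnu := (andP hi).1; rewrite /= in hnu.
  have lt1 k : idxJ p (nu, k) -> k = 0%N by rewrite /idxJ /= mult_exceptional // => /andP[_]; case: k.
  rewrite (lt1 _ hi) (lt1 _ hj).
  have [m em] := exceptional_even ex; rewrite em hwv_exceptional.
  have h1 : valid_part p (wt K1 m.+1 0 0) by rewrite wt_exc1 -em.
  have hXX : valid_part p (wt KXX m 0 0) by rewrite wt_excXX -em.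
  by rewrite (bmx_coord_evB _ (ev_hwm K p0 hXX) (ev_hwm K p0 h1)) !bmx_coord_bmx subr0 eqxx.
have [h [m [n [c [eh ew ->]]]]] := hwv_hwm hj ex.
have hnu := (andP hi).1; rewrite /= in hnu.
rewrite ev_hwm ?ew // bmx_coord_bmx eh /kind_of nth_uniq ?uniq_kinds_of_degree // -mult_nuE //.
  by case/andP: hi.
by case/andP: hj.
Qed.

Lemma hwv_neq0 nu i : idxJ p (nu, i) -> hwv nu i <> 0.
Proof.
move=> hi e; have := coef_hwvE hi hi; rewrite e eqxx /coef_hwv /ev_frame rmorph0.
have l0 h : bmx_coord h (0 : 'M[K]_3) = 0 by case: h; rewrite /bmx_coord !mxE; ring.
by rewrite l0 => /esym/eqP; rewrite oner_eq0.
Qed.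

Lemma gact_eigenB g a A B :
  gact g A = mxsc a A -> gact g B = mxsc a B -> gact g (A - B) = mxsc a (A - B).
Proof. by move=> eA eB; rewrite gactB eA eB mxscBr. Qed.

Lemma hw_hwv nu i : idxJ p (nu, i) -> hw_vector nu (hwv nu i).
Proof.
move=> hi; split; first exact: hwv_neq0.
  move=> dd _; case: (boolP (exceptional nu)) => [/exceptional_even[m ->]|ex].
    rewrite hwv_exceptional; apply: gact_eigenB.
      by have := hwm_torus KXX m 0 0 dd; rewrite wt_excXX.
    by have := hwm_torus K1 m.+1 0 0 dd; rewrite wt_exc1.
  by have [h [m [n [c [_ ew ->]]]]] := hwv_hwm hi ex; rewrite hwm_torus ew.
move=> N N1 N2; case: (boolP (exceptional nu)) => [/exceptional_even[m ->]|ex].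
  rewrite hwv_exceptional -[RHS]mxsc1; apply: gact_eigenB; rewrite mxsc1; exact: hwm_unipotent_fixed.
by have [h [m [n [c [_ _ ->]]]]] := hwv_hwm hi ex; rewrite hwm_unipotent_fixed.
Qed.

Lemma exceptional_hwmE m :
  hwm KXX m 0 0 - hwm K1 m.+1 0 0 = qr m 0 x y *: (bmx KXX x y - dot x x *: 1).
Proof.
by rewrite !hwmE expr0 !mul1r scalerBr scalerA /qr !expr0 !mulr1 exprSr.
Qed.

Lemma allowed_exceptional h m n c : allowed h m n c -> ~~ exceptional (wt h m n c).
Proof.
rewrite /exceptional /wt /pt1 /pt2 /pt3 /= addn_eq0 /allowed.
case: (posnP n) => [->|]; last by case: n.
case: (posnP c) => [->|] //=; last by case: c => //= c _; rewrite andbF.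
by rewrite !addn0; case: h; rewrite /degx /degy ?addn0 ?(oddD _ 1) ?oddM ?andbF // => /eqP ->.
Qed.

Lemma inFp_hwv nu i : idxJ p (nu, i) -> inFp (hwv nu i).
Proof.
move=> hi; case: (boolP (exceptional nu)) => [/exceptional_even[m ->]|ex].
  rewrite hwv_exceptional exceptional_hwmE /qr expr0 mulr1; exact: (@stableq_ax K p m).
have [h [m [n [c [_ ew ->]]]]] := hwv_hwm hi ex; apply: inFp_hwm => //.
move: ex; rewrite -ew /exceptional /wt /pt1 /pt2 /pt3 /allowed.
case: (posnP n) => [->|] //; case: (posnP c) => [->|] //.
by rewrite !addn0; case: h {ew}; rewrite /degx /degy ?addn0 ?(oddD _ 2) ?oddM ?addn2 //; case: m.
Qed.

(** More than [p] nonzero parts means that a vector beyond the range, hence zero, enters [y] or [d].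
    In this way [p < 3] merges into the general case. *)
Lemma hwm_invalid h m n c : ~~ valid_part p (wt h m n c) -> hwm h m n c = 0.
Proof.
rewrite /valid_part /wt /pt1 /pt2 /pt3 /= leq_add2r !leq_addl /= => hv.
have zv k (a : 'I_3 -> poly) : (p <= k)%N -> cross a (vec k) =1 (fun=> 0).
  move=> le_pk i; rewrite vec_out //; elim/ord3_ind: i; rewrite /cross /vec3 /=; ring.
case: (posnP c) => [c0|c0].
  rewrite c0 !addn0 in hv *.
  have b0 : (0 < 2 * n + degy h)%N.
    rewrite lt0n; apply: contra hv => /eqP ->; rewrite /= !addn0.
    exact: leq_trans (leq_b1 _) p0.
  have p1 : (p <= 1)%N.
    rewrite leqNgt; apply: contra hv => p1; apply: leq_trans p1.
    by rewrite /= ?addn0; apply: (@leq_add _ _ 1 1); apply: leq_b1.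
  rewrite /hwm (eq_fam _ _ _ (frefl _) (zv 1%N x p1)).
  have -> : fam h m n x (fun=> 0) = 0; last by rewrite scaler0.
  rewrite /fam /qr; case: n b0 {hv} => [|n] b0; last first.
    have -> : dot (fun=> 0) (fun=> 0) = 0 :> poly by rewrite /dot; ring.
    by rewrite exprS mul0r mulr0 scale0r.
  rewrite (_ : bmx _ _ _ = 0) ?scaler0 //; case: h b0 => // _ /=;
    by apply/matrixP => i j; rewrite !mxE /cross /vec3; elim/ord3_ind: i; elim/ord3_ind: j => /=; ring.
have p2 : (p <= 2)%N.
  rewrite leqNgt; apply: contra hv => p2; apply: leq_trans p2.
  by rewrite /= ?addn0; apply: (@leq_add _ _ 1 2); [apply: leq_b1|apply: (@leq_add _ _ 1 1); apply: leq_b1].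
rewrite /hwm (_ : d = 0) ?expr0n ?eqn0Ngt ?c0 ?scale0r //.
by rewrite /det3 /dot (vec_out K p2); ring.
Qed.

Lemma hwm_hwv h m n c : allowed h m n c -> valid_part p (wt h m n c) ->
  exists2 i, idxJ p (wt h m n c, i) & hwm h m n c = hwv (wt h m n c) i.
Proof.
move=> ha hv; have ex := allowed_exceptional ha.
have e1 : (pt1 (wt h m n c) - pt2 (wt h m n c) = 2 * m + degx h)%N.
  by rewrite /wt /pt1 /pt2 /= -addnA addnK.
have e2 : (pt2 (wt h m n c) - pt3 (wt h m n c) = 2 * n + degy h)%N.
  by rewrite /wt /pt2 /pt3 /= addnK.
exists (index h (kinds_of_degree (2 * m + degx h) (2 * n + degy h))).
  by rewrite /idxJ /= hv mult_nuE // e1 e2 index_mem kinds_of_degree_mem.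
have ek : kind_of (wt h m n c) (index h (kinds_of_degree (2 * m + degx h) (2 * n + degy h))) = h.
  by rewrite /kind_of e1 e2 nth_index ?kinds_of_degree_mem.
have f1 : (pt1 (wt h m n c) - pt2 (wt h m n c) - degx h)./2 = m by rewrite e1 addnK mul2n doubleK.
have f2 : (pt2 (wt h m n c) - pt3 (wt h m n c) - degy h)./2 = n by rewrite e2 addnK mul2n doubleK.
by rewrite /hwv (negbTE ex) ek f1 f2.
Qed.

End HighestWeightFamily.

(** * Rational structure of the highest weight vectors *)

Section Rationality.
Variables (K F : fieldType) (p : nat) (phi : {rmorphism F -> K}).

Lemma ratmap_hwm h m n c : hwm K p h m n c = ratmap phi (hwm F p h m n c).
Proof.
have ev k : map_mpoly phi \o vec F p k =1 vec K p k.
  move=> i; case: (ltnP k p) => [lt_kp|le_pk]; last by rewrite !vec_out //= rmorph0.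
  have vk L : vec L p k = tv L (Ordinal lt_kp) by rewrite -vecE.
  by rewrite !vk /=; elim/ord3_ind: i; rewrite /tv /vec3 /= ?rmorphN /= map_mpolyX.
have ey : map_mpoly phi \o cross (vec F p 0) (vec F p 1) =1 cross (vec K p 0) (vec K p 1).
  by move=> i; rewrite /= map_cross; apply: eq_cross.
rewrite /hwm /ratmap map_mxZ map_fam rmorphXn /= map_det3.
by rewrite (eq_det3 (ev 0%N) (ev 1%N) (ev 2%N)) (eq_fam _ _ _ (ev 0%N) ey).
Qed.

Lemma ratmap_hwv nu i : hwv K p nu i = ratmap phi (hwv F p nu i).
Proof.
rewrite /hwv; case: ifP => _; last exact: ratmap_hwm.
rewrite rmorphB; congr (_ - _); exact: ratmap_hwm.
Qed.

End Rationality.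

(** * The decomposition *)

Section FamilySum.
Variables (K : fieldType) (p : nat) (J : eqType) (D : pred J) (U : J -> mx3 K p -> Prop).
Hypothesis hU : forall j, submodule (U j).
Local Notation mx3 := (mx3 K p).

Definition family_sum (A : mx3) := exists (s : seq J) (u : J -> mx3),
  [/\ uniq s, all D s, (forall j, j \in s -> U j (u j)) & A = \sum_(j <- s) u j].

Lemma sum_undup_subset (s s' : seq J) (u : J -> mx3) : uniq s -> uniq s' -> {subset s <= s'} ->
  \sum_(j <- s') (if j \in s then u j else 0) = \sum_(j <- s) u j.
Proof.
move=> us us' ss'; rewrite -big_mkcond -big_filter; apply: perm_big.
apply: uniq_perm => [||j]; rewrite ?filter_uniq //.
by rewrite mem_filter; case: (boolP (j \in s)) => [/ss'|].
Qed.

Lemma family_sum_submodule : submodule family_sum.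
Proof.
split; first split.
- by exists [::], (fun=> 0); split; rewrite ?big_nil.
- move=> A B [s1 [u1 [us1 D1 h1 ->]]] [s2 [u2 [us2 D2 h2 ->]]].
  (* Both families are extended by 0 to the merged index set, where they add pointwise. *)
  exists (undup (s1 ++ s2)),
    (fun j => (if j \in s1 then u1 j else 0) + (if j \in s2 then u2 j else 0)); split.
  + exact: undup_uniq.
  + by rewrite all_undup all_cat D1.
  + move=> j _; apply: (subspD (hU j).1); case: ifP => hj; try exact: (subsp0 (hU j).1).
      exact: h1.
    exact: h2.
  + rewrite big_split /= !sum_undup_subset ?undup_uniq // => j hj;
      by rewrite mem_undup mem_cat hj ?orbT.
- move=> c A [s [u [us Ds h ->]]]; exists s, (fun j => mxsc c (u j)); split=> //.
    by move=> j hj; apply: (subspZ (hU j).1); apply: h.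
  exact: mxsc_sumr.
- move=> g ug A [s [u [us Ds h ->]]]; exists s, (fun j => gact g (u j)); split=> //.
    by move=> j hj; apply: (hU j).2 => //; apply: h.
  exact: gact_sum.
Qed.

Lemma family_sum_incl j A : D j -> U j A -> family_sum A.
Proof.
move=> Dj UA; exists [:: j], (fun=> A); split; rewrite ?big_seq1 //= ?Dj //.
by move=> k; rewrite inE => /eqP ->.
Qed.

End FamilySum.

Section Decomposition.
Variables (K : fieldType) (p : nat).
Hypothesis charK0 : [pchar K] =i pred0.
Hypothesis p0 : (0 < p)%N.
Local Notation mx3 := (mx3 K p).
Local Notation hwm := (hwm K p).
Local Notation t := (tgen K).

Definition hw_component (j : part3 * nat) : mx3 -> Prop := gspan (hwv K p j.1 j.2).
Local Notation S := (family_sum (@idxJ p) hw_component).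

Lemma hw_component_submodule j : submodule (hw_component j).
Proof. exact: gspan_submodule. Qed.

Let hS : submodule S := family_sum_submodule _ hw_component_submodule.

Lemma S_hwv nu i : idxJ p (nu, i) -> S (hwv K p nu i).
Proof. by move=> hj; apply: (family_sum_incl hj); apply: gspan_id. Qed.

Lemma S_hwm h m n c : allowed h m n c -> S (hwm h m n c).
Proof.
move=> ha; case: (boolP (valid_part p (wt h m n c))) => hv.
  by have [i hi ->] := hwm_hwv K ha hv; apply: S_hwv.
by rewrite hwm_invalid //; apply: (subsp0 hS.1).
Qed.

Lemma S_ax m : S (qr m 0 (vec K p 0) (cross (vec K p 0) (vec K p 1)) *:
  (bmx KXX (vec K p 0) (cross (vec K p 0) (vec K p 1)) -
   dot (vec K p 0) (vec K p 0) *: 1)).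
Proof.
rewrite -exceptional_hwmE -(hwv_exceptional K p m 0); apply: S_hwv.
rewrite /idxJ mult_exceptional; last by rewrite /exceptional /pt1 /pt2 /pt3 [_.1.1]/= muln_gt0 oddM.
by rewrite /valid_part /= p0.
Qed.

Lemma S_t_hwm k h m n c : S (t k * hwm h m n c).
Proof. by apply: (t_hwm charK0 hS); [exact: S_hwm|exact: S_ax]. Qed.

Lemma S_t_hwv k nu i : S (t k * hwv K p nu i).
Proof.
rewrite /hwv; case: ifP => _; last exact: S_t_hwm.
by rewrite mulrBr; apply: (subspB hS.1); apply: S_t_hwm.
Qed.

Lemma t_gact g k A : g \in unitmx ->
  t k * gact g A = gact g (\sum_(l < p) mxsc ((invmx g) l k) (t l * A)).
Proof.
move=> ug; have -> : \sum_(l < p) mxsc ((invmx g) l k) (t l * A) = gact (invmx g) (t k) * A.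
  by rewrite gact_t mulr_suml; apply: eq_bigr => l _; rewrite mxsc_mull.
by rewrite gact_mul -gactM mulmxV // gact1.
Qed.

(** By [t_gact] the matrices [B] with all products [t l * B] in the sum form a submodule, because
    the group permutes the combinations of the generators. Hence testing the highest weight vectors
    suffices. *)
Lemma S_t k A : S A -> S (t k * A).
Proof.
move=> [s [u [_ _ hu ->]]]; rewrite mulr_sumr big_seq; apply: (subsp_sum hS.1) => j /hu.
pose W (B : mx3) := forall l, S (t l * B).
suff hW : submodule W by move=> /(_ W hW) hj; apply: hj => l; apply: S_t_hwv.
split; first split.
- by move=> l; rewrite mulr0; apply: (subsp0 hS.1).
- by move=> B C hB hC l; rewrite mulrDr; apply: (subspD hS.1).
- by move=> c B hB l; rewrite mxsc_mulr; apply: (subspZ hS.1).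
move=> g ug B hB l; rewrite t_gact //; apply: hS.2 => //.
by apply: (subsp_sum hS.1) => i _; apply: (subspZ hS.1).
Qed.

Lemma S_1 : S 1.
Proof.
have -> : 1 = hwm K1 0 0 0; last exact: S_hwm.
by rewrite hwmE /qr !expr0 !mul1r scale1r.
Qed.

Lemma inFp_S A : inFp A -> S A.
Proof.
move=> [s ->]; apply: (subsp_sum hS.1) => z _; apply: (subspZ hS.1).
elim: z.2 => [|k w IH]; rewrite /word ?big_nil ?big_cons; first exact: S_1.
exact: S_t.
Qed.

Lemma hw_component_inFp j A : idxJ p j -> hw_component j A -> inFp A.
Proof.
by case: j => nu i hj; apply; [exact: inFp_submodule|exact: inFp_hwv].
Qed.

Lemma valid_ptk0 nu k : valid_part p nu -> (p <= k)%N -> ptk nu k = 0%N.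
Proof.
case: nu => [[a b] c] /and3P[]; rewrite /ptk /pt1 /pt2 /pt3 /= => ba cb hc le_pk.
have {}hc := leq_trans hc le_pk; have k0 := leq_trans p0 le_pk.
case: k k0 hc {le_pk} => [|[|[|k]]] //= _.
- case: b ba cb => [//|b]; case: a => [//|a] _ _; by rewrite /= !add1n.
- case: c cb => [//|c]; case: b ba => [//|b]; case: a => [//|a].
  by rewrite /= !add1n.
- by rewrite nth_nil.
Qed.

Lemma valid_part_neq nu nu' : valid_part p nu -> valid_part p nu' -> nu != nu' ->
  exists k : 'I_p, ptk nu k != ptk nu' k.
Proof.
move=> hnu hnu' ne; apply/existsP; apply: contraR ne => /existsPn h.
have e k : ptk nu k = ptk nu' k.
  case: (ltnP k p) => [lt_kp|le_pk]; last by rewrite !valid_ptk0.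
  by have := h (Ordinal lt_kp); rewrite negbK => /eqP.
move: (e 0%N) (e 1%N) (e 2%N); case: nu nu' {hnu hnu' h e} => [[a b] c] [[a' b'] c'].
by rewrite /ptk /pt1 /pt2 /pt3 /= => -> -> ->.
Qed.

Variable phi : {rmorphism rat -> K}.

(** Different weights are orthogonal, so by descent a vanishing combination vanishes weight by
    weight; within one weight the coordinates at the frame separate the vectors. *)
Lemma hwv_lin_indep r (j : 'I_r -> part3 * nat) (c : 'I_r -> K) :
  injective j -> (forall i, idxJ p (j i)) ->
  \sum_i mxsc (c i) (hwv K p (j i).1 (j i).2) = 0 -> forall i, c i = 0.
Proof.
move=> inj hj sum0 i0; pose u i := hwv K p (j i).1 (j i).2.
have hu i : hw_vector (j i).1 (u i) by apply: hw_hwv => //; case: (j i) (hj i).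
pose c' i := if (j i).1 == (j i0).1 then c i else 0.
have orth i l : (j i).1 != (j l).1 -> mform (u i) (u l) = 0.
  move=> ne; apply: (weights_orth charK0 (hu i) (hu l)).
  by apply: valid_part_neq ne; [case/andP: (hj i)|case/andP: (hj l)].
have w0 : \sum_i mxsc (c' i) (u i) = 0.
  have eu i : u i = ratmap phi (hwv rat p (j i).1 (j i).2) by apply: ratmap_hwv.
  have := @gram_nondegenerate K rat p phi (@mform_rat_eq0 p) r (fun i => hwv rat p (j i).1 (j i).2) c'.
  rewrite /= (eq_bigr (fun i => mxsc (c' i) (u i))); last by move=> i _; rewrite eu.
  apply=> l; rewrite -eu mform_suml.
  (* Against a vector of the kept weight the truncated sum pairs like the full one, which is 0;
     against any other vector every term is 0. *)
  case: (eqVneq (j l).1 (j i0).1) => el; last first.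
    rewrite big1 // => i _; rewrite mformZl /c'; case: eqP => [ei|_]; last by rewrite mul0r.
    by rewrite orth ?mulr0 // ei eq_sym.
  have := congr1 (fun A => mform A (u l)) sum0.
  rewrite /= mform_suml [mform 0 _]mformC mform0r => e0; apply: etrans e0.
  apply: eq_bigr => i _; rewrite !mformZl /c'; case: eqP => // /eqP ne.
  by rewrite orth ?mulr0 // el.
have := congr1 (@coef_hwv K p (j i0).1 (j i0).2) w0.
have hJ i : idxJ p ((j i).1, (j i).2) by rewrite -surjective_pairing.
(* The empty instance of [coef_hwv_sum] gives the value at the zero matrix. *)
have := @coef_hwv_sum K p (j i0).1 (j i0).2 'I_r [::] xpredT c u; rewrite !big_nil => ->.
rewrite coef_hwv_sum (bigD1 i0) //= big1 => [|i ne].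
  rewrite /u (coef_hwvE K p0 (hJ i0) (hJ i0)) // eqxx mulr1 addr0.
  by rewrite /c' eqxx.
rewrite /c'; case: eqP => [ei|_]; last by rewrite mul0r.
have hi : idxJ p ((j i0).1, (j i).2) by rewrite -ei.
rewrite /u ei (coef_hwvE K p0 (hJ i0) hi) //.
case: eqP => [e2|_]; last by rewrite mulr0.
case/eqP: ne; apply: inj; rewrite (surjective_pairing (j i)) (surjective_pairing (j i0)).
by rewrite ei e2.
Qed.

Lemma hw_component_independent (s : seq (part3 * nat)) (u : part3 * nat -> mx3) :
  uniq s -> all (idxJ p) s -> (forall j, j \in s -> hw_component j (u j)) ->
  \sum_(j <- s) u j = 0 -> forall j, j \in s -> u j = 0.
Proof.
move=> us /allP hs hu sum0 j hj; pose J i := tnth (in_tuple s) i.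
have hJ i : idxJ p (J i) by apply: hs; apply: mem_tnth.
have -> : j = J (Ordinal (etrans (index_mem j s) hj)).
  by rewrite /J (tnth_nth j) nth_index.
move: (Ordinal _) => i; move: i.
apply: (gspan_independent charK0 (@mform_rat_eq0 p) (phi := phi)
  (nu := fun i => (J i).1) (u := fun i => hwv K p (J i).1 (J i).2)).
- by move=> i; apply: hw_hwv => //; rewrite -surjective_pairing.
- by move=> i; exists (hwv rat p (J i).1 (J i).2); apply: ratmap_hwv.
- by move=> c; apply: hwv_lin_indep => // ; apply/tuple_uniqP.
- by move=> i; apply: hu; apply: mem_tnth.
- by rewrite big_tnth in sum0.
Qed.

End Decomposition.

Unset Implicit Arguments.

Theorem theorem4p1 (K : fieldType) (charK0 : [pchar K] =i pred0)
    (p : nat) (hp : (1 <= p)%N) :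
  exists U : part3 * nat -> mx3 K p -> Prop,
    [/\ (forall j, idxJ p j -> is_W j.1 (U j) /\ (forall A, U j A -> inFp A)),
        (forall A, inFp A ->
           exists (s : seq (part3 * nat)) (u : part3 * nat -> mx3 K p),
             [/\ uniq s, all (idxJ p) s, (forall j, j \in s -> U j (u j)) &
                 A = \sum_(j <- s) u j]) &
        (forall (s : seq (part3 * nat)) (u : part3 * nat -> mx3 K p),
           uniq s -> all (idxJ p) s -> (forall j, j \in s -> U j (u j)) ->
           \sum_(j <- s) u j = 0 -> forall j, j \in s -> u j = 0)].
Proof.
have [phi _] := exists_rat_morphism charK0.
exists (@hw_component K p); split.
- case=> nu i hj; have hw := hw_hwv K hp hj.
  split; last by move=> A; apply: hw_component_inFp.
  split; last by exists (hwv K p nu i); split=> //; apply: gspan_id.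
  apply: (gspan_irreducible charK0 (@mform_rat_eq0 p) hw (phi := phi)).
  by exists (hwv rat p nu i); apply: ratmap_hwv.
- by move=> A; apply: inFp_S.
- exact: hw_component_independent.
Qed.
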